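(* There exists a dense $G_\delta$ subset $E\subset[0,1]$ such that for every $\alpha\in E$, the closure $\overline{\mathcal{A}_\alpha}$ of $\mathcal{A}_\alpha$ in $(\mathrm{Diff}(\mathbb{T}^2),\tau)$ contains a subset which is dense in $\overline{\mathcal{A}_\alpha}$ and consists of diffeomorphisms that are minimal (every orbit is dense) and not ergodic with respect to Lebesgue measure on $\mathbb{T}^2$.
   Context: $\mathbb{T}^2=\mathbb{R}^2/\mathbb{Z}^2$. $\mathrm{Diff}(\mathbb{T}^2)$ is the set of real-analytic diffeomorphisms of $\mathbb{T}^2$ homotopic to the identity; each has a lift $F(x,y)=(x+f_1(x,y),y+f_2(x,y))$ with $f_1,f_2$ real-analytic and $\mathbb{Z}^2$-periodic. For $r>0$ let $A^r=\{(x,y)\in\mathbb{C}^2:|\mathrm{Im}\,x|<r,\ |\mathrm{Im}\,y|<r\}$, and let $\mathrm{Diff}_r(\mathbb{T}^2)$ be the set of those $F$ for which $f_1,f_2$ extend holomorphically to $A^r$ with finite sup norm; it carries the topology $\tau_r$ of the distance $|F-G|_r=\max_{i=1,2}\sup_{A^r}|f_i-g_i|$. The topology $\tau$ on $\mathrm{Diff}(\mathbb{T}^2)=\bigcup_{r>0}\mathrm{Diff}_r(\mathbb{T}^2)$ is the inductive limit topology: a set $O$ is open iff $O\cap\mathrm{Diff}_r(\mathbb{T}^2)$ is $\tau_r$-open for every $r>0$. $R_\alpha(x,y)=(x+\alpha,y)$. $\mathcal{A}_\alpha$ is the set of $F\in\mathrm{Diff}(\mathbb{T}^2)$ such that $F=T^{-1}\circ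 R_\alpha\circ T$ for some real-analytic area-preserving diffeomorphism $T$ of $\mathbb{T}^2$. *)

(* Defs.v *)
From Stdlib Require Import Reals ZArith.
From Coquelicot Require Coquelicot.
Open Scope R_scope.

Definition C : Type := Coquelicot.Complex.C.
Definition RtoC (x : R) : C := Coquelicot.Complex.RtoC x.
Definition Cmod (z : C) : R := Coquelicot.Complex.Cmod z.
Definition Cim (z : C) : R := Coquelicot.Complex.Im z.
Definition Cminus (z w : C) : C := Coquelicot.Complex.Cminus z w.

Definition strip (r : R) (z w : C) : Prop := Rabs (Cim z) < r /\ Rabs (Cim w) < r.

Definition C_differentiable_at (h : C -> C) (z : C) : Prop :=
  Coquelicot.Derive.ex_derive (K := Coquelicot.Complex.C_AbsRing)
    (V := Coquelicot.Complex.C_NormedModule) h z.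

(** holomorphic function of two complex variables on A^r (Osgood definition:
    jointly continuous and holomorphic in each variable separately) *)
Definition holo_on_strip (r : R) (g : C -> C -> C) : Prop :=
  (forall z w, strip r z w ->
     forall eps, 0 < eps -> exists delta, 0 < delta /\
       forall z' w', Cmod (Cminus z' z) < delta -> Cmod (Cminus w' w) < delta ->
         Cmod (Cminus (g z' w') (g z w)) < eps) /\
  (forall z w, strip r z w ->
     C_differentiable_at (fun u => g u w) z /\ C_differentiable_at (fun u => g z u) w).

Definition holo_ext_bounded_by (r : R) (f : R -> R -> R) (M : R) : Prop :=
  exists g : C -> C -> C, holo_on_strip r g /\
    (forall x y, g (RtoC x) (RtoC y) = RtoC (f x y)) /\
    (forall z w, strip r z w -> Cmod (g z w) <= M).

Definition holo_ext (r : R) (f : R -> R -> R) : Prop :=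
  exists M, holo_ext_bounded_by r f M.

Definition periodic2 (f : R -> R -> R) : Prop :=
  forall x y, f (x + 1) y = f x y /\ f x (y + 1) = f x y.

Definition disp1 (F : R * R -> R * R) (x y : R) : R := fst (F (x, y)) - x.
Definition disp2 (F : R * R -> R * R) (x y : R) : R := snd (F (x, y)) - y.

Definition lift_r (r : R) (F : R * R -> R * R) : Prop :=
  periodic2 (disp1 F) /\ periodic2 (disp2 F) /\
  holo_ext r (disp1 F) /\ holo_ext r (disp2 F).

(** real-analytic self-map of T^2 homotopic to the identity (given by its lift) *)
Definition analytic_lift (F : R * R -> R * R) : Prop :=
  exists r, 0 < r /\ lift_r r F.

(** Diff(T^2): lifts of real-analytic diffeomorphisms of T^2 homotopic to the identity
    (the inverse is again real-analytic) *)
Definition InDiff (F : R * R -> R * R) : Prop :=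
  analytic_lift F /\
  exists G, analytic_lift G /\ (forall p, F (G p) = p) /\ (forall p, G (F p) = p).

Definition Diff_r (r : R) (F : R * R -> R * R) : Prop := InDiff F /\ lift_r r F.

Definition dist_r_lt (r : R) (F G : R * R -> R * R) (eps : R) : Prop :=
  exists d, d < eps /\
    holo_ext_bounded_by r (fun x y => disp1 F x y - disp1 G x y) d /\
    holo_ext_bounded_by r (fun x y => disp2 F x y - disp2 G x y) d.

(** open sets of the inductive limit topology tau on Diff(T^2) *)
Definition tau_open (O : (R * R -> R * R) -> Prop) : Prop :=
  (forall F, O F -> InDiff F) /\
  forall r, 0 < r -> forall F, O F -> Diff_r r F ->
    exists eps, 0 < eps /\ forall G, Diff_r r G -> dist_r_lt r F G eps -> O G.

Definition tau_closure (A : (R * R -> R * R) -> Prop) (F : R * R -> R * R) : Prop :=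
  InDiff F /\ forall O, tau_open O -> O F -> exists G, O G /\ A G.

Definition rot (alpha : R) (p : R * R) : R * R := (fst p + alpha, snd p).

(** lift of a real-analytic self-map of T^2 in an arbitrary homotopy class:
    T(x,y) = M (x,y) + (t1,t2)(x,y), M an integer matrix, t1, t2 Z^2-periodic
    real-analytic *)
Definition gen_analytic_lift (T : R * R -> R * R) : Prop :=
  exists (a b c d : Z) (r : R), 0 < r /\
    let t1 := fun x y => fst (T (x, y)) - (IZR a * x + IZR b * y) in
    let t2 := fun x y => snd (T (x, y)) - (IZR c * x + IZR d * y) in
    periodic2 t1 /\ periodic2 t2 /\ holo_ext r t1 /\ holo_ext r t2.

Definition analytic_diffeo (T : R * R -> R * R) : Prop :=
  gen_analytic_lift T /\
  exists S, gen_analytic_lift S /\ (forall p, T (S p) = p) /\ (forall p, S (T p) = p).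

Definition minimal (F : R * R -> R * R) : Prop :=
  forall p z : R * R, forall eps, 0 < eps ->
    exists q : R * R,
      ((exists n : nat, Nat.iter n F p = q) \/ (exists n : nat, Nat.iter n F q = p)) /\
      exists k1 k2 : Z,
        Rabs (fst q + IZR k1 - fst z) < eps /\ Rabs (snd q + IZR k2 - snd z) < eps.

(** Z^2-periodic subsets of R^2 = subsets of T^2 *)
Definition periodic_set (E : R * R -> Prop) : Prop :=
  forall x y, (E (x + 1, y) <-> E (x, y)) /\ (E (x, y + 1) <-> E (x, y)).

Definition unit_square (p : R * R) : Prop :=
  0 <= fst p < 1 /\ 0 <= snd p < 1.

Close Scope R_scope.

From mathcomp Require Import all_boot all_algebra.
From mathcomp Require Import classical_sets boolp reals ereal measure lebesgue_measure
  lebesgue_integral Rstruct.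

Local Open Scope classical_set_scope.
Local Open Scope ereal_scope.

Definition leb2 : set (measurableTypeR R * measurableTypeR R)%type -> \bar R :=
  (@lebesgue_measure R) \x (@lebesgue_measure R).

(** a (Borel-)measurable subset of T^2, as a Z^2-periodic subset of R^2 *)
Definition torus_measurable (E : R * R -> Prop) : Prop :=
  periodic_set E /\
  measurable ((E : set (measurableTypeR R * measurableTypeR R)%type) `&` unit_square).

Definition muT (E : R * R -> Prop) : \bar R :=
  leb2 ((E : set (measurableTypeR R * measurableTypeR R)%type) `&` unit_square).

Definition area_preserving (T : R * R -> R * R) : Prop :=
  forall E, torus_measurable E ->
    torus_measurable (fun p => E (T p)) /\ muT (fun p => E (T p)) = muT E.

Definition ergodic_leb (F : R * R -> R * R) : Prop :=
  forall E, torus_measurable E -> (forall p, E (F p) <-> E p) ->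
    muT E = 0 \/ muT E = 1.

Local Close Scope ereal_scope.
Local Close Scope classical_set_scope.

(** A_alpha: F = T^{-1} o R_alpha o T on T^2, i.e. on lifts T o F = R_alpha o T
    up to an integer translation *)
Definition A_alpha (alpha : R) (F : R * R -> R * R) : Prop :=
  InDiff F /\
  exists T, analytic_diffeo T /\ area_preserving T /\
    exists k1 k2 : Z, forall p,
      T (F p) = (Rplus (Rplus (fst (T p)) alpha) (IZR k1), Rplus (snd (T p)) (IZR k2)).

(* Main.v *)
Require Import Defs.
From Stdlib Require Import Reals ZArith Lra Lia Psatz ClassicalEpsilon FunctionalExtensionality.
From mathcomp Require all_boot all_order all_algebra all_classical all_reals all_analysis.
From mathcomp Require measurable_realfun zify lra Rstruct Rstruct_topology.

(** Every element of [A_alpha] is [S o R o T] with [S = T^-1] and [R] the rotation (up to an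
    integer translation).  It is perturbed inside the conjugacy, replacing [R] by a skew product
    [(x + alpha, y + phi x)] in the manner of Furstenberg, where
    [phi x = psi (x + alpha) - psi x] and [psi = sum_k peak_k (q_k x)] is a sum of narrow
    trigonometric peaks of height 2.  If [alpha] is Liouville, the frequencies [q_k] can be chosen
    such that [phi] is analytic and as small as desired although [psi] is discontinuous.
    - The truncations of [psi] are analytic, so they conjugate the truncated skew products to
      [R]: the skew product lies in the closure of [A_alpha].
    - The peaks make each truncation of [psi] take all values modulo 1 on short intervals, while
      the remaining terms of [phi] are negligible during the time in which the rotation becomes
      dense at that scale: all orbits are dense.
    - The peaks are narrow, so [psi] converges on a set of positive measure, and the region
      [cos (2 pi (y - psi x)) > 0] is invariant and neither null nor of full measure.
    Since extensions are only assumed to be separately complex differentiable, the compositions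
    rest on Cauchy estimates, obtained from Goursat's lemma in logarithmic coordinates. *)

(** * Lebesgue measure on the torus *)

(** A [tau]-open set gives a radius for each [r] separately, so all perturbations should lie in one
    [Diff_r]. The cocycles are therefore controlled on the fixed strip of width 1. There a peak of
    exponent m and frequency q may be as large as e^(2 pi m q), but replacing z by z + alpha moves q
    z, modulo 1, only by q alpha - p; an error below e^(-n q) with n large compared with m beats
    this growth. The transfer functions themselves are large on that strip, but they enter only the
    conjugacies, whose strip may shrink with the truncation. The order of the choices matters. The
    exponents [m k] come first: they depend only on [gap k], and the measure lost to the peaks does
    not depend on the frequencies. Then each [q k] is chosen, followed by the next error bound.
    Peaks have height 2 because the earlier partial sum may oscillate by 1 over a distance 1 /
    [q k]; a variation of at least 1 remains, which is enough to meet every value modulo 1. *)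

Module TorusMeasure.
Import all_boot all_order all_algebra all_classical all_reals all_analysis.
Import measurable_realfun zify lra.
Import Order.TTheory GRing.Theory Num.Theory numFieldNormedType.Exports.
Set Implicit Arguments.
Unset Strict Implicit.
Unset Printing Implicit Defensive.
Local Open Scope classical_set_scope.
Local Open Scope ring_scope.

Section circle.
Context {R : realType}.
Notation mu := (@lebesgue_measure R).
Notation RR := (measurableTypeR R).

Lemma measurable_shift (c : R) : measurable_fun setT (fun y : RR => (y + c : RR)).
Proof. by apply: measurable_funD => //; exact: measurable_cst. Qed.

(** The pushforward under the translation agrees with Lebesgue measure on half-open intervals, and
    such a measure is unique. *)
Lemma lebesgue_measure_shift (c : R) (A : set RR) : measurable A ->
  mu [set y | A (y + c)] = mu A.
Proof.
move=> mA; apply/esym.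
pose nu : {measure set RR -> \bar R} :=
  measure_function_pushforward__canonical__measure_function_Measure mu (@measurable_shift c).
rewrite (@lebesgue_measure_unique R nu) //.
move=> _ [[a b] _ <-] /=; rewrite /nu /= /pushforward.
have -> : (fun y : R => y + c) @^-1` `]a, b] = `]a - c, b - c]%classic.
  by apply/seteqP; split => x /=; rewrite !in_itv /= => /andP[? ?]; apply/andP; split; lra.
rewrite !lebesgue_measure_itv /= !lte_fin.
have -> : (a - c < b - c) = (a < b) by rewrite ltrD2r.
by case: ifP => // _; rewrite -!EFinB; congr EFin; lra.
Qed.

Lemma periodic_int (e : set R) : (forall y, e (y + 1) <-> e y) -> forall (n : int) y, e (y + n%:~R) <-> e y.
Proof.
move=> he; have hn : forall (n : nat) y, e (y + n%:R) <-> e y.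
  elim => [y|n IH y]; first by rewrite addr0.
  by rewrite -natr1 addrA he IH.
case=> n y; first by rewrite -pmulrn hn.
rewrite NegzE mulrNz -[X in _ <-> X](_ : e (y - n.+1%:R + n.+1%:R) <-> _); last by rewrite subrK.
by rewrite hn.
Qed.

(** Periodicity reduces [c] to its fractional part. Then the circle is cut at [c]: the translation
    takes the part of [e] in [c, 1) to [0, 1 - c), and the part in [0, c), after adding 1, to [1 -
    c, 1). *)
Lemma circle_measure_shift (c : R) (e : set RR) : measurable e ->
  (forall y, e (y + 1) <-> e y) ->
  mu ([set y | e (y + c)] `&` `[0, 1[) = mu (e `&` `[0, 1[).
Proof.
wlog : c / 0 <= c < 1.
  move=> H me he; rewrite -(H (c - (Num.floor c)%:~R)) //.
    congr (mu (_ `&` _)); apply/seteqP; split => y /=; rewrite addrA.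
      by move=> ?; rewrite -mulrNz periodic_int.
    by rewrite -mulrNz periodic_int.
  by have /andP[h1 h2] := floor_itv c; apply/andP; split; [rewrite subr_ge0|rewrite ltrBlDr addrC -intrD1].
move=> /andP[c0 c1] me he.
have mi (i : interval R) : measurable ([set` i] : set RR) by exact: measurable_itv.
have split1 : e `&` `[0, 1[ = (e `&` `[0, c[) `|` (e `&` `[c, 1[).
  apply/seteqP; split => y /=; rewrite !in_itv /=.
    move=> [ey /andP[y0 y1]]; case: (ltP y c) => h; [left|right]; split => //; apply/andP; split=> //.
  by move=> [[ey]|[ey]] /andP[? ?]; split => //; apply/andP; split; lra.
have split2 : [set y | e (y + c)] `&` `[0, 1[ =
    [set y | (e `&` `[c, 1[) (y + c)] `|` [set y | (e `&` `[0, c[) (y + (c - 1))].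
  apply/seteqP; split => y /=; rewrite !in_itv /=.
    move=> [ey /andP[y0 y1]]; case: (ltP (y + c) 1) => h; [left|right].
      by split => //; apply/andP; split; lra.
    split; last by apply/andP; split; lra.
    by apply/he; rewrite addrA subrK.
  move=> [[ey]|[ey]] /andP[? ?]; split => //.
  - by apply/andP; split; lra.
  - by move/he : ey; rewrite addrA subrK.
  - by apply/andP; split; lra.
have m1 : measurable (e `&` `[c, 1[) by apply: measurableI.
have m2 : measurable (e `&` `[0, c[) by apply: measurableI.
have ms (A : set RR) (d : R) : measurable A -> measurable [set y | A (y + d)].
  by move=> mA; rewrite -[X in measurable X]setTI; exact: measurable_shift.
rewrite split1 split2 measureU; [|exact: ms|exact: ms|]; last first.
  apply/seteqP; split => y //= [[_]]; rewrite !in_itv /= => /andP[? ?] [_ /andP[? ?]]; lra.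
rewrite measureU //; last first.
  by apply/seteqP; split => y //= [[_]]; rewrite !in_itv /= => /andP[? ?] [_ /andP[? ?]]; lra.
rewrite addeC; congr (_ + _)%E; [exact: (lebesgue_measure_shift (c - 1) m2)|exact: (lebesgue_measure_shift c m1)].
Qed.
End circle.

Section torus.
Context {R : realType}.
Notation mu := (@lebesgue_measure R).
Notation RR := (measurableTypeR R).

Definition cell : set (RR * RR) := `[0, 1[ `*` `[0, 1[.

Lemma cellP (x y : R) : cell (x, y) <-> (0 <= x < 1) /\ (0 <= y < 1).
Proof. by rewrite /cell /setX /= !in_itv. Qed.

Lemma measurable_superlevel (g : RR * RR -> RR) (c : R) : measurable_fun setT g ->
  measurable [set p | c <= (g p : R)].
Proof.
move=> mg; have -> : [set p | c <= (g p : R)] = setT `&` g @^-1` `[c, +oo[%classic.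
  by apply/seteqP; split => p /=; rewrite in_itv /= andbT // => -[].
by apply: mg => //; exact: measurable_itv.
Qed.

Lemma measurable_cell : measurable cell.
Proof. by apply: measurableX; exact: measurable_itv. Qed.

(** [torus_measurable] speaks only of the part in the unit square, whereas preimages under shears
    reach other squares. The whole set is the countable union of the integer translates of that
    part. *)
Lemma periodic_measurable (E : set (RR * RR)) :
  (forall x y, (E (x + 1, y) <-> E (x, y)) /\ (E (x, y + 1) <-> E (x, y))) ->
  measurable (E `&` cell) -> measurable E.
Proof.
move=> pE mE.
pose tau (i j : int) (p : RR * RR) : RR * RR := (p.1 + i%:~R, p.2 + j%:~R).
have mtau i j : measurable_fun setT (tau i j).
  apply: measurable_fun_pair; apply: measurable_funD => //; exact: measurable_cst.
have pE' i j x y : E (x + i%:~R, y + j%:~R) <-> E (x, y).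
  apply: iff_trans; first exact: (@periodic_int R (fun x' => E (x', y + j%:~R)) (fun x' => (pE x' _).1) i x).
  exact: (@periodic_int R (fun y' => E (x, y')) (fun y' => (pE x y').2) j y).
have -> : E = \bigcup_(i in [set: int]) \bigcup_(j in [set: int]) (tau i j @^-1` (E `&` cell)).
  apply/seteqP; split => [[x y] Exy|[x y] [i _ [j _ [/= +  _]]]]; last by rewrite pE'.
  exists (- Num.floor x) => //; exists (- Num.floor y) => //=.
  rewrite /tau /= /setI /= pE'; split => //=.
  apply/cellP; rewrite !mulrNz !subr_ge0 !ltrBlDr.
  have /andP[-> hx] := floor_itv x; have /andP[-> hy] := floor_itv y.
  by rewrite /= addrC -intrD1 hx addrC -intrD1 hy.
apply: countable_bigcupT_measurable => // i; apply: countable_bigcupT_measurable => // j.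
by rewrite -[X in measurable X]setTI; exact: mtau.
Qed.

Lemma shear_measurable (psi : R -> R) : measurable_fun setT (psi : RR -> RR) ->
  measurable_fun setT (fun p : RR * RR => (p.1, p.2 + psi p.1) : RR * RR).
Proof.
move=> mpsi; apply: measurable_fun_pair; first exact: measurable_fst.
apply: measurable_funD; first exact: measurable_snd.
exact: (measurableT_comp mpsi measurable_fst).
Qed.

(** By Fubini, since on each vertical circle the shear is a translation. *)
Lemma shear_measure (psi : R -> R) (E : set (RR * RR)) :
  measurable E -> (forall x y, E (x, y + 1) <-> E (x, y)) ->
  (mu \x mu)%E ([set p | E (p.1, p.2 + psi p.1)] `&` cell) = (mu \x mu)%E (E `&` cell).
Proof.
move=> mE pE; rewrite /product_measure1; apply: eq_integral => x _ /=.
have [x01|x01] := pselect (x \in `[0, 1[); last first.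
  congr (mu _); apply/seteqP; split => y; rewrite /xsection /cell /= !inE /= => -[_ []] //=.
have -> : xsection ([set p | E (p.1, p.2 + psi p.1)] `&` cell) x =
    [set y | xsection E x (y + psi x)] `&` `[0, 1[.
  apply/seteqP; split => y; rewrite /xsection /cell /= !inE /=; first by move=> [? []].
  by move=> [].
have -> : xsection (E `&` cell) x = xsection E x `&` `[0, 1[.
  apply/seteqP; split => y; rewrite /xsection /cell /= !inE /=; first by move=> [? []].
  by move=> [].
apply: circle_measure_shift; first exact: measurable_xsection.
by move=> y; rewrite /xsection /= !inE.
Qed.

(** Half-width, in the variable q x, of the neighbourhoods of the integers to be removed. Their
    measure in [0, 1) is at most 4 [gap k] = 1 / 2^(k+2) for every frequency q, and these bounds add
    up to 1/2. *)
Definition gap (k : nat) : R := 4^-1 / 2 ^+ k.+1 / 2.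

Definition away (q : nat -> nat) (k : nat) : set R :=
  [set x : R | forall j : int, gap k <= `|(q k)%:R * x - j%:~R|].

Lemma gap_gt0 k : 0 < gap k.
Proof. by rewrite /gap; do 2 (apply: divr_gt0 => //); rewrite exprn_gt0. Qed.

Lemma near_itv (q : nat -> nat) k (j : int) : (0 < q k)%N ->
  [set x : R | `|(q k)%:R * x - j%:~R| < gap k] = `](j%:~R - gap k) / (q k)%:R, (j%:~R + gap k) / (q k)%:R[%classic.
Proof.
move=> q0; have q0' : 0 < (q k)%:R :> R by rewrite ltr0n.
move: (gap k) => g.
apply/seteqP; split => x /=; rewrite in_itv /= ltr_norml ltr_pdivrMr // ltr_pdivlMr //.
  by move=> /andP[? ?]; apply/andP; split; lra.
by move=> /andP[? ?]; apply/andP; split; lra.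
Qed.

Lemma measurable_away q k : (0 < q k)%N -> measurable (away q k).
Proof.
move=> q0; rewrite -[X in measurable X]setCK; apply: measurableC.
have -> : ~` away q k = \bigcup_(j in [set: int]) [set x : R | `|(q k)%:R * x - j%:~R| < gap k].
  apply/seteqP; split => x /=.
    by move=> /existsNP[j /negP]; rewrite -ltNge => h; exists j.
  by move=> [j _ /= h] /(_ j); rewrite leNgt h.
by apply: countable_bigcupT_measurable => // j; rewrite near_itv //; exact: measurable_itv.
Qed.

(** The set is covered by q + 1 intervals of length 2 [gap k] / q centred at the fractions j / q,
    and q + 1 <= 2 q. *)
Lemma near_measure q k : (0 < q k)%N ->
  (mu (~` away q k `&` `[0%R, 1%R[) <= (2^-1 / 2 ^+ k.+1)%:E)%E.
Proof.
move=> q0; have q0' : 0 < (q k)%:R :> R by rewrite ltr0n.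
pose F (j : nat) : set RR := `](j%:R - gap k) / (q k)%:R, (j%:R + gap k) / (q k)%:R[%classic.
have mF j : measurable (F j) by exact: measurable_itv.
have muF j : mu (F j) = (gap k *+ 2 / (q k)%:R)%:E.
  rewrite lebesgue_measure_itv /= lte_fin ltr_pM2r ?invr_gt0//.
  have -> : j%:R - gap k < j%:R + gap k by have := gap_gt0 k; lra.
  by rewrite -EFinB; congr EFin; rewrite -mulrBl; congr (_ / _); lra.
have d1 : gap k < 1 / 2.
  rewrite /gap ltr_pdivrMr // ltr_pdivrMr ?exprn_gt0 //.
  have : 1 <= 2 ^+ k.+1 :> R by rewrite exprn_ege1 // ler1n.
  lra.
have dg := gap_gt0 k.
apply: (@le_trans _ _ (\sum_(j < (q k).+1) mu (F j))%E).
  apply: (@content_subadditive _ _ _ mu _ F (q k).+1) => //.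
    by apply: measurableI; [apply: measurableC; exact: measurable_away|exact: measurable_itv].
  move=> x [/= /existsNP[j /negP]]; rewrite -ltNge => hj; rewrite in_itv /= => /andP[x0 x1].
  (* Since q x lies in [0, q), an integer closer to it than 1/2 is one of 0, ..., q. *)
  have qx0 : 0 <= (q k)%:R * x by rewrite mulr_ge0 // ltW.
  have qx1 : (q k)%:R * x < (q k)%:R by rewrite gtr_pMr.
  have j0 : 0 <= j.
    rewrite leNgt; apply/negP => j0; have : j%:~R <= -1 :> R by rewrite -(mulrN1z 1) ler_int; lia.
    by move: hj; rewrite ltr_norml => /andP[? ?]; lra.
  have jq : j <= (q k)%:Z.
    rewrite leNgt; apply/negP => jq; have : (q k)%:R + 1 <= j%:~R :> R.
      by rewrite natr1 -[_.+1%:R]/((_.+1)%:Z%:~R) ler_int; lia.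
    by move: hj; rewrite ltr_norml => /andP[? ?]; lra.
  case: j j0 jq hj => // j _ jq hj.
  rewrite -bigcup_mkord; exists j => /=; first by move: jq; rewrite lez_nat ltnS.
  have := near_itv j%:Z q0; rewrite /F => <- //=.
under eq_bigr do rewrite muF.
rewrite sumEFin lee_fin sumr_const card_ord -[X in X <= _]mulr_natr.
have q1 : 1 <= (q k)%:R :> R by rewrite ler1n.
rewrite -natr1 mulrAC ler_pdivrMr //.
have -> : gap k = 4^-1 / 2 ^+ k.+1 / 2 by [].
set t := 4^-1 / 2 ^+ k.+1.
have t0 : 0 < t by apply: divr_gt0 => //; rewrite exprn_gt0.
have -> : 2^-1 / 2 ^+ k.+1 = t * 2 :> R by rewrite /t; lra.
have : t * 1 <= t * (q k)%:R by rewrite ler_pM2l.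
clearbody t; have -> : t / 2 *+ 2 = t by rewrite mulr2n; lra.
by rewrite mulr1 mulrDr mulr1 mulrAC; move: (t * _) => u; lra.
Qed.
End torus.

Section intermediate.
Context {R : realType}.
Notation mu := (@lebesgue_measure R).
Notation RR := (measurableTypeR R).

Lemma measurable_away_all q : (forall k, (0 < q k)%N) -> measurable (\bigcap_k @away R q k : set RR).
Proof. by move=> q0; apply: bigcapT_measurable => k; exact: measurable_away. Qed.

Lemma lebesgue_measure01 : mu (`[0, 1[%classic : set RR) = 1%E.
Proof. by rewrite lebesgue_measure_itv /= lte_fin ltr01 -EFinB subr0. Qed.

Lemma away_measure q : (forall k, (0 < q k)%N) ->
  ((2^-1)%:E <= mu ((\bigcap_k @away R q k) `&` `[0%R, 1%R[))%E.
Proof.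
move=> q0.
pose B k : set RR := ~` @away R q k `&` `[0, 1[.
have mB k : measurable (B k).
  by apply: measurableI; [apply: measurableC; exact: measurable_away|exact: measurable_itv].
set X : set RR := _ `&` _.
have mX : measurable X by apply: measurableI; [exact: measurable_away_all|exact: measurable_itv].
have mUB : measurable (\bigcup_k B k) by exact: bigcupT_measurable.
have hB : (mu (\bigcup_k B k) <= (2^-1)%:E)%E.
  apply: (@le_trans _ _ (\sum_(0 <= k <oo) mu (B k))%E).
    exact: (measure_sigma_subadditive mu mB mUB).
  apply: le_trans; last exact: (@epsilon_trick0 R 2^-1 xpredT).
  apply: lee_nneseries => // k _; rewrite natrX; exact: near_measure.
have : (1 <= mu X + mu (\bigcup_k B k))%E.
  rewrite -lebesgue_measure01; apply: (le_trans _ (measureU2 mu mX mUB)).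
  apply: le_measure; rewrite ?inE; [exact: measurable_itv|exact: measurableU|].
  move=> x x01; case: (pselect ((\bigcap_k @away R q k) x)) => [h|]; first by left.
  by move=> /existsNP[k /not_implyP[_ h]]; right; exists k.
move: hB; case: (mu X) => [r| |] //; last by rewrite leey.
case: (mu (\bigcup_k B k)) => [s| |] //; rewrite -?EFinD ?lee_fin; lra.
Qed.

(** All vertical translates of [E] have the same measure. Four of them cover the part of the cell
    above [X], so [E] is not null; two of them are disjoint, so [E] has measure at most 1/2. *)
Lemma nontrivial_measure (E : set (RR * RR)) (X : set RR) : measurable E -> measurable X ->
  (forall x y, E (x, y + 1) <-> E (x, y)) ->
  (0 < mu (X `&` `[0%R, 1%R[))%E ->
  (forall x y, E (x, y) -> ~ E (x, y + 2^-1)) ->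
  (forall x y, X x -> exists i : 'I_4, E (x, y + i%:R / 4)) ->
  (mu \x mu)%E (E `&` cell) <> 0%E /\ (mu \x mu)%E (E `&` cell) <> 1%E.
Proof.
move=> mE mX pE X0 dE cE.
pose Es (c : R) : set (RR * RR) := [set p | E (p.1, p.2 + c)] `&` cell.
have mEs c : measurable (Es c).
  apply: measurableI; last exact: measurable_cell.
  by rewrite -[X in measurable X]setTI; apply: (shear_measurable (psi := cst c)) => //; exact: measurable_cst.
have muEs c : (mu \x mu)%E (Es c) = (mu \x mu)%E (E `&` cell).
  exact: (shear_measure (cst c) mE pE).
have mI : measurable (`[0, 1[%classic : set RR) by exact: measurable_itv.
split=> hE.
- pose XS : set (RR * RR) := (X `&` `[0, 1[) `*` `[0, 1[.
  have mXI : measurable (X `&` `[0%R, 1%R[) by apply: measurableI => //; exact: measurable_itv.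
  have mXS : measurable XS by apply: measurableX => //; exact: measurable_itv.
  have : ((mu \x mu)%E XS <= \sum_(i < 4) (mu \x mu)%E (Es (i%:R / 4)%R))%E.
    apply: (@content_subadditive _ _ _ (mu \x mu)%E XS (fun i => Es (i%:R / 4)) 4) => //.
    move=> [x y] [/= [Xx x01] y01]; have [i hi] := cE x y Xx.
    by rewrite -(bigcup_mkord 4 (fun i => Es (i%:R / 4))); exists i => //=.
  rewrite (product_measure1E mu mu mXI mI).
  rewrite [X in (_ * X)%E]lebesgue_measure01 mule1 big1; last by move=> i _; rewrite muEs.
  by rewrite leNgt X0.
- have : ((mu \x mu)%E (Es 0%R `|` Es (2^-1)%R) <= (mu \x mu)%E cell)%E.
    apply: le_measure; rewrite ?inE; [exact: measurableU|exact: measurable_cell|].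
    by move=> p [[]|[]].
  have -> : (mu \x mu)%E (Es 0 `|` Es 2^-1) = ((mu \x mu)%E (Es 0%R) + (mu \x mu)%E (Es (2^-1)%R))%E.
    apply: (measureU (mu \x mu)%E) => //.
    apply/seteqP; split => -[x y] //= [[/= h _] [/= h' _]].
    by move: h; rewrite addr0 => /dE.
  rewrite !muEs hE (product_measure1E mu mu mI mI).
  by rewrite [X in (_ <= X * _)%E]lebesgue_measure01 [X in (_ <= _ * X)%E]lebesgue_measure01 mule1 -EFinD lee_fin; lra.
Qed.
End intermediate.

End TorusMeasure.

From Coquelicot Require Import Coquelicot.
Open Scope R_scope.

(** * Choice and complex differentiability *)

Lemma exists_choice {A B : Type} (P : A -> B -> Prop) :
  (forall x, exists y, P x y) -> exists f, forall x, P x (f x).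
Proof.
  intros H. exists (fun x => proj1_sig (constructive_indefinite_description _ (H x))).
  intros x. apply proj2_sig.
Qed.

(** Stated without a quotient, so that the point u = z needs no exception and the chain rule needs
    no case distinction. *)
Definition cderiv (h : C -> C) (z l : C) : Prop :=
  forall eps, 0 < eps -> exists d, 0 < d /\
    forall u, Cmod (u - z) < d -> Cmod (h u - h z - (u - z) * l) <= eps * Cmod (u - z).

Definition cdiff (h : C -> C) (z : C) : Prop := exists l, cderiv h z l.

Lemma C_differentiable_atP (h : C -> C) (z : C) : C_differentiable_at h z <-> cdiff h z.
Proof.
  split.
  - intros [l [_ H]]. exists l. intros eps He.
    destruct (H z (fun P HP => HP) (mkposreal _ He)) as [d Hd].
    exists d; split; [apply cond_pos|]. intros u Hu. exact (Hd u Hu).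
  - intros [l H]. exists l. split.
    + apply is_linear_scal_l.
    + intros x Hx eps.
      assert (x = z) as ->.
      { apply eq_sym. apply (is_filter_lim_locally_unique (K:=C_AbsRing) (V := AbsRing_NormedModule C_AbsRing)). exact Hx. }
      destruct (H eps (cond_pos eps)) as [d [Hd0 Hd]].
      exists (mkposreal d Hd0). intros u Hu. exact (Hd u Hu).
Qed.

Lemma Cmod_sub_sym (x y : C) : Cmod (x - y) = Cmod (y - x).
Proof. rewrite <- Cmod_opp. f_equal. ring. Qed.

Lemma Cmod_sub_triangle (x y z : C) : Cmod (x - z) <= Cmod (x - y) + Cmod (y - z).
Proof. replace (x - z)%C with ((x - y) + (y - z))%C by ring. apply Cmod_triangle. Qed.

Lemma Re_le_Cmod (z : C) : Rabs (Re z) <= Cmod z.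
Proof. eapply Rle_trans; [|apply Rmax_Cmod]. apply Rmax_l. Qed.

Lemma Im_le_Cmod (z : C) : Rabs (Im z) <= Cmod z.
Proof. eapply Rle_trans; [|apply Rmax_Cmod]. apply Rmax_r. Qed.

Lemma Cmod_le_Re_Im (z : C) : Cmod z <= Rabs (Re z) + Rabs (Im z).
Proof.
  replace z with (RtoC (Re z) + Ci * RtoC (Im z))%C at 1
    by (destruct z; unfold Ci, Cmult, Cplus, RtoC; simpl; f_equal; ring).
  eapply Rle_trans; [apply Cmod_triangle|].
  rewrite Cmod_mult, !Cmod_R.
  replace (Cmod Ci) with 1. lra.
  unfold Cmod, Ci; simpl. replace (0 * (0*1) + 1 * (1*1)) with 1 by ring. symmetry; apply sqrt_1.
Qed.

Lemma cderiv_lipschitz (h : C -> C) z l : cderiv h z l ->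
  exists d, 0 < d /\ forall u, Cmod (u - z) < d -> Cmod (h u - h z) <= (Cmod l + 1) * Cmod (u - z).
Proof.
  intros H. destruct (H 1 Rlt_0_1) as [d [Hd Hu]]. exists d; split; auto.
  intros u H1. specialize (Hu u H1).
  replace (h u - h z)%C with ((h u - h z - (u - z) * l) + (u - z) * l)%C by ring.
  eapply Rle_trans; [apply Cmod_triangle|]. rewrite Cmod_mult. lra.
Qed.

Lemma cdiff_continuous (h : C -> C) z : cdiff h z -> forall eps, 0 < eps ->
  exists d, 0 < d /\ forall u, Cmod (u - z) < d -> Cmod (h u - h z) < eps.
Proof.
  intros [l Hl] eps He. destruct (cderiv_lipschitz _ _ _ Hl) as [d [Hd H]].
  pose proof (Cmod_ge_0 l).
  exists (Rmin d (eps / (Cmod l + 1))). split.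
  - apply Rmin_pos; auto. apply Rdiv_lt_0_compat; lra.
  - intros u Hu. eapply Rle_lt_trans; [apply H|].
    + eapply Rlt_le_trans; [apply Hu|apply Rmin_l].
    + assert (Cmod (u - z) < eps / (Cmod l + 1)) by (eapply Rlt_le_trans; [apply Hu|apply Rmin_r]).
      apply Rmult_lt_compat_l with (r := Cmod l + 1) in H1; [|lra].
      replace ((Cmod l + 1) * (eps / (Cmod l + 1))) with eps in H1 by (field; lra). exact H1.
Qed.

Lemma cderiv_const (c z : C) : cderiv (fun _ => c) z 0.
Proof.
  intros eps He. exists 1; split; [lra|]. intros u _.
  replace (c - c - (u - z) * 0)%C with (RtoC 0) by ring. rewrite Cmod_0.
  pose proof (Cmod_ge_0 (u - z)). nra.
Qed.

Lemma cderiv_id (z : C) : cderiv (fun u => u) z 1.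
Proof.
  intros eps He. exists 1; split; [lra|]. intros u _.
  replace (u - z - (u - z) * 1)%C with (RtoC 0) by ring. rewrite Cmod_0.
  pose proof (Cmod_ge_0 (u - z)). nra.
Qed.

Lemma cderiv_plus (f g : C -> C) z a b :
  cderiv f z a -> cderiv g z b -> cderiv (fun u => f u + g u)%C z (a + b)%C.
Proof.
  intros Hf Hg eps He.
  destruct (Hf (eps / 2)) as [d1 [H1 Hd1]]; [lra|]. destruct (Hg (eps / 2)) as [d2 [H2 Hd2]]; [lra|].
  exists (Rmin d1 d2); split; [apply Rmin_pos; auto|]. intros u Hu.
  specialize (Hd1 u (Rlt_le_trans _ _ _ Hu (Rmin_l _ _))).
  specialize (Hd2 u (Rlt_le_trans _ _ _ Hu (Rmin_r _ _))).
  replace (f u + g u - (f z + g z) - (u - z) * (a + b))%C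
    with ((f u - f z - (u - z) * a) + (g u - g z - (u - z) * b))%C by ring.
  eapply Rle_trans; [apply Cmod_triangle|]. lra.
Qed.

Lemma cderiv_mult (f g : C -> C) z a b :
  cderiv f z a -> cderiv g z b -> cderiv (fun u => f u * g u)%C z (a * g z + f z * b)%C.
Proof.
  intros Hf Hg eps He.
  set (K := Cmod (g z) + Cmod (f z) + (Cmod b + 1) + 1).
  pose proof (Cmod_ge_0 (g z)). pose proof (Cmod_ge_0 (f z)). pose proof (Cmod_ge_0 a). pose proof (Cmod_ge_0 b).
  assert (HK : 0 < K) by (unfold K; lra).
  assert (Hea : 0 < eps / K) by (apply Rdiv_lt_0_compat; lra).
  assert (Hec : 0 < eps / K / (Cmod a + 1)) by (apply Rdiv_lt_0_compat; lra).
  destruct (Hf _ Hea) as [d1 [H1' Hd1]]. destruct (Hg _ Hea) as [d2 [H2' Hd2]].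
  destruct (cderiv_lipschitz _ _ _ Hf) as [d3 [H3' Hd3]].
  destruct (cderiv_lipschitz _ _ _ Hg) as [d4 [H4' Hd4]].
  exists (Rmin (Rmin d1 d2) (Rmin (Rmin d3 d4) (eps / K / (Cmod a + 1)))). split.
  { repeat apply Rmin_pos; auto. }
  intros u Hu.
  apply Rmin_Rgt in Hu as [Hu1 Hu2]. apply Rmin_Rgt in Hu1 as [Hu1 Hu1'].
  apply Rmin_Rgt in Hu2 as [Hu2 Hu5]. apply Rmin_Rgt in Hu2 as [Hu3 Hu4].
  specialize (Hd1 u Hu1). specialize (Hd2 u Hu1'). specialize (Hd3 u Hu3). specialize (Hd4 u Hu4).
  replace (f u * g u - f z * g z - (u - z) * (a * g z + f z * b))%C
    with ((f u - f z - (u - z) * a) * g z + f z * (g u - g z - (u - z) * b) + (f u - f z) * (g u - g z))%C by ring.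
  eapply Rle_trans; [apply Cmod_triangle|].
  eapply Rle_trans; [apply Rplus_le_compat_r, Cmod_triangle|].
  rewrite !Cmod_mult.
  set (r := Cmod (u - z)) in *. assert (Hr : 0 <= r) by apply Cmod_ge_0.
  assert (Hp : Cmod (f u - f z) * Cmod (g u - g z) <= eps / K * (Cmod b + 1) * r).
  { eapply Rle_trans; [apply Rmult_le_compat; try apply Cmod_ge_0; [apply Hd3|apply Hd4]|].
    replace ((Cmod a + 1) * r * ((Cmod b + 1) * r)) with ((Cmod a + 1) * r * (Cmod b + 1) * r) by ring.
    apply Rmult_le_compat_r; auto. apply Rmult_le_compat_r; [lra|].
    assert (r <= eps / K / (Cmod a + 1)) by lra.
    apply Rmult_le_compat_l with (r := Cmod a + 1) in H3; [|lra].
    replace ((Cmod a + 1) * (eps / K / (Cmod a + 1))) with (eps / K) in H3 by (field; lra). exact H3. }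
  assert (Cmod (f u - f z - (u - z) * a) * Cmod (g z) <= eps / K * r * Cmod (g z)) by (apply Rmult_le_compat_r; auto).
  assert (Cmod (f z) * Cmod (g u - g z - (u - z) * b) <= Cmod (f z) * (eps / K * r)) by (apply Rmult_le_compat_l; auto).
  replace (eps * r) with (eps / K * r * K) by (field; lra). unfold K at 2.
  assert (0 <= eps / K * r) by (apply Rmult_le_pos; lra). lra.
Qed.

Lemma cderiv_comp (f g : C -> C) z a b :
  cderiv g z b -> cderiv f (g z) a -> cderiv (fun u => f (g u)) z (b * a)%C.
Proof.
  intros Hg Hf eps He.
  pose proof (Cmod_ge_0 a). pose proof (Cmod_ge_0 b).
  set (K := Cmod a + Cmod b + 1). assert (HK : 0 < K) by (unfold K; lra).
  assert (Hea : 0 < eps / K) by (apply Rdiv_lt_0_compat; lra).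
  destruct (Hf _ Hea) as [d1 [H1' Hd1]]. destruct (Hg _ Hea) as [d2 [H2' Hd2]].
  destruct (cderiv_lipschitz _ _ _ Hg) as [d3 [H3' Hd3]].
  exists (Rmin (Rmin d2 d3) (d1 / (Cmod b + 1))). split.
  { repeat apply Rmin_pos; auto. apply Rdiv_lt_0_compat; lra. }
  intros u Hu. apply Rmin_Rgt in Hu as [Hu1 Hu3]. apply Rmin_Rgt in Hu1 as [Hu1 Hu2].
  specialize (Hd2 u Hu1). specialize (Hd3 u Hu2).
  set (r := Cmod (u - z)) in *. assert (Hr : 0 <= r) by apply Cmod_ge_0.
  assert (Hg1 : Cmod (g u - g z) < d1).
  { eapply Rle_lt_trans; [apply Hd3|].
    apply Rmult_lt_compat_l with (r := Cmod b + 1) in Hu3; [|lra].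
    replace ((Cmod b + 1) * (d1 / (Cmod b + 1))) with d1 in Hu3 by (field; lra). exact Hu3. }
  specialize (Hd1 _ Hg1).
  replace (f (g u) - f (g z) - (u - z) * (b * a))%C
    with ((f (g u) - f (g z) - (g u - g z) * a) + (g u - g z - (u - z) * b) * a)%C by ring.
  eapply Rle_trans; [apply Cmod_triangle|]. rewrite Cmod_mult.
  replace (eps * r) with (eps / K * ((Cmod b + 1) * r) + (eps / K * r) * Cmod a) by (unfold K; field; unfold K in HK; lra).
  apply Rplus_le_compat.
  - eapply Rle_trans; [apply Hd1|]. apply Rmult_le_compat_l; lra.
  - apply Rmult_le_compat_r; auto.
Qed.

Lemma cderiv_ext_loc (f g : C -> C) z a d : 0 < d ->
  (forall u, Cmod (u - z) < d -> f u = g u) -> cderiv f z a -> cderiv g z a.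
Proof.
  intros Hd E H eps He. destruct (H eps He) as [d1 [H1 Hu]].
  exists (Rmin d d1); split; [apply Rmin_pos; auto|]. intros u Hu1.
  rewrite <- !E; [apply Hu| |].
  - eapply Rlt_le_trans; [apply Hu1|apply Rmin_r].
  - replace (z - z)%C with (RtoC 0) by ring. rewrite Cmod_0; auto.
  - eapply Rlt_le_trans; [apply Hu1|apply Rmin_l].
Qed.

Lemma cdiff_const c z : cdiff (fun _ => c) z. Proof. eexists; apply cderiv_const. Qed.
Lemma cdiff_id z : cdiff (fun u => u) z. Proof. eexists; apply cderiv_id. Qed.
Lemma cdiff_plus f g z : cdiff f z -> cdiff g z -> cdiff (fun u => f u + g u)%C z.
Proof. intros [a Ha] [b Hb]; eexists; apply cderiv_plus; eauto. Qed.
Lemma cdiff_mult f g z : cdiff f z -> cdiff g z -> cdiff (fun u => f u * g u)%C z.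
Proof. intros [a Ha] [b Hb]; eexists; apply cderiv_mult; eauto. Qed.
Lemma cdiff_comp f g z : cdiff g z -> cdiff f (g z) -> cdiff (fun u => f (g u)) z.
Proof. intros [a Ha] [b Hb]; eexists; apply cderiv_comp; eauto. Qed.
Lemma cdiff_ext (f g : C -> C) z : (forall u, f u = g u) -> cdiff f z -> cdiff g z.
Proof. intros E [a Ha]; exists a. apply cderiv_ext_loc with f 1; auto; lra. Qed.
Lemma cdiff_opp f z : cdiff f z -> cdiff (fun u => - f u)%C z.
Proof.
  intros H. apply cdiff_ext with (fun u => RtoC (-1) * f u)%C.
  - intros u. apply injective_projections; simpl; ring.
  - apply cdiff_mult; auto. apply cdiff_const.
Qed.
Lemma cdiff_minus f g z : cdiff f z -> cdiff g z -> cdiff (fun u => f u - g u)%C z.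
Proof. intros Hf Hg. apply (cdiff_plus f (fun u => - g u)%C); auto. apply cdiff_opp; auto. Qed.

(** * The complex exponential *)

Definition cexp (z : C) : C := (exp (Re z) * cos (Im z), exp (Re z) * sin (Im z)).

Lemma cexp_plus z w : cexp (z + w) = (cexp z * cexp w)%C.
Proof.
  destruct z as [a b], w as [c d]. unfold cexp, Cmult, Cplus; simpl. rewrite exp_plus, cos_plus, sin_plus. f_equal; ring.
Qed.

Lemma cexp_0 : cexp 0 = 1%C.
Proof. unfold cexp; simpl. rewrite exp_0, cos_0, sin_0. unfold RtoC; f_equal; ring. Qed.

Lemma Cmod_cexp z : Cmod (cexp z) = exp (Re z).
Proof.
  unfold Cmod, cexp; simpl.
  replace (exp (Re z) * cos (Im z) * (exp (Re z) * cos (Im z) * 1) + exp (Re z) * sin (Im z) * (exp (Re z) * sin (Im z) * 1))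
    with (Rsqr (exp (Re z)) * (Rsqr (sin (Im z)) + Rsqr (cos (Im z)))) by (unfold Rsqr; ring).
  rewrite sin2_cos2, Rmult_1_r. apply sqrt_Rsqr. left; apply exp_pos.
Qed.

Lemma cexp_2pi_periodic z (n : Z) : cexp (z + (0, 2 * PI * IZR n)) = cexp z.
Proof.
  assert (H : cexp (0, 2 * PI * IZR n) = 1%C).
  { unfold cexp; simpl. rewrite exp_0.
    replace (2 * PI * IZR n) with (0 + 2 * IZR n * PI) by ring.
    assert (Hc : cos (0 + 2 * IZR n * PI) = 1 /\ sin (0 + 2 * IZR n * PI) = 0).
    { destruct (Z_le_gt_dec 0 n) as [Hn|Hn].
      - rewrite <- (Z2Nat.id n Hn), <- INR_IZR_INZ, cos_period, sin_period, cos_0, sin_0; auto.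
      - replace (0 + 2 * IZR n * PI) with (-(0 + 2 * INR (Z.to_nat (-n)) * PI)).
        + rewrite cos_neg, sin_neg, cos_period, sin_period, cos_0, sin_0. split; ring.
        + rewrite INR_IZR_INZ, Z2Nat.id by lia. rewrite opp_IZR. ring. }
    destruct Hc as [-> ->]. unfold RtoC; f_equal; ring. }
  rewrite cexp_plus, H. ring.
Qed.

(** The real derivatives of exp, cos and sin at 0 give first-order bounds for the real and the
    imaginary part; other base points follow from the functional equation. *)
Lemma cderiv_cexp_0 : cderiv cexp 0 1.
Proof.
  (* The error terms below add up to at most 7 e |u|; the bound e <= 1 is used for products of two
     small factors. *)
  intros eps He. set (e := Rmin 1 (eps / 8)).
  assert (He0 : 0 < e) by (apply Rmin_pos; lra).
  assert (He1 : e <= 1) by apply Rmin_l. assert (He8 : e <= eps / 8) by apply Rmin_r.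
  destruct (derivable_pt_lim_exp 0 e He0) as [d1 H1].
  destruct (derivable_pt_lim_cos 0 e He0) as [d2 H2].
  destruct (derivable_pt_lim_sin 0 e He0) as [d3 H3].
  rewrite exp_0 in H1. rewrite sin_0, cos_0 in H2. rewrite sin_0, cos_0 in H3.
  assert (H1' : forall a, Rabs a < d1 -> Rabs (exp a - 1 - a) <= e * Rabs a).
  { intros a Ha. destruct (Req_dec a 0) as [->|Hn].
    - rewrite exp_0. replace (1 - 1 - 0) with 0 by ring. rewrite Rabs_R0. lra.
    - specialize (H1 a Hn Ha). rewrite Rplus_0_l in H1.
      replace (exp a - 1 - a) with (((exp a - 1) / a - 1) * a) by (field; auto).
      rewrite Rabs_mult. apply Rmult_le_compat_r; [apply Rabs_pos|lra]. }
  assert (H2' : forall a, Rabs a < d2 -> Rabs (cos a - 1) <= e * Rabs a).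
  { intros a Ha. destruct (Req_dec a 0) as [->|Hn].
    - rewrite cos_0. replace (1 - 1) with 0 by ring. rewrite Rabs_R0. lra.
    - specialize (H2 a Hn Ha). rewrite Rplus_0_l in H2.
      replace (cos a - 1) with (((cos a - 1) / a - -0) * a) by (field; auto).
      rewrite Rabs_mult. apply Rmult_le_compat_r; [apply Rabs_pos|lra]. }
  assert (H3' : forall a, Rabs a < d3 -> Rabs (sin a - a) <= e * Rabs a).
  { intros a Ha. destruct (Req_dec a 0) as [->|Hn].
    - rewrite sin_0. replace (0 - 0) with 0 by ring. rewrite Rabs_R0. lra.
    - specialize (H3 a Hn Ha). rewrite Rplus_0_l in H3.
      replace (sin a - a) with (((sin a - 0) / a - 1) * a) by (field; auto).
      rewrite Rabs_mult. apply Rmult_le_compat_r; [apply Rabs_pos|lra]. }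
  exists (Rmin (Rmin d1 (Rmin d2 d3)) e). split.
  { apply Rmin_pos; [|exact He0]. apply Rmin_pos; [|apply Rmin_pos]; apply cond_pos. }
  intros u Hu. rewrite cexp_0.
  replace (u - 0)%C with u in * by ring.
  replace (cexp u - 1 - u * 1)%C with (cexp u - 1 - u)%C by ring.
  apply Rmin_Rgt in Hu as [Hu He']. apply Rmin_Rgt in Hu as [Hu1 Hu]. apply Rmin_Rgt in Hu as [Hu2 Hu3].
  destruct u as [a b]. pose proof (Re_le_Cmod (a, b)) as Ra. pose proof (Im_le_Cmod (a, b)) as Rb.
  simpl in Ra, Rb. set (r := Cmod (a, b)) in *.
  assert (K1 : Rabs (exp a - 1 - a) <= e * Rabs a) by (apply H1'; lra).
  assert (K2 : Rabs (cos b - 1) <= e * Rabs b) by (apply H2'; lra).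
  assert (K3 : Rabs (sin b - b) <= e * Rabs b) by (apply H3'; lra).
  eapply Rle_trans; [apply Cmod_le_Re_Im|]. unfold cexp; simpl.
  assert (E1 : exp a * cos b + - (1) + - a = (exp a - 1 - a) * cos b + (1 + a) * (cos b - 1)) by ring.
  assert (E2 : exp a * sin b + - 0 + - b = (exp a - 1 - a) * sin b + a * sin b + (sin b - b)) by ring.
  rewrite E1, E2.
  assert (Pa := Rabs_pos a). assert (Pb := Rabs_pos b).
  assert (er : e * Rabs a <= e * r) by (apply Rmult_le_compat_l; lra).
  assert (er' : e * Rabs b <= e * r) by (apply Rmult_le_compat_l; lra).
  assert (L1 : Rabs ((exp a - 1 - a) * cos b) <= e * r).
  { rewrite Rabs_mult. assert (Rabs (cos b) <= 1) by (apply Rabs_le, COS_bound).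
    pose proof (Rabs_pos (exp a - 1 - a)). pose proof (Rabs_pos (cos b)). nra. }
  assert (L1' : Rabs ((exp a - 1 - a) * sin b) <= e * r).
  { rewrite Rabs_mult. assert (Rabs (sin b) <= 1) by (apply Rabs_le, SIN_bound).
    pose proof (Rabs_pos (exp a - 1 - a)). pose proof (Rabs_pos (sin b)). nra. }
  assert (L2 : Rabs ((1 + a) * (cos b - 1)) <= 2 * (e * r)).
  { rewrite Rabs_mult. assert (Rabs (1 + a) <= 2).
    { eapply Rle_trans; [apply Rabs_triang|]. rewrite Rabs_R1. lra. }
    apply Rmult_le_compat; try apply Rabs_pos; lra. }
  assert (L3 : Rabs (a * sin b) <= 2 * (e * r)).
  { rewrite Rabs_mult. assert (Rabs (sin b) <= 2 * r).
    { replace (sin b) with ((sin b - b) + b) by ring. eapply Rle_trans; [apply Rabs_triang|].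
      assert (e * Rabs b <= 1 * Rabs b) by (apply Rmult_le_compat_r; lra). lra. }
    apply Rle_trans with (e * (2 * r)); [|lra]. apply Rmult_le_compat; try apply Rabs_pos; lra. }
  pose proof (Rabs_triang ((exp a - 1 - a) * cos b) ((1 + a) * (cos b - 1))).
  pose proof (Rabs_triang ((exp a - 1 - a) * sin b + a * sin b) (sin b - b)).
  pose proof (Rabs_triang ((exp a - 1 - a) * sin b) (a * sin b)).
  assert (8 * (e * r) <= eps * r).
  { rewrite <- Rmult_assoc. apply Rmult_le_compat_r; [unfold r; apply Cmod_ge_0|lra]. }
  assert (0 <= e * r) by (apply Rmult_le_pos; [lra|apply Cmod_ge_0]).
  lra.
Qed.

Lemma cdiff_cexp z : cdiff cexp z.
Proof.
  apply cdiff_ext with (fun u => cexp z * cexp (u + - z))%C.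
  { intros u. rewrite <- cexp_plus. f_equal. ring. }
  apply cdiff_mult; [apply cdiff_const|].
  apply (cdiff_comp cexp (fun u => u + - z)%C).
  - apply cdiff_plus; [apply cdiff_id|apply cdiff_const].
  - replace (z + - z)%C with (RtoC 0) by ring. exists 1%C. apply cderiv_cexp_0.
Qed.

(** * Goursat's lemma *)

Lemma nested_intervals (a b : nat -> R) :
  (forall n, a n <= a (S n)) -> (forall n, b (S n) <= b n) -> (forall n, a n <= b n) ->
  exists x, forall n, a n <= x <= b n.
Proof.
  intros Ha Hb Hab.
  assert (Ma : forall n m, (n <= m)%nat -> a n <= a m).
  { intros n m H; induction H; [lra|]. specialize (Ha m). lra. }
  assert (Mb : forall n m, (n <= m)%nat -> b m <= b n).
  { intros n m H; induction H; [lra|]. specialize (Hb m). lra. }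
  assert (Hub : forall n m, a n <= b m).
  { intros n m. apply Rle_trans with (a (max n m)); [apply Ma; lia|].
    apply Rle_trans with (b (max n m)); auto. apply Mb; lia. }
  destruct (completeness (fun x => exists n, x = a n)) as [x [Hx1 Hx2]].
  - exists (b O). intros y [n ->]. apply Hub.
  - exists (a O); exists O; auto.
  - exists x. intros n; split.
    + apply Hx1. exists n; auto.
    + apply Hx2. intros y [m ->]. apply Hub.
Qed.

Lemma pow_half_lt (K e : R) : 0 < e -> exists n, K / 2 ^ n < e.
Proof.
  intros He. destruct (Rle_lt_dec K 0) as [HK|HK].
  - exists O. simpl. lra.
  - destruct (pow_lt_1_zero (/2) (ltac:(rewrite Rabs_pos_eq; lra)) (e / K)) as [n Hn].
    + apply Rdiv_lt_0_compat; lra.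
    + exists n. specialize (Hn n (le_n n)).
      assert (0 < 2 ^ n) by (apply pow_lt; lra).
      rewrite Rabs_pos_eq in Hn by (apply pow_le; lra).
      rewrite pow_inv in Hn.
      apply Rmult_lt_compat_l with (r := K) in Hn; auto.
      replace (K * (e / K)) with e in Hn by (field; lra). exact Hn.
Qed.

Lemma RInt_diff_const_bound (f g : R -> R) a b k e : a <= b ->
  ex_RInt f a b -> ex_RInt g a b -> (forall x, a <= x <= b -> Rabs (f x - g x - k) <= e) ->
  Rabs (RInt f a b - RInt g a b - k * (b - a)) <= e * (b - a).
Proof.
  intros Hab Hf Hg H.
  assert (Hm : ex_RInt (fun x => minus (minus (f x) (g x)) k) a b).
  { apply @ex_RInt_minus; [apply @ex_RInt_minus; auto|apply ex_RInt_const]. }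
  replace (RInt f a b - RInt g a b - k * (b - a)) with (RInt (fun x => minus (minus (f x) (g x)) k) a b).
  - rewrite Rmult_comm. apply abs_RInt_le_const; auto.
  - apply is_RInt_unique. 
    replace (RInt f a b - RInt g a b - k * (b - a)) with (minus (minus (RInt f a b) (RInt g a b)) (scal (b - a) k)).
    + apply @is_RInt_minus; [apply @is_RInt_minus; apply @RInt_correct; auto|apply @is_RInt_const].
    + unfold minus, plus, opp, scal; simpl. unfold mult; simpl. ring.
Qed.

(* [p] and [q] are differentiable with [dp/dt = - dq/ds]: the form [p ds - q dt] is closed. *)
Definition closed_at (p q : R -> R -> R) (s t : R) : Prop :=
  exists A B D, forall eps, 0 < eps -> exists d, 0 < d /\
    forall s' t', Rabs (s' - s) < d -> Rabs (t' - t) < d ->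
      Rabs (p s' t' - p s t - A * (s' - s) - B * (t' - t)) <= eps * (Rabs (s' - s) + Rabs (t' - t)) /\
      Rabs (q s' t' - q s t + B * (s' - s) - D * (t' - t)) <= eps * (Rabs (s' - s) + Rabs (t' - t)).

Definition boundary_int (p q : R -> R -> R) (a b c d : R) : R :=
  RInt (fun s => p s c) a b - RInt (fun s => p s d) a b - RInt (q b) c d + RInt (q a) c d.

Lemma lipschitz_at_continuous (f : R -> R) x d K : 0 < d -> 0 < K ->
  (forall y, Rabs (y - x) < d -> Rabs (f y - f x) <= K * Rabs (y - x)) -> continuous f x.
Proof.
  intros Hd HK H. apply continuity_pt_filterlim. intros eps He.
  exists (Rmin d (eps / K)). split.
  - apply Rmin_pos; auto. apply Rdiv_lt_0_compat; auto.
  - intros y [_ Hy]. unfold dist in *; simpl in *. unfold R_dist in *.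
    apply Rmin_Rgt in Hy as [Hy1 Hy2]. eapply Rle_lt_trans; [apply H; auto|].
    apply Rmult_lt_compat_l with (r := K) in Hy2; auto.
    replace (K * (eps / K)) with eps in Hy2 by (field; lra). exact Hy2.
Qed.

Lemma closed_at_continuous (p q : R -> R -> R) s t : closed_at p q s t ->
  continuous (fun s => p s t) s /\ continuous (q s) t.
Proof.
  intros [A [B [D H]]]. destruct (H 1 Rlt_0_1) as [d [Hd Hx]]. split.
  - apply lipschitz_at_continuous with d (Rabs A + 1); auto.
    { pose proof (Rabs_pos A); lra. }
    intros s' Hs. destruct (Hx s' t Hs) as [H1 _]. { rewrite Rminus_diag, Rabs_R0; auto. }
    rewrite Rminus_diag, Rabs_R0 in H1.
    replace (p s' t - p s t) with ((p s' t - p s t - A * (s' - s) - B * 0) + A * (s' - s)) by ring.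
    eapply Rle_trans; [apply Rabs_triang|]. rewrite Rabs_mult. lra.
  - apply lipschitz_at_continuous with d (Rabs D + 1); auto.
    { pose proof (Rabs_pos D); lra. }
    intros t' Ht. destruct (Hx s t') as [_ H1]; auto. { rewrite Rminus_diag, Rabs_R0; auto. }
    rewrite Rminus_diag, Rabs_R0 in H1.
    replace (q s t' - q s t) with ((q s t' - q s t + B * 0 - D * (t' - t)) + D * (t' - t)) by ring.
    eapply Rle_trans; [apply Rabs_triang|]. rewrite Rabs_mult. lra.
Qed.

Section Goursat.
Variables (p q : R -> R -> R) (a0 b0 c0 d0 : R).
Hypothesis Hdiff : forall s t, a0 <= s <= b0 -> c0 <= t <= d0 -> closed_at p q s t.

Lemma ex_RInt_horizontal t a b : c0 <= t <= d0 -> a0 <= a <= b -> b <= b0 ->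
  ex_RInt (fun s => p s t) a b.
Proof.
  intros Ht Ha Hb. apply @ex_RInt_continuous. intros s Hs.
  rewrite Rmin_left, Rmax_right in Hs by lra. apply (closed_at_continuous p q). apply Hdiff; lra.
Qed.

Lemma ex_RInt_vertical s c d : a0 <= s <= b0 -> c0 <= c <= d -> d <= d0 -> ex_RInt (q s) c d.
Proof.
  intros Hs Hc Hd. apply @ex_RInt_continuous. intros t Ht.
  rewrite Rmin_left, Rmax_right in Ht by lra. apply (closed_at_continuous p q). apply Hdiff; lra.
Qed.

Lemma boundary_int_split_h a m b c d : a0 <= a <= m -> m <= b <= b0 -> c0 <= c <= d -> d <= d0 ->
  boundary_int p q a b c d = boundary_int p q a m c d + boundary_int p q m b c d.
Proof.
  intros. unfold boundary_int.
  rewrite <- (RInt_Chasles (fun s => p s c) a m b), <- (RInt_Chasles (fun s => p s d) a m b)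
    by (apply ex_RInt_horizontal; lra).
  unfold plus; simpl. ring.
Qed.

Lemma boundary_int_split_v a b c m d : a0 <= a <= b -> b <= b0 -> c0 <= c <= m -> m <= d <= d0 ->
  boundary_int p q a b c d = boundary_int p q a b c m + boundary_int p q a b m d.
Proof.
  intros. unfold boundary_int.
  rewrite <- (RInt_Chasles (q a) c m d), <- (RInt_Chasles (q b) c m d)
    by (apply ex_RInt_vertical; lra).
  unfold plus; simpl. ring.
Qed.

(** The affine parts of [p] and [q] integrate to zero around a rectangle because [p] changes with t
    at the opposite rate of [q] with s. What remains is at most the error 2 eps L times the
    half-perimeter L. *)
Lemma boundary_int_local s t eps : a0 <= s <= b0 -> c0 <= t <= d0 -> 0 < eps ->
  exists r, 0 < r /\ forall a b c d, a0 <= a <= s -> s <= b <= b0 -> c0 <= c <= t -> t <= d <= d0 ->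
    (b - a) + (d - c) < r -> Rabs (boundary_int p q a b c d) <= 2 * eps * ((b - a) + (d - c)) ^ 2.
Proof.
  intros Hs Ht He. destruct (Hdiff s t Hs Ht) as [A [B [D H]]].
  destruct (H eps He) as [r [Hr Hx]]. exists r; split; auto.
  intros a b c d Ha Hb Hc Hd Hw. set (L := (b - a) + (d - c)) in *.
  assert (Habs : forall x y w, x <= w <= y -> forall z, x <= z <= y -> Rabs (z - w) <= y - x).
  { intros x y w H1 z H2. apply Rabs_le. lra. }
  assert (HpL : forall s' t', a <= s' <= b -> c <= t' <= d ->
    Rabs (p s' t' - p s t - A * (s' - s) - B * (t' - t)) <= eps * L /\
    Rabs (q s' t' - q s t + B * (s' - s) - D * (t' - t)) <= eps * L).
  { intros s' t' Hs' Ht'.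
    assert (Rabs (s' - s) <= b - a) by (apply (Habs a b); lra).
    assert (Rabs (t' - t) <= d - c) by (apply (Habs c d); lra).
    destruct (Hx s' t') as [K1 K2]; [unfold L in Hw; lra|unfold L in Hw; lra|].
    assert (eps * (Rabs (s' - s) + Rabs (t' - t)) <= eps * L) by (apply Rmult_le_compat_l; unfold L; lra).
    lra. }
  assert (Hh : Rabs (RInt (fun s => p s c) a b - RInt (fun s => p s d) a b - (B * (c - d)) * (b - a)) <= 2 * eps * L * (b - a)).
  { apply RInt_diff_const_bound; try (apply ex_RInt_horizontal; lra); [lra|].
    intros x Hx'. destruct (HpL x c) as [H1 _]; [lra|lra|]. destruct (HpL x d) as [H2 _]; [lra|lra|].
    apply Rabs_le_between in H1. apply Rabs_le_between in H2. apply Rabs_le. lra. }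
  assert (Hv : Rabs (RInt (q a) c d - RInt (q b) c d - (- B * (a - b)) * (d - c)) <= 2 * eps * L * (d - c)).
  { apply RInt_diff_const_bound; try (apply ex_RInt_vertical; lra); [lra|].
    intros x Hx'. destruct (HpL a x) as [_ H1]; [lra|lra|]. destruct (HpL b x) as [_ H2]; [lra|lra|].
    apply Rabs_le_between in H1. apply Rabs_le_between in H2. apply Rabs_le. lra. }
  unfold boundary_int.
  (* The two added terms B (c - d) (b - a) and - B (a - b) (d - c) cancel; this is where closedness
     is used. *)
  replace (RInt (fun s => p s c) a b - RInt (fun s => p s d) a b - RInt (q b) c d + RInt (q a) c d)
    with ((RInt (fun s => p s c) a b - RInt (fun s => p s d) a b - (B * (c - d)) * (b - a)) +
          (RInt (q a) c d - RInt (q b) c d - (- B * (a - b)) * (d - c))) by ring.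
  eapply Rle_trans; [apply Rabs_triang|].
  replace (2 * eps * L ^ 2) with (2 * eps * L * (b - a) + 2 * eps * L * (d - c)) by (unfold L; ring).
  lra.
Qed.

Record rect := Rect { rl : R; rr : R; rb : R; rt : R }.
Let bint Q := boundary_int p q (rl Q) (rr Q) (rb Q) (rt Q).
Let mh Q := (rl Q + rr Q) / 2.
Let mv Q := (rb Q + rt Q) / 2.
Let Q1 Q := Rect (rl Q) (mh Q) (rb Q) (mv Q).
Let Q2 Q := Rect (mh Q) (rr Q) (rb Q) (mv Q).
Let Q3 Q := Rect (rl Q) (mh Q) (mv Q) (rt Q).
Let Q4 Q := Rect (mh Q) (rr Q) (mv Q) (rt Q).
(** Selects a quarter that keeps at least a quarter of the boundary integral. The last quarter is
    the default; [bisect_bound] shows that it qualifies when the other three fail. *)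
Let step Q :=
  if Rle_dec (Rabs (bint Q) / 4) (Rabs (bint (Q1 Q))) then Q1 Q
  else if Rle_dec (Rabs (bint Q) / 4) (Rabs (bint (Q2 Q))) then Q2 Q
  else if Rle_dec (Rabs (bint Q) / 4) (Rabs (bint (Q3 Q))) then Q3 Q else Q4 Q.
Let good Q := a0 <= rl Q <= rr Q /\ rr Q <= b0 /\ c0 <= rb Q <= rt Q /\ rt Q <= d0.

Lemma bisect_bound Q : good Q -> Rabs (bint Q) / 4 <= Rabs (bint (step Q)).
Proof.
  intros [H1 [H2 [H3 H4]]]. unfold step.
  destruct (Rle_dec _ (Rabs (bint (Q1 Q)))) as [|N1]; auto.
  destruct (Rle_dec _ (Rabs (bint (Q2 Q)))) as [|N2]; auto.
  destruct (Rle_dec _ (Rabs (bint (Q3 Q)))) as [|N3]; auto.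
  apply Rnot_le_lt in N1, N2, N3.
  assert (E : bint Q = bint (Q1 Q) + bint (Q2 Q) + (bint (Q3 Q) + bint (Q4 Q))).
  { unfold bint, Q1, Q2, Q3, Q4; simpl. unfold mh, mv.
    rewrite (boundary_int_split_v _ _ _ ((rb Q + rt Q) / 2)) by lra.
    rewrite !(boundary_int_split_h (rl Q) ((rl Q + rr Q) / 2) (rr Q)) by lra. ring. }
  pose proof (Rabs_triang (bint (Q1 Q) + bint (Q2 Q)) (bint (Q3 Q) + bint (Q4 Q))) as T.
  pose proof (Rabs_triang (bint (Q1 Q)) (bint (Q2 Q))).
  pose proof (Rabs_triang (bint (Q3 Q)) (bint (Q4 Q))).
  rewrite <- E in T. lra.
Qed.

Lemma bisect_shape Q : good Q ->
  rl Q <= rl (step Q) /\ rr (step Q) <= rr Q /\ rb Q <= rb (step Q) /\ rt (step Q) <= rt Q /\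
  rr (step Q) - rl (step Q) = (rr Q - rl Q) / 2 /\ rt (step Q) - rb (step Q) = (rt Q - rb Q) / 2.
Proof.
  intros [H1 [H2 [H3 H4]]]. unfold step.
  destruct (Rle_dec _ (Rabs (bint (Q1 Q)))); [|destruct (Rle_dec _ (Rabs (bint (Q2 Q))));
    [|destruct (Rle_dec _ (Rabs (bint (Q3 Q))))]];
  unfold Q1, Q2, Q3, Q4, mh, mv; simpl; repeat split; lra.
Qed.

(** Under n bisections the integral shrinks at most by 4^n, while the local bound at the common
    point of the rectangles shrinks by (2^n)^2. The two factors cancel, and an arbitrary eps
    remains. *)
Theorem goursat : a0 <= b0 -> c0 <= d0 -> boundary_int p q a0 b0 c0 d0 = 0.
Proof.
  intros Hab Hcd.
  set (sq := fix sq n := match n with O => Rect a0 b0 c0 d0 | S n => step (sq n) end).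
  assert (Hgood : forall n, good (sq n)).
  { induction n as [|n IH]; simpl.
    - unfold good; simpl; lra.
    - destruct (bisect_shape _ IH) as [? [? [? [? [? ?]]]]]. destruct IH as [? [? [? ?]]].
      unfold good. lra. }
  assert (Hw : forall n, rr (sq n) - rl (sq n) = (b0 - a0) / 2 ^ n /\ rt (sq n) - rb (sq n) = (d0 - c0) / 2 ^ n).
  { induction n as [|n [IH1 IH2]].
    - simpl. split; field.
    - destruct (bisect_shape _ (Hgood n)) as [_ [_ [_ [_ [E1 E2]]]]].
      change (sq (S n)) with (step (sq n)). rewrite E1, E2, IH1, IH2. simpl.
      split; field; apply pow_nonzero; lra. }
  assert (HJ : forall n, Rabs (bint (sq O)) <= 4 ^ n * Rabs (bint (sq n))).
  { induction n as [|n IH].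
    - simpl. lra.
    - pose proof (bisect_bound _ (Hgood n)) as HB. change (sq (S n)) with (step (sq n)).
      assert (0 < 4 ^ n) by (apply pow_lt; lra). change (4 ^ S n) with (4 * 4 ^ n).
      apply Rmult_le_compat_l with (r := 4 ^ n) in HB; lra. }
  destruct (nested_intervals (fun n => rl (sq n)) (fun n => rr (sq n))) as [s Hs].
  { intros n. apply (bisect_shape _ (Hgood n)). } { intros n. apply (bisect_shape _ (Hgood n)). }
  { intros n. apply (Hgood n). }
  destruct (nested_intervals (fun n => rb (sq n)) (fun n => rt (sq n))) as [t Ht].
  { intros n. apply (bisect_shape _ (Hgood n)). } { intros n. apply (bisect_shape _ (Hgood n)). }
  { intros n. apply (Hgood n). }
  set (L := (b0 - a0) + (d0 - c0)).
  assert (Hle : forall eps, 0 < eps -> Rabs (bint (sq O)) <= 2 * eps * L ^ 2).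
  { intros eps He.
    destruct (boundary_int_local s t eps (Hs O) (Ht O) He) as [r [Hr Hb]].
    destruct (pow_half_lt L r Hr) as [n Hn].
    eapply Rle_trans; [apply (HJ n)|].
    destruct (Hgood n) as [? [? [? ?]]]. specialize (Hs n). specialize (Ht n). destruct (Hw n) as [W1 W2].
    assert (P2 : 2 ^ n <> 0) by (apply pow_nonzero; lra).
    assert (WL : (rr (sq n) - rl (sq n)) + (rt (sq n) - rb (sq n)) = L / 2 ^ n).
    { rewrite W1, W2. unfold L. field; auto. }
    assert (HB : Rabs (bint (sq n)) <= 2 * eps * (L / 2 ^ n) ^ 2).
    { rewrite <- WL. apply Hb; try lra. }
    apply Rmult_le_compat_l with (r := 4 ^ n) in HB; [|apply pow_le; lra].
    replace (2 * eps * L ^ 2) with (4 ^ n * (2 * eps * (L / 2 ^ n) ^ 2)); auto.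
    replace 4 with (2 * 2) by ring. rewrite Rpow_mult_distr. field; auto. }
  apply Rabs_eq_0. apply Rle_antisym; [|apply Rabs_pos].
  change (Rabs (bint (sq O)) <= 0). apply le_epsilon. intros e He.
  (* The summand 1 covers the degenerate rectangle with L = 0. *)
  specialize (Hle (e / (2 * (L ^ 2 + 1)))). 
  assert (0 <= L ^ 2) by apply pow2_ge_0.
  rewrite Rplus_0_l. eapply Rle_trans; [apply Hle|].
  - apply Rdiv_lt_0_compat; lra.
  - replace (2 * (e / (2 * (L ^ 2 + 1))) * L ^ 2) with (e * (L ^ 2 / (L ^ 2 + 1))) by (field; lra).
    rewrite <- (Rmult_1_r e) at 2. apply Rmult_le_compat_l; [lra|].
    apply Rle_div_l; lra.
Qed.
End Goursat.

(** * Cauchy estimates *)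

(** By the Cauchy-Riemann equations: with zeta = s + i t, the form p ds - q dt is minus the
    imaginary part of k(zeta) d zeta. *)
Lemma cdiff_closed_at (k : C -> C) s t : cdiff k (s, t) ->
  closed_at (fun s t => - Im (k (s, t))) (fun s t => Re (k (s, t))) s t.
Proof.
  intros [[l1 l2] H]. exists (- l2), (- l1), (- l2). intros eps He.
  destruct (H eps He) as [d [Hd Hu]]. exists (d / 2); split; [lra|]. intros s' t' Hs Ht.
  specialize (Hu (s', t')).
  assert (Hm : Cmod ((s', t') - (s, t)) <= Rabs (s' - s) + Rabs (t' - t)) by apply Cmod_le_Re_Im.
  assert (Hb : Cmod (k (s', t') - k (s, t) - ((s', t') - (s, t)) * (l1, l2)) <= eps * (Rabs (s' - s) + Rabs (t' - t))).
  { eapply Rle_trans; [apply Hu; lra|]. apply Rmult_le_compat_l; lra. }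
  split.
  - eapply Rle_trans; [|apply Hb]. eapply Rle_trans; [|apply Im_le_Cmod].
    rewrite <- Rabs_Ropp. right. f_equal. destruct (k (s', t')), (k (s, t)); simpl. ring.
  - eapply Rle_trans; [|apply Hb]. eapply Rle_trans; [|apply Re_le_Cmod].
    right. f_equal. destruct (k (s', t')), (k (s, t)); simpl. ring.
Qed.

Lemma cexp_opp_r z : (cexp z * cexp (- z))%C = 1%C.
Proof. rewrite <- cexp_plus. replace (z + - z)%C with (RtoC 0) by ring. apply cexp_0. Qed.

(* In the coordinate [zeta = log (u - z0)] the circles around [z0] become vertical
   segments, so Goursat's lemma makes the mean of [h u / (u - z0)] over a circle
   independent of the radius; letting the radius tend to 0 it equals [h' z0]. *)
Lemma cauchy_Re_bound (h : C -> C) z0 l R0 M : 0 < R0 ->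
  (forall u, Cmod (u - z0) < R0 -> cdiff h u) -> (forall u, Cmod (u - z0) < R0 -> Cmod (h u) <= M) ->
  h z0 = 0 -> cderiv h z0 l -> Rabs (Re l) <= 2 * M / R0.
Proof.
  intros HR Hd HM Hz Hl.
  set (k := fun zeta => (h (z0 + cexp zeta) * cexp (- zeta))%C).
  assert (Hpi := PI_RGT_0).
  assert (Hin : forall s t, exp s < R0 -> Cmod (z0 + cexp (s, t) - z0) < R0).
  { intros s t Hs. replace (z0 + cexp (s, t) - z0)%C with (cexp (s, t)) by ring.
    rewrite Cmod_cexp. exact Hs. }
  assert (Hk : forall s t, exp s < R0 -> cdiff k (s, t)).
  { intros s t Hs. unfold k. apply cdiff_mult.
    - apply (cdiff_comp h (fun zeta => z0 + cexp zeta)%C); [|apply Hd, Hin, Hs].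
      apply cdiff_plus; [apply cdiff_const|apply cdiff_cexp].
    - apply (cdiff_comp cexp (fun zeta => - zeta)%C); [apply cdiff_opp, cdiff_id|apply cdiff_cexp]. }
  (* The outer circle has radius R0 / 2, well inside the disc; this accounts for the factor 2 of the
     bound. *)
  set (s2 := ln (R0 / 2)). assert (Es2 : exp s2 = R0 / 2) by (apply exp_ln; lra).
  set (V := fun s => RInt (fun t => Re (k (s, t))) 0 (2 * PI)).
  assert (Hmono : forall s, s <= s2 -> exp s < R0).
  { intros s Hs. apply Rle_lt_trans with (exp s2); [|lra].
    destruct Hs as [Hs|Hs]; [left; apply exp_increasing; auto|rewrite Hs; lra]. }
  assert (HV : forall s, s <= s2 -> V s = V s2).
  { intros s Hs.
    pose proof (goursat (fun s t => - Im (k (s, t))) (fun s t => Re (k (s, t))) s s2 0 (2 * PI)) as G.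
    unfold boundary_int in G. fold (V s) (V s2) in G.
    (* The horizontal edges of the rectangle cancel because [k] has period 2 pi i. *)
    replace (fun s => - Im (k (s, 2 * PI))) with (fun s => - Im (k (s, 0))) in G.
    - assert (E : RInt (fun s => - Im (k (s, 0))) s s2 - RInt (fun s => - Im (k (s, 0))) s s2 - V s2 + V s = 0); [|lra].
      apply G; auto; [|lra]. intros s' t Hs' Ht. apply cdiff_closed_at, Hk, Hmono; lra.
    - apply functional_extensionality. intros s'. do 2 f_equal. unfold k.
      assert (P1 : cexp (s', 2 * PI) = cexp (s', 0)).
      { rewrite <- (cexp_2pi_periodic (s', 0) 1). f_equal. apply injective_projections; simpl; ring. }
      assert (P2 : cexp (- (s', 2 * PI)) = cexp (- (s', 0))).
      { rewrite <- (cexp_2pi_periodic (- (s', 0)) (-1)). f_equal. apply injective_projections; simpl; ring. }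
      rewrite P1, P2. reflexivity. }
  assert (Hint : forall s, s <= s2 -> ex_RInt (fun t => Re (k (s, t))) 0 (2 * PI)).
  { intros s Hs. apply @ex_RInt_continuous. intros t _.
    apply (closed_at_continuous (fun s t => - Im (k (s, t))) (fun s t => Re (k (s, t)))).
    apply cdiff_closed_at, Hk, Hmono, Hs. }
  assert (HV2 : Rabs (V s2) <= (2 * PI - 0) * (M * (2 / R0))).
  { apply abs_RInt_le_const; [lra|apply Hint; lra|]. intros t _.
    eapply Rle_trans; [apply Re_le_Cmod|]. unfold k. rewrite Cmod_mult, Cmod_cexp.
    assert (E : exp (Re (- (s2, t))) = 2 / R0).
    { simpl. rewrite exp_Ropp, Es2. field; lra. }
    rewrite E. apply Rmult_le_compat_r; [left; apply Rdiv_lt_0_compat; lra|].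
    apply HM, Hin. lra. }
  assert (He : forall eps, 0 < eps -> Rabs (Re l) <= 2 * M / R0 + eps).
  { intros eps He. destruct (Hl eps He) as [d [Hd0 Hu]].
    (* A circle so small that [h u] differs from (u - z0) l by at most eps |u - z0|, hence [k] from
       [l] by at most eps. *)
    set (s := Rmin s2 (ln (d / 2))).
    assert (Hs : s <= s2) by apply Rmin_l.
    assert (Hsd : exp s < d).
    { apply Rle_lt_trans with (exp (ln (d / 2))); [|rewrite exp_ln; lra].
      assert (Hs' : s <= ln (d / 2)) by apply Rmin_r.
      destruct Hs' as [Hs'|Hs']; [left; apply exp_increasing; auto|rewrite Hs'; lra]. }
    assert (HB : Rabs (V s - RInt (fun _ => 0) 0 (2 * PI) - Re l * (2 * PI - 0)) <= eps * (2 * PI - 0)).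
    { apply RInt_diff_const_bound; [lra|apply Hint, Hs|apply ex_RInt_const|].
      intros t _. specialize (Hu (z0 + cexp (s, t))%C).
      replace (z0 + cexp (s, t) - z0)%C with (cexp (s, t)) in Hu by ring.
      rewrite Cmod_cexp in Hu. specialize (Hu Hsd). rewrite Hz in Hu.
      replace (Re (k (s, t)) - 0 - Re l) with (Re (k (s, t) - l)) by (destruct (k (s, t)), l; simpl; ring).
      eapply Rle_trans; [apply Re_le_Cmod|].
      replace (k (s, t) - l)%C with ((h (z0 + cexp (s, t)) - 0 - cexp (s, t) * l) * cexp (- (s, t)))%C.
      - rewrite Cmod_mult, Cmod_cexp.
        replace eps with (eps * exp (Re (s, t)) * exp (Re (- (s, t)))).
        + apply Rmult_le_compat_r; [left; apply exp_pos|exact Hu].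
        + rewrite Rmult_assoc, <- exp_plus. replace (Re (s, t) + Re (- (s, t))) with 0 by (simpl; ring).
          rewrite exp_0; ring.
      - unfold k. transitivity (h (z0 + cexp (s, t)) * cexp (- (s, t)) - l * (cexp (s, t) * cexp (- (s, t))))%C; [ring|].
        rewrite cexp_opp_r. ring. }
    assert (E0 : RInt (fun _ => 0) 0 (2 * PI) = 0) by (rewrite RInt_const; apply Rmult_0_r).
    rewrite E0, HV in HB by auto.
    assert (Hl' : Rabs (Re l * (2 * PI)) <= (2 * PI) * (2 * M / R0 + eps)).
    { replace (Re l * (2 * PI)) with (V s2 - (V s2 - 0 - Re l * (2 * PI - 0))) by ring.
      eapply Rle_trans; [apply Rabs_triang|]. rewrite Rabs_Ropp.
      replace ((2 * PI) * (2 * M / R0 + eps)) with ((2 * PI - 0) * (M * (2 / R0)) + eps * (2 * PI - 0)) by (field; lra).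
      lra. }
    rewrite Rabs_mult, (Rabs_pos_eq (2 * PI)) in Hl' by lra.
    apply Rmult_le_reg_l with (2 * PI); [lra|]. lra. }
  apply le_epsilon. exact He.
Qed.

(** Subtracting [h z0] doubles the bound M. Multiplying by 1 and by -i turns the bound on real parts
    into one on the modulus, which costs another factor 2. *)
Lemma cauchy_deriv_bound (h : C -> C) z0 l R0 M : 0 < R0 ->
  (forall u, Cmod (u - z0) < R0 -> cdiff h u) -> (forall u, Cmod (u - z0) < R0 -> Cmod (h u) <= M) ->
  cderiv h z0 l -> Cmod l <= 8 * M / R0.
Proof.
  intros HR Hd HM Hl.
  assert (HM0 : Cmod (h z0) <= M).
  { apply HM. replace (z0 - z0)%C with (RtoC 0) by ring. rewrite Cmod_0; auto. }
  assert (Hgen : forall c, Cmod c = 1 -> Rabs (Re (c * l)) <= 2 * (2 * M) / R0).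
  { intros c Hc. apply (cauchy_Re_bound (fun u => c * (h u + - h z0))%C z0); auto.
    - intros u Hu. apply cdiff_mult; [apply cdiff_const|]. apply cdiff_plus; [auto|apply cdiff_const].
    - intros u Hu. rewrite Cmod_mult, Hc. specialize (HM u Hu).
      pose proof (Cmod_triangle (h u) (- h z0)) as T. rewrite Cmod_opp in T. lra.
    - ring.
    - pose proof (cderiv_mult (fun _ => c) (fun u => h u + - h z0)%C z0 _ _ (cderiv_const c z0)
        (cderiv_plus _ _ _ _ _ Hl (cderiv_const (- h z0)%C z0))) as H.
      cbv beta in H. replace (c * l)%C with (0 * (h z0 + - h z0) + c * (l + 0))%C by ring. exact H. }
  eapply Rle_trans; [apply Cmod_le_Re_Im|].
  pose proof (Hgen 1%C) as H1. rewrite Cmod_1 in H1. specialize (H1 eq_refl).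
  replace (1 * l)%C with l in H1 by ring.
  pose proof (Hgen (- Ci)%C) as H2. rewrite Cmod_opp in H2.
  assert (Hi : Cmod Ci = 1).
  { unfold Cmod, Ci; simpl. replace (0 * (0 * 1) + 1 * (1 * 1)) with 1 by ring. apply sqrt_1. }
  specialize (H2 Hi).
  replace (Re (- Ci * l)) with (Im l) in H2 by (destruct l; simpl; ring).
  replace (8 * M / R0) with (2 * (2 * M) / R0 + 2 * (2 * M) / R0) by (field; lra). lra.
Qed.

(** The mean value theorem fails for complex values. It is applied to the real part of c h along the
    segment, for c = 1 and c = -i, whence the factor 2. *)
Lemma mean_value_bound (h : C -> C) z w K :
  (forall t, 0 <= t <= 1 -> exists l, cderiv h (w + RtoC t * (z - w)) l /\ Cmod l <= K) ->
  Cmod (h z - h w) <= 2 * K * Cmod (z - w).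
Proof.
  intros H. set (g := fun t => h (w + RtoC t * (z - w))%C).
  assert (Hgen : forall c, Cmod c = 1 -> Rabs (Re (c * (h z - h w))) <= K * Cmod (z - w)).
  { intros c Hc. set (f := fun t => Re (c * g t)).
    destruct (exists_choice (fun t l => 0 <= t <= 1 -> cderiv h (w + RtoC t * (z - w)) l /\ Cmod l <= K)) as [D HD].
    { intros t. destruct (excluded_middle_informative (0 <= t <= 1)) as [Ht|Ht].
      - destruct (H t Ht) as [l Hl]. exists l. auto.
      - exists (RtoC 0). intros; contradiction. }
    assert (Hder : forall t, 0 <= t <= 1 -> is_derive f t (Re (c * ((z - w) * D t)))).
    { intros t Ht. destruct (HD t Ht) as [Hl _].
      apply is_derive_Reals. intros eps He.
      set (m := Cmod (z - w)) in *. assert (Hm : 0 <= m) by apply Cmod_ge_0.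
      destruct (Hl (eps / (2 * (m + 1)))) as [d [Hd0 Hd]]; [apply Rdiv_lt_0_compat; lra|].
      assert (Hd' : 0 < d / (m + 1)) by (apply Rdiv_lt_0_compat; lra).
      exists (mkposreal _ Hd'). intros x Hx0 Hx. simpl in Hx.
      assert (Hx' : 0 < Rabs x) by (apply Rabs_pos_lt; auto).
      specialize (Hd (w + RtoC (t + x) * (z - w))%C).
      replace (w + RtoC (t + x) * (z - w) - (w + RtoC t * (z - w)))%C with (RtoC x * (z - w))%C in Hd
        by (rewrite RtoC_plus; ring).
      rewrite Cmod_mult, Cmod_R in Hd. fold m in Hd.
      assert (Hlt : Rabs x * m < d).
      { apply Rle_lt_trans with (Rabs x * (m + 1)); [apply Rmult_le_compat_l; lra|].
        apply Rmult_lt_compat_r with (r := m + 1) in Hx; [|lra].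
        replace (d / (m + 1) * (m + 1)) with d in Hx by (field; lra). exact Hx. }
      specialize (Hd Hlt). unfold f.
      replace ((Re (c * g (t + x)%R) - Re (c * g t)) / x - Re (c * ((z - w) * D t)))
        with (Re (c * (g (t + x)%R - g t - RtoC x * (z - w) * D t)) / x)
        by (destruct c, (g (t + x)), (g t), (z - w)%C, (D t); simpl; field; auto).
      unfold Rdiv. rewrite Rabs_mult, Rabs_inv. 
      apply Rle_lt_trans with (eps / 2); [|lra].
      apply Rle_div_l; [lra|].
      eapply Rle_trans; [apply Re_le_Cmod|]. rewrite Cmod_mult, Hc, Rmult_1_l.
      eapply Rle_trans; [apply Hd|].
      replace (eps / 2 * Rabs x) with (eps / (2 * (m + 1)) * (Rabs x * (m + 1))) by (field; lra).
      apply Rmult_le_compat_l; [left; apply Rdiv_lt_0_compat; lra|]. apply Rmult_le_compat_l; lra. }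
    destruct (MVT_gen f 0 1 (fun t => Re (c * ((z - w) * D t)))) as [t [Ht E]].
    - intros t Ht. rewrite Rmin_left, Rmax_right in Ht by lra. apply Hder; lra.
    - intros t Ht. rewrite Rmin_left, Rmax_right in Ht by lra.
      apply derivable_continuous_pt. eexists. apply is_derive_Reals. apply Hder; lra.
    - rewrite Rmin_left, Rmax_right in Ht by lra.
      unfold f, g in E.
      replace (w + RtoC 1 * (z - w))%C with z in E by ring.
      replace (w + RtoC 0 * (z - w))%C with w in E by ring.
      replace (Re (c * (h z - h w))) with (Re (c * h z) - Re (c * h w)) by (destruct c, (h z), (h w); simpl; ring).
      rewrite E. replace (Re (c * ((z - w) * D t)) * (1 - 0)) with (Re (c * ((z - w) * D t))) by ring.
      eapply Rle_trans; [apply Re_le_Cmod|]. rewrite !Cmod_mult, Hc, Rmult_1_l, Rmult_comm.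
      apply Rmult_le_compat_r; [apply Cmod_ge_0|]. apply (HD t Ht). }
  eapply Rle_trans; [apply Cmod_le_Re_Im|].
  pose proof (Hgen 1%C) as H1. rewrite Cmod_1 in H1. specialize (H1 eq_refl).
  replace (1 * (h z - h w))%C with (h z - h w)%C in H1 by ring.
  pose proof (Hgen (- Ci)%C) as H2. rewrite Cmod_opp in H2.
  assert (Hi : Cmod Ci = 1).
  { unfold Cmod, Ci; simpl. replace (0 * (0 * 1) + 1 * (1 * 1)) with 1 by ring. apply sqrt_1. }
  specialize (H2 Hi).
  replace (Re (- Ci * (h z - h w))) with (Im (h z - h w)) in H2 by (destruct (h z - h w)%C; simpl; ring).
  lra.
Qed.

Lemma cauchy_lipschitz (h : C -> C) z w R0 M : 0 < R0 ->
  (forall u t, 0 <= t <= 1 -> Cmod (u - (w + RtoC t * (z - w))) < R0 -> cdiff h u /\ Cmod (h u) <= M) ->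
  Cmod (h z - h w) <= 16 * M / R0 * Cmod (z - w).
Proof.
  intros HR H. replace (16 * M / R0) with (2 * (8 * M / R0)) by (field; lra).
  apply mean_value_bound. intros t Ht.
  set (c := (w + RtoC t * (z - w))%C) in *.
  destruct (H c t Ht) as [[l Hl] _].
  { fold c. replace (c - c)%C with (RtoC 0) by ring. rewrite Cmod_0; auto. }
  exists l; split; auto. apply cauchy_deriv_bound with h c; auto; intros u Hu; apply (H u t Ht Hu).
Qed.

(** * Holomorphic functions on strips *)

Definition holo1 (r : R) (f : C -> C) : Prop := forall z, Rabs (Im z) < r -> cdiff f z.

Lemma Im_near (u z : C) d : Cmod (u - z) < d -> Rabs (Im u) < Rabs (Im z) + d.
Proof.
  intros H. pose proof (Im_le_Cmod (u - z)) as H1.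
  replace (Im (u - z)) with (Im u - Im z) in H1 by (destruct u, z; simpl; ring).
  pose proof (Rabs_triang_inv (Im u) (Im z)). lra.
Qed.

Lemma Im_segment (z w : C) t r : 0 <= t <= 1 -> Rabs (Im z) < r -> Rabs (Im w) < r ->
  Rabs (Im (w + RtoC t * (z - w))) < r.
Proof.
  intros Ht Hz Hw. replace (Im (w + RtoC t * (z - w))) with ((1 - t) * Im w + t * Im z)
    by (destruct z, w; simpl; ring).
  apply Rabs_def2 in Hz as [Hz1 Hz2]. apply Rabs_def2 in Hw as [Hw1 Hw2].
  destruct (Rle_lt_dec t (1 / 2)); apply Rabs_def1; nra.
Qed.

(** The segment stays in the strip of half the width, so around each of its points there is a disc
    of radius r / 2 in the full strip. *)
Lemma holo1_lipschitz r f M z w : 0 < r -> holo1 r f ->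
  (forall u, Rabs (Im u) < r -> Cmod (f u) <= M) -> Rabs (Im z) < r / 2 -> Rabs (Im w) < r / 2 ->
  Cmod (f z - f w) <= 32 * M / r * Cmod (z - w).
Proof.
  intros Hr Hf HM Hz Hw. replace (32 * M / r) with (16 * M / (r / 2)) by (field; lra).
  apply cauchy_lipschitz; [lra|]. intros u t Ht Hu.
  assert (Rabs (Im u) < r).
  { apply Im_near in Hu. pose proof (Im_segment z w t (r / 2) Ht Hz Hw). lra. }
  split; [apply Hf|apply HM]; auto.
Qed.

Lemma C_cauchy_complete (l : nat -> C) :
  (forall eps, 0 < eps -> exists N, forall n m, (N <= n)%nat -> (N <= m)%nat -> Cmod (l n - l m) < eps) ->
  exists L, forall eps, 0 < eps -> exists N, forall n, (N <= n)%nat -> Cmod (l n - L) < eps.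
Proof.
  intros H.
  destruct (Rcomplete.R_complete (fun n => Re (l n))) as [x Hx].
  { intros eps He. destruct (H eps He) as [N HN]. exists N. intros n m Hn Hm.
    unfold Rdist. eapply Rle_lt_trans; [|apply (HN n m); lia].
    replace (Re (l n) - Re (l m)) with (Re (l n - l m)) by (destruct (l n), (l m); simpl; ring). apply Re_le_Cmod. }
  destruct (Rcomplete.R_complete (fun n => Im (l n))) as [y Hy].
  { intros eps He. destruct (H eps He) as [N HN]. exists N. intros n m Hn Hm.
    unfold Rdist. eapply Rle_lt_trans; [|apply (HN n m); lia].
    replace (Im (l n) - Im (l m)) with (Im (l n - l m)) by (destruct (l n), (l m); simpl; ring). apply Im_le_Cmod. }
  exists (x, y). intros eps He.
  destruct (Hx (eps / 2)) as [N1 H1]; [lra|]. destruct (Hy (eps / 2)) as [N2 H2]; [lra|].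
  exists (max N1 N2). intros n Hn. specialize (H1 n ltac:(lia)). specialize (H2 n ltac:(lia)).
  eapply Rle_lt_trans; [apply Cmod_le_Re_Im|]. unfold Rdist in *.
  destruct (l n) as [a b]; simpl in *. unfold Rminus in *. lra.
Qed.

(** No integral representation is used: Cauchy estimates for [fs n] - [fs m] make the derivatives at
    z a Cauchy sequence and make the increments of [fs n] - [fs m] small relative to |u - z|; the
    latter survives m to infinity. *)
Lemma holo1_uniform_limit r (fs : nat -> C -> C) (f : C -> C) : 0 < r ->
  (forall n, holo1 r (fs n)) ->
  (forall eps, 0 < eps -> exists N, forall n z, (N <= n)%nat -> Rabs (Im z) < r -> Cmod (fs n z - f z) <= eps) ->
  holo1 r f.
Proof.
  intros Hr Hfs Hu z Hz.
  (* Half the distance to the boundary, so that discs of radius [rho] around points at distance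
     below [rho] from z remain in the strip. *)
  set (rho := (r - Rabs (Im z)) / 2). assert (Hrho : 0 < rho) by (unfold rho; lra).
  assert (Hin : forall u, Cmod (u - z) < rho + rho -> Rabs (Im u) < r).
  { intros u Hu'. apply Im_near in Hu'. unfold rho in Hu'. lra. }
  assert (Hz0 : Cmod (z - z) = 0) by (replace (z - z)%C with (RtoC 0) by ring; apply Cmod_0).
  destruct (exists_choice (fun n l => cderiv (fs n) z l)) as [l Hl].
  { intros n. apply (Hfs n z Hz). }
  assert (Hdiff : forall eps, 0 < eps -> exists N, forall n m u, (N <= n)%nat -> (N <= m)%nat ->
     Rabs (Im u) < r -> Cmod (fs n u - fs m u) <= eps).
  { intros eps He. destruct (Hu (eps / 2)) as [N HN]; [lra|]. exists N. intros n m u Hn Hm Hu'.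
    eapply Rle_trans; [apply (Cmod_sub_triangle _ (f u))|].
    rewrite (Cmod_sub_sym (f u)). pose proof (HN n u Hn Hu'). pose proof (HN m u Hm Hu'). lra. }
  destruct (C_cauchy_complete l) as [L HL].
  { intros eps He. destruct (Hdiff (eps * rho / 16)) as [N HN]; [apply Rdiv_lt_0_compat; [apply Rmult_lt_0_compat|]; lra|].
    exists N. intros n m Hn Hm.
    assert (Cmod (l n + RtoC (-1) * l m) <= 8 * (eps * rho / 16) / rho).
    { apply cauchy_deriv_bound with (fun u => fs n u + RtoC (-1) * fs m u)%C z; auto.
      - intros u Hu'. apply cdiff_plus; [|apply cdiff_mult; [apply cdiff_const|]]; apply Hfs, Hin; lra.
      - intros u Hu'. replace (fs n u + RtoC (-1) * fs m u)%C with (fs n u - fs m u)%C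
          by (apply injective_projections; simpl; ring). apply HN; auto. apply Hin; lra.
      - apply cderiv_plus; auto.
        pose proof (cderiv_mult (fun _ => RtoC (-1)) (fs m) z _ _ (cderiv_const _ z) (Hl m)) as Hm'.
        replace (RtoC (-1) * l m)%C with (0 * fs m z + RtoC (-1) * l m)%C by ring. exact Hm'. }
    replace (l n - l m)%C with (l n + RtoC (-1) * l m)%C by (apply injective_projections; simpl; ring).
    replace (8 * (eps * rho / 16) / rho) with (eps / 2) in H by (field; lra). lra. }
  assert (Htail : forall eps, 0 < eps -> exists N, forall n u, (N <= n)%nat -> Cmod (u - z) < rho ->
     Cmod ((f u - fs n u) - (f z - fs n z)) <= eps * Cmod (u - z)).
  { intros eps He. destruct (Hdiff (eps * rho / 16)) as [N HN]; [apply Rdiv_lt_0_compat; [apply Rmult_lt_0_compat|]; lra|].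
    exists N. intros n u Hn Hu'. apply le_epsilon. intros e He'.
    destruct (Hu (e / 2)) as [N2 HN2]; [lra|]. set (m := max N N2).
    assert (HB : Cmod ((fs m u - fs n u) - (fs m z - fs n z)) <= eps * Cmod (u - z)).
    { replace eps with (16 * (eps * rho / 16) / rho) by (field; lra).
      apply (cauchy_lipschitz (fun v => fs m v - fs n v)%C); auto.
      intros v t Ht Hv.
      assert (Hv' : Cmod (v - z) < rho + rho).
      { eapply Rle_lt_trans; [apply (Cmod_sub_triangle _ (z + RtoC t * (u - z))%C)|].
        apply Rplus_lt_le_compat; auto.
        replace (z + RtoC t * (u - z) - z)%C with (RtoC t * (u - z))%C by ring.
        rewrite Cmod_mult, Cmod_R, Rabs_pos_eq by lra. pose proof (Cmod_ge_0 (u - z)). nra. }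
      split; [apply cdiff_minus; apply Hfs, Hin, Hv'|]. apply HN; [unfold m; lia|auto|apply Hin, Hv']. }
    assert (H1 := HN2 m u ltac:(unfold m; lia) (Hin u ltac:(lra))).
    assert (H2 := HN2 m z ltac:(unfold m; lia) Hz).
    replace ((f u - fs n u) - (f z - fs n z))%C
      with (((fs m u - fs n u) - (fs m z - fs n z)) + ((f u - fs m u) + (fs m z - f z)))%C by ring.
    eapply Rle_trans; [apply Cmod_triangle|].
    pose proof (Cmod_triangle (f u - fs m u) (fs m z - f z)).
    rewrite (Cmod_sub_sym (f u)) in H. lra. }
  exists L. intros eps He.
  destruct (Htail (eps / 3)) as [N1 H1]; [lra|]. destruct (HL (eps / 3)) as [N2 H2]; [lra|].
  set (n := max N1 N2).
  destruct (Hl n (eps / 3)) as [d [Hd Hd']]; [lra|].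
  exists (Rmin d rho). split; [apply Rmin_pos; auto|]. intros u Hu'.
  apply Rmin_Rgt in Hu' as [Hu1 Hu2].
  specialize (Hd' u Hu1). specialize (H1 n u ltac:(unfold n; lia) Hu2). specialize (H2 n ltac:(unfold n; lia)).
  replace (f u - f z - (u - z) * L)%C
    with ((fs n u - fs n z - (u - z) * l n) + ((f u - fs n u) - (f z - fs n z)) + (u - z) * (l n - L))%C by ring.
  eapply Rle_trans; [apply Cmod_triangle|].
  eapply Rle_trans; [apply Rplus_le_compat_r, Cmod_triangle|]. rewrite Cmod_mult.
  pose proof (Cmod_ge_0 (u - z)). nra.
Qed.

(** * Separately holomorphic functions of two variables *)

Definition jcont (g : C -> C -> C) (z w : C) : Prop :=
  forall eps, 0 < eps -> exists delta, 0 < delta /\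
    forall z' w', Cmod (z' - z) < delta -> Cmod (w' - w) < delta -> Cmod (g z' w' - g z w) < eps.

Definition holo2 (r : R) (g : C -> C -> C) : Prop :=
  forall z w, Rabs (Im z) < r -> Rabs (Im w) < r ->
    jcont g z w /\ cdiff (fun u => g u w) z /\ cdiff (fun u => g z u) w.

Lemma holo_on_stripP r g : holo_on_strip r g <-> holo2 r g.
Proof.
  split.
  - intros [H1 H2] z w Hz Hw. split; [|split].
    + exact (H1 z w (conj Hz Hw)).
    + apply C_differentiable_atP. apply (H2 z w (conj Hz Hw)).
    + apply C_differentiable_atP. apply (H2 z w (conj Hz Hw)).
  - intros H. split; intros z w [Hz Hw]; destruct (H z w Hz Hw) as [H1 [H2 H3]].
    + exact H1.
    + split; apply C_differentiable_atP; auto.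
Qed.

Lemma holo2_mono r r' g : r' <= r -> holo2 r g -> holo2 r' g.
Proof. intros Hr H z w Hz Hw. apply H; lra. Qed.

Lemma jcont_comp (g : C -> C -> C) (A B : C -> C -> C) z w :
  jcont A z w -> jcont B z w -> jcont g (A z w) (B z w) -> jcont (fun z w => g (A z w) (B z w)) z w.
Proof.
  intros HA HB Hg eps He. destruct (Hg eps He) as [d [Hd Hx]].
  destruct (HA d Hd) as [d1 [H1 K1]]. destruct (HB d Hd) as [d2 [H2 K2]].
  exists (Rmin d1 d2); split; [apply Rmin_pos; auto|]. intros z' w' Hz Hw.
  apply Rmin_Rgt in Hz as [? ?]. apply Rmin_Rgt in Hw as [? ?]. apply Hx; auto.
Qed.

Lemma jcont_of_cont (f : C -> C) z w : cdiff f z -> jcont (fun z _ => f z) z w.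
Proof.
  intros H eps He. destruct (cdiff_continuous f z H eps He) as [d [Hd Hx]].
  exists d; split; auto.
Qed.

Lemma jcont_const c z w : jcont (fun _ _ => c) z w.
Proof. apply jcont_of_cont, cdiff_const. Qed.
Lemma jcont_fst z w : jcont (fun z _ => z) z w.
Proof. intros eps He; exists eps; auto. Qed.
Lemma jcont_snd z w : jcont (fun _ w => w) z w.
Proof. intros eps He; exists eps; auto. Qed.

Lemma jcont_plus z w : jcont (fun a b => a + b)%C z w.
Proof.
  intros eps He. exists (eps / 2); split; [lra|]. intros z' w' Hz Hw.
  replace (z' + w' - (z + w))%C with ((z' - z) + (w' - w))%C by ring.
  eapply Rle_lt_trans; [apply Cmod_triangle|]. lra.
Qed.

Lemma holo2_const r c : holo2 r (fun _ _ => c).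
Proof. intros z w _ _. split; [apply jcont_const|split; apply cdiff_const]. Qed.
Lemma holo2_fst r : holo2 r (fun z _ => z).
Proof. intros z w _ _. split; [apply jcont_fst|split; [apply cdiff_id|apply cdiff_const]]. Qed.
Lemma holo2_snd r : holo2 r (fun _ w => w).
Proof. intros z w _ _. split; [apply jcont_snd|split; [apply cdiff_const|apply cdiff_id]]. Qed.

Lemma holo2_plus r f g : holo2 r f -> holo2 r g -> holo2 r (fun z w => f z w + g z w)%C.
Proof.
  intros Hf Hg z w Hz Hw. destruct (Hf z w Hz Hw) as [? [? ?]]. destruct (Hg z w Hz Hw) as [? [? ?]].
  split; [|split; apply cdiff_plus; auto]. apply (jcont_comp (fun a b => a + b)%C); auto. apply jcont_plus.
Qed.

Lemma holo2_comp1 r r' f g : holo1 r' f -> holo2 r g ->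
  (forall z w, Rabs (Im z) < r -> Rabs (Im w) < r -> Rabs (Im (g z w)) < r') ->
  holo2 r (fun z w => f (g z w)).
Proof.
  intros Hf Hg H z w Hz Hw. destruct (Hg z w Hz Hw) as [? [? ?]].
  assert (cdiff f (g z w)) by (apply Hf, H; auto).
  split; [|split].
  - apply (jcont_comp (fun a _ => f a) g g); auto. apply jcont_of_cont; auto.
  - apply (cdiff_comp f (fun u => g u w)); auto.
  - apply (cdiff_comp f (fun u => g z u)); auto.
Qed.

Lemma holo2_scal r c g : holo2 r g -> holo2 r (fun z w => c * g z w)%C.
Proof.
  intros Hg z w Hz Hw. destruct (Hg z w Hz Hw) as [? [? ?]].
  assert (Hc : forall u, cdiff (fun u => (c * u)%C) u).
  { intros u. apply cdiff_mult; [apply cdiff_const|apply cdiff_id]. }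
  split; [|split].
  - apply (jcont_comp (fun a _ => (c * a)%C) g g); auto. apply (jcont_of_cont (fun u => (c * u)%C)); auto.
  - apply (cdiff_comp (fun u => (c * u)%C) (fun u => g u w)); auto.
  - apply (cdiff_comp (fun u => (c * u)%C) (fun u => g z u)); auto.
Qed.

Definition bounded2 (r : R) (g : C -> C -> C) (M : R) : Prop :=
  forall z w, Rabs (Im z) < r -> Rabs (Im w) < r -> Cmod (g z w) <= M.

Lemma holo2_lipschitz_fst r g M z z' w : 0 < r -> holo2 r g -> bounded2 r g M ->
  Rabs (Im z) < r / 2 -> Rabs (Im z') < r / 2 -> Rabs (Im w) < r ->
  Cmod (g z w - g z' w) <= 32 * M / r * Cmod (z - z').
Proof.
  intros Hr Hg HM Hz Hz' Hw. apply (holo1_lipschitz r (fun u => g u w)); auto.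
  intros u Hu. apply (Hg u w Hu Hw).
Qed.

Lemma holo2_lipschitz_snd r g M z w w' : 0 < r -> holo2 r g -> bounded2 r g M ->
  Rabs (Im z) < r -> Rabs (Im w) < r / 2 -> Rabs (Im w') < r / 2 ->
  Cmod (g z w - g z w') <= 32 * M / r * Cmod (w - w').
Proof.
  intros Hr Hg HM Hz Hw Hw'. apply (holo1_lipschitz r (fun u => g z u)); auto.
  intros u Hu. apply (Hg z u Hz Hu).
Qed.

Lemma cderiv_quadratic (X : C -> C) u0 K d : 0 < d -> 0 <= K ->
  (forall u, Cmod (u - u0) < d -> Cmod (X u) <= K * Cmod (u - u0) ^ 2) -> cderiv X u0 0.
Proof.
  intros Hd HK H eps He.
  assert (E0 : X u0 = 0).
  { apply Cmod_eq_0. apply Rle_antisym; [|apply Cmod_ge_0].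
    specialize (H u0). replace (u0 - u0)%C with (RtoC 0) in H by ring. rewrite Cmod_0 in H.
    specialize (H Hd). simpl in H. lra. }
  exists (Rmin d (eps / (K + 1))); split.
  { apply Rmin_pos; auto. apply Rdiv_lt_0_compat; lra. }
  intros u Hu. apply Rmin_Rgt in Hu as [Hu1 Hu2]. rewrite E0.
  replace (X u - 0 - (u - u0) * 0)%C with (X u) by ring.
  eapply Rle_trans; [apply H; auto|]. set (x := Cmod (u - u0)) in *.
  assert (Hx : 0 <= x) by apply Cmod_ge_0.
  replace (K * x ^ 2) with (K * x * x) by ring. apply Rmult_le_compat_r; auto.
  assert (x * (K + 1) <= eps).
  { apply Rlt_le in Hu2. apply Rmult_le_compat_r with (r := K + 1) in Hu2; [|lra].
    replace (eps / (K + 1) * (K + 1)) with eps in Hu2 by (field; lra). exact Hu2. }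
  nra.
Qed.

(* The mixed second difference of [g] is quadratically small by the Cauchy estimates,
   so separate differentiability suffices for the chain rule. *)
Lemma cdiff_comp2 r g M (a b : C -> C) u0 : 0 < r -> holo2 r g -> bounded2 r g M ->
  Rabs (Im (a u0)) < r / 4 -> Rabs (Im (b u0)) < r / 4 -> cdiff a u0 -> cdiff b u0 ->
  cdiff (fun u => g (a u) (b u)) u0.
Proof.
  intros Hr Hg HM Ha Hb Hda Hdb.
  set (a0 := a u0) in *. set (b0 := b u0) in *.
  set (X := fun u => ((g (a u) (b u) - g (a u) b0) - (g a0 (b u) - g a0 b0))%C).
  apply cdiff_ext with (fun u => (g (a u) b0 + g a0 (b u)) + (X u + - g a0 b0))%C.
  { intros u. unfold X. ring. }
  destruct (Hg a0 b0) as [_ [Hg1 Hg2]]; [lra|lra|].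
  apply cdiff_plus; [apply cdiff_plus|apply cdiff_plus; [|apply cdiff_const]].
  { apply (cdiff_comp (fun v => g v b0) a); auto. }
  { apply (cdiff_comp (fun v => g a0 v) b); auto. }
  assert (HM0 : 0 <= M).
  { eapply Rle_trans; [apply Cmod_ge_0|apply (HM a0 b0); lra]. }
  destruct Hda as [la Hla]. destruct Hdb as [lb Hlb].
  destruct (cderiv_lipschitz _ _ _ Hla) as [d1 [Hd1 H1]].
  destruct (cderiv_lipschitz _ _ _ Hlb) as [d2 [Hd2 H2]].
  destruct (cdiff_continuous a u0 (ex_intro _ _ Hla) (r / 4)) as [d3 [Hd3 H3]]; [lra|].
  destruct (cdiff_continuous b u0 (ex_intro _ _ Hlb) (r / 4)) as [d4 [Hd4 H4]]; [lra|].
  pose proof (Cmod_ge_0 la). pose proof (Cmod_ge_0 lb).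
  set (K := 16 * (32 * M / r * (Cmod lb + 1)) / (r / 4) * (Cmod la + 1)).
  assert (HK0 : 0 <= 32 * M / r) by (apply Rdiv_le_0_compat; lra).
  exists (RtoC 0). apply cderiv_quadratic with K (Rmin (Rmin d1 d2) (Rmin d3 d4)).
  { repeat apply Rmin_pos; auto. }
  { unfold K. apply Rmult_le_pos; [|lra]. apply Rdiv_le_0_compat; [|lra].
    apply Rmult_le_pos; [lra|]. apply Rmult_le_pos; lra. }
  intros u Hu. apply Rmin_Rgt in Hu as [Hu1 Hu2]. apply Rmin_Rgt in Hu1 as [Hu1 Hu1'].
  apply Rmin_Rgt in Hu2 as [Hu2 Hu2'].
  specialize (H1 u Hu1). specialize (H2 u Hu1'). specialize (H3 u Hu2). specialize (H4 u Hu2').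
  fold a0 in H1, H3. fold b0 in H2, H4.
  pose proof (Im_near _ _ _ H3) as Ia. pose proof (Im_near _ _ _ H4) as Ib.
  set (x := Cmod (u - u0)) in *. assert (Hx : 0 <= x) by apply Cmod_ge_0.
  unfold X.
  assert (HB : Cmod ((g (a u) (b u) - g (a u) b0) - (g a0 (b u) - g a0 b0))
     <= 16 * (32 * M / r * ((Cmod lb + 1) * x)) / (r / 4) * Cmod (a u - a0)).
  { apply (cauchy_lipschitz (fun v => g v (b u) - g v b0)%C); [lra|].
    intros v t Ht Hv.
    assert (Hv' : Rabs (Im v) < r).
    { apply Im_near in Hv. pose proof (Im_segment (a u) a0 t (r / 2) Ht ltac:(lra) ltac:(lra)). lra. }
    split.
    - apply cdiff_minus; [apply (Hg v (b u))|apply (Hg v b0)]; lra.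
    - eapply Rle_trans; [apply (holo2_lipschitz_snd r g M); auto; lra|].
      apply Rmult_le_compat_l; auto. }
  eapply Rle_trans; [apply HB|].
  replace (K * x ^ 2) with (16 * (32 * M / r * ((Cmod lb + 1) * x)) / (r / 4) * ((Cmod la + 1) * x)) by (unfold K; field; lra).
  apply Rmult_le_compat_l; auto. apply Rdiv_le_0_compat; [|lra].
  apply Rmult_le_pos; [lra|]. apply Rmult_le_pos; auto. apply Rmult_le_pos; lra.
Qed.

Lemma holo2_comp2 r rS s M A B : 0 < rS -> holo2 rS s -> bounded2 rS s M -> holo2 r A -> holo2 r B ->
  (forall z w, Rabs (Im z) < r -> Rabs (Im w) < r -> Rabs (Im (A z w)) < rS / 4 /\ Rabs (Im (B z w)) < rS / 4) ->
  holo2 r (fun z w => s (A z w) (B z w)).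
Proof.
  intros HrS Hs HM HA HB H z w Hz Hw. destruct (HA z w Hz Hw) as [? [? ?]]. destruct (HB z w Hz Hw) as [? [? ?]].
  destruct (H z w Hz Hw). split; [|split].
  - apply (jcont_comp s A B); auto. apply Hs; lra.
  - apply (cdiff_comp2 rS s M (fun u => A u w) (fun u => B u w)); auto.
  - apply (cdiff_comp2 rS s M (fun u => A z u) (fun u => B z u)); auto.
Qed.

(** * Lifts of torus maps conjugated to skew translations *)

Definition ext_on (r : R) (f : R -> R -> R) (g : C -> C -> C) (M : R) : Prop :=
  holo2 r g /\ (forall x y, g (RtoC x) (RtoC y) = RtoC (f x y)) /\ bounded2 r g M.

Lemma holo_ext_bounded_byP r f M : holo_ext_bounded_by r f M <-> exists g, ext_on r f g M.
Proof.
  split.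
  - intros [g [H1 [H2 H3]]]. exists g. split; [apply holo_on_stripP; auto|split; auto].
    intros z w Hz Hw. apply (H3 z w). split; auto.
  - intros [g [H1 [H2 H3]]]. exists g. split; [apply holo_on_stripP; auto|split; auto].
    intros z w [Hz Hw]. apply H3; auto.
Qed.

Lemma Im_RtoC x : Im (RtoC x) = 0. Proof. reflexivity. Qed.

Lemma Cmod_sub_Re (z : C) : Cmod (z - RtoC (Re z)) = Rabs (Im z).
Proof.
  destruct z as [x y]. simpl.
  replace ((x, y) - RtoC x)%C with (Ci * RtoC y)%C by (apply injective_projections; simpl; ring).
  rewrite Cmod_mult, Cmod_R. replace (Cmod Ci) with 1; [ring|].
  unfold Cmod, Ci; simpl. replace (0 * (0 * 1) + 1 * (1 * 1)) with 1 by ring. symmetry; apply sqrt_1.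
Qed.

Lemma bounded2_pos r g M : 0 < r -> bounded2 r g M -> 0 <= M.
Proof.
  intros Hr H. eapply Rle_trans; [apply Cmod_ge_0|apply (H 0%C 0%C)]; rewrite Im_RtoC, Rabs_R0; auto.
Qed.

(** Complex extension of one component of a lift: a row of the integer matrix plus the extended
    periodic part. *)
Definition lin_ext (a b : R) (g : C -> C -> C) (z w : C) : C := (RtoC a * z + RtoC b * w + g z w)%C.

(** The imaginary part vanishes on the real plane, and the Cauchy estimates bound its growth away
    from it. *)
Lemma lin_ext_Im_bound a b r t g M z w : 0 < r -> ext_on r t g M ->
  Rabs (Im z) < r / 2 -> Rabs (Im w) < r / 2 ->
  Rabs (Im (lin_ext a b g z w)) <= (Rabs a + Rabs b + 32 * M / r) * (Rabs (Im z) + Rabs (Im w)).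
Proof.
  intros Hr [Hg [Hreal HM]] Hz Hw.
  assert (HM0 := bounded2_pos r g M Hr HM).
  assert (E : Im (lin_ext a b g z w) = a * Im z + b * Im w + Im (g z w - g (RtoC (Re z)) (RtoC (Re w)))).
  { unfold lin_ext. rewrite Hreal. destruct z, w, (g _ _); simpl. ring. }
  rewrite E.
  assert (HL : Cmod (g z w - g (RtoC (Re z)) (RtoC (Re w))) <= 32 * M / r * (Rabs (Im z) + Rabs (Im w))).
  { eapply Rle_trans; [apply (Cmod_sub_triangle _ (g (RtoC (Re z)) w))|].
    rewrite Rmult_plus_distr_l, <- (Cmod_sub_Re z), <- (Cmod_sub_Re w).
    apply Rplus_le_compat.
    - apply (holo2_lipschitz_fst r g M); auto; try (rewrite Im_RtoC, Rabs_R0); lra.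
    - apply (holo2_lipschitz_snd r g M); auto; try (rewrite Im_RtoC, Rabs_R0); lra. }
  pose proof (Im_le_Cmod (g z w - g (RtoC (Re z)) (RtoC (Re w)))).
  eapply Rle_trans; [apply Rabs_triang|].
  pose proof (Rabs_triang (a * Im z) (b * Im w)) as T. rewrite !Rabs_mult in T.
  pose proof (Rabs_pos a). pose proof (Rabs_pos b). pose proof (Rabs_pos (Im z)). pose proof (Rabs_pos (Im w)).
  nra.
Qed.

(** Makes the inner map of a composition land in whatever strip the outer map requires. *)
Lemma inner_strip a b c d rT t1 g1 M1 t2 g2 M2 mu : 0 < rT -> 0 < mu ->
  ext_on rT t1 g1 M1 -> ext_on rT t2 g2 M2 ->
  exists r, 0 < r <= rT /\ forall z w, Rabs (Im z) < r -> Rabs (Im w) < r ->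
    Rabs (Im (lin_ext a b g1 z w)) < mu /\ Rabs (Im (lin_ext c d g2 z w)) < mu.
Proof.
  intros HrT Hmu H1 H2.
  assert (HM1 := bounded2_pos _ _ _ HrT (proj2 (proj2 H1))).
  assert (HM2 := bounded2_pos _ _ _ HrT (proj2 (proj2 H2))).
  assert (P1 : 0 <= 32 * M1 / rT) by (apply Rdiv_le_0_compat; lra).
  assert (P2 : 0 <= 32 * M2 / rT) by (apply Rdiv_le_0_compat; lra).
  pose proof (Rabs_pos a). pose proof (Rabs_pos b). pose proof (Rabs_pos c). pose proof (Rabs_pos d).
  set (K1 := Rabs a + Rabs b + 32 * M1 / rT) in *. set (K2 := Rabs c + Rabs d + 32 * M2 / rT).
  assert (0 <= K1) by (unfold K1; lra). assert (0 <= K2) by (unfold K2; lra).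
  set (r := Rmin (rT / 2) (mu / (2 * (K1 + K2 + 1)))).
  assert (Hr : 0 < r) by (apply Rmin_pos; [lra|apply Rdiv_lt_0_compat; lra]).
  assert (Hr2 : r <= rT / 2) by apply Rmin_l.
  assert (Hr3 : r * (2 * (K1 + K2 + 1)) <= mu).
  { apply Rle_div_r; [lra|apply Rmin_r]. }
  exists r; split; [lra|]. intros z w Hz Hw.
  pose proof (lin_ext_Im_bound a b rT t1 g1 M1 z w HrT H1 ltac:(lra) ltac:(lra)) as B1.
  pose proof (lin_ext_Im_bound c d rT t2 g2 M2 z w HrT H2 ltac:(lra) ltac:(lra)) as B2.
  fold K1 in B1. fold K2 in B2.
  pose proof (Rabs_pos (Im z)). pose proof (Rabs_pos (Im w)).
  split; nra.
Qed.

Definition skew (alpha beta : R) (phi : R -> R) (p : R * R) : R * R :=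
  (fst p + alpha, snd p + beta + phi (fst p)).

(** Two bounds are kept apart: [eta] limits how far the fibre translation leaves the real direction
    and must fit the strip of the outer map, while [B] only has to be finite. *)
Definition skew_ext (rho eta : R) (phi : R -> R) (phic : C -> C) (B : R) : Prop :=
  holo1 rho phic /\ (forall x, phic (RtoC x) = RtoC (phi x)) /\
  (forall z, Rabs (Im z) < rho -> Rabs (Im (phic z)) <= eta /\ Cmod (phic z) <= B).

Section Component.
Variables (a b c d a' b' : R) (rS rho r : R).
Variables (s t1 t2 : R -> R -> R) (gs g1 g2 : C -> C -> C) (MS M1 M2 : R).
Hypothesis (HrS : 0 < rS) (Hr : 0 < r) (Hs : ext_on rS s gs MS).
Hypothesis (H1 : ext_on r t1 g1 M1) (H2 : ext_on r t2 g2 M2).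
Hypothesis Hin : forall z w, Rabs (Im z) < r -> Rabs (Im w) < r ->
    Rabs (Im (lin_ext a b g1 z w)) < Rmin rho (rS / 8) /\ Rabs (Im (lin_ext c d g2 z w)) < Rmin rho (rS / 8).

(** Extension of the periodic part of a component of S o [skew] o T. The row (a', b') of the matrix
    of S, applied to the linear part of T, belongs to the linear part of the composition and is left
    out. *)
Definition comp_ext (alpha beta : R) (phic : C -> C) (z w : C) : C :=
  (RtoC a' * (g1 z w + RtoC alpha) + RtoC b' * (g2 z w + RtoC beta + phic (lin_ext a b g1 z w)) +
   gs (lin_ext a b g1 z w + RtoC alpha) (lin_ext c d g2 z w + RtoC beta + phic (lin_ext a b g1 z w)))%C.

Lemma comp_args_strip alpha beta phi phic B z w : skew_ext rho (rS / 16) phi phic B ->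
  Rabs (Im z) < r -> Rabs (Im w) < r ->
  Rabs (Im (lin_ext a b g1 z w)) < rho /\ Rabs (Im (lin_ext a b g1 z w + RtoC alpha)) < rS / 4 /\
  Rabs (Im (lin_ext c d g2 z w + RtoC beta + phic (lin_ext a b g1 z w))) < rS / 4.
Proof.
  intros [_ [_ Hphi]] Hz Hw. destruct (Hin z w Hz Hw) as [I1 I2].
  pose proof (Rmin_l rho (rS / 8)). pose proof (Rmin_r rho (rS / 8)).
  assert (I1' : Rabs (Im (lin_ext a b g1 z w)) < rho) by lra.
  destruct (Hphi _ I1') as [I3 _].
  split; auto. split.
  - replace (Im (lin_ext a b g1 z w + RtoC alpha)) with (Im (lin_ext a b g1 z w))
      by (destruct (lin_ext a b g1 z w); simpl; ring). lra.
  - replace (Im (lin_ext c d g2 z w + RtoC beta + phic (lin_ext a b g1 z w)))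
      with (Im (lin_ext c d g2 z w) + Im (phic (lin_ext a b g1 z w)))
      by (destruct (lin_ext c d g2 z w), (phic (lin_ext a b g1 z w)); simpl; ring).
    eapply Rle_lt_trans; [apply Rabs_triang|]. lra.
Qed.

Lemma lin_ext_holo2 e f t g M : ext_on r t g M -> holo2 r (lin_ext e f g).
Proof.
  intros [Hg _]. unfold lin_ext. apply holo2_plus; auto.
  apply holo2_plus; apply holo2_scal; [apply holo2_fst|apply holo2_snd].
Qed.

Lemma lin_ext_real e f t g M x y : ext_on r t g M ->
  lin_ext e f g (RtoC x) (RtoC y) = RtoC (e * x + f * y + t x y).
Proof. intros [_ [H _]]. unfold lin_ext. rewrite H, !RtoC_plus, !RtoC_mult. reflexivity. Qed.

Lemma comp_ext_correct alpha beta phi phic B : skew_ext rho (rS / 16) phi phic B ->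
  ext_on r (fun x y => let x1 := a * x + b * y + t1 x y in let x2 := c * x + d * y + t2 x y in
      a' * (t1 x y + alpha) + b' * (t2 x y + beta + phi x1) + s (x1 + alpha) (x2 + beta + phi x1))
    (comp_ext alpha beta phic)
    (Rabs a' * (M1 + Rabs alpha) + Rabs b' * (M2 + Rabs beta + B) + MS).
Proof.
  intros Hphi. destruct Hs as [Hs1 [Hs2 Hs3]]. destruct Hphi as [P1 [P2 P3]] eqn:EP. clear EP.
  assert (L1 := lin_ext_holo2 a b t1 g1 M1 H1). assert (L2 := lin_ext_holo2 c d t2 g2 M2 H2).
  assert (HP : holo2 r (fun z w => phic (lin_ext a b g1 z w))).
  { apply holo2_comp1 with rho; auto. intros z w Hz Hw. apply (comp_args_strip 0 0 phi phic B z w); auto. }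
  split; [|split].
  - unfold comp_ext. apply holo2_plus.
    + apply holo2_plus; apply holo2_scal.
      * apply holo2_plus; [apply H1|apply holo2_const].
      * apply holo2_plus; auto. apply holo2_plus; [apply H2|apply holo2_const].
    + apply (holo2_comp2 r rS gs MS (fun z w => lin_ext a b g1 z w + RtoC alpha)%C
        (fun z w => lin_ext c d g2 z w + RtoC beta + phic (lin_ext a b g1 z w))%C); auto.
      * apply holo2_plus; auto. apply holo2_const.
      * apply holo2_plus; auto. apply holo2_plus; auto. apply holo2_const.
      * intros z w Hz Hw. apply (comp_args_strip alpha beta phi phic B z w); auto.
  - intros x y. unfold comp_ext. cbv zeta.
    rewrite (lin_ext_real a b t1 g1 M1 x y H1), (lin_ext_real c d t2 g2 M2 x y H2), P2.
    destruct H1 as [_ [E1 _]]. destruct H2 as [_ [E2 _]]. rewrite E1, E2.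
    rewrite <- !RtoC_plus, Hs2, <- !RtoC_mult, <- !RtoC_plus. reflexivity.
  - intros z w Hz Hw. destruct (comp_args_strip alpha beta phi phic B z w Hphi Hz Hw) as [I1 [I2 I3]].
    destruct (P3 _ I1) as [_ HB].
    destruct H1 as [_ [_ B1]]. destruct H2 as [_ [_ B2]]. specialize (B1 z w Hz Hw). specialize (B2 z w Hz Hw).
    unfold comp_ext.
    eapply Rle_trans; [apply Cmod_triangle|]. apply Rplus_le_compat; [|apply Hs3; lra].
    eapply Rle_trans; [apply Cmod_triangle|]. rewrite !Cmod_mult, !Cmod_R.
    apply Rplus_le_compat; apply Rmult_le_compat_l; try apply Rabs_pos.
    + eapply Rle_trans; [apply Cmod_triangle|]. rewrite Cmod_R. lra.
    + eapply Rle_trans; [apply Cmod_triangle|].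
      pose proof (Cmod_triangle (g2 z w) (RtoC beta)) as T. rewrite Cmod_R in T. lra.
Qed.

(** Both maps use the same rotation of the base, so only the second argument of [gs] changes and one
    Lipschitz estimate suffices. *)
Lemma comp_ext_diff alpha beta phi phic B phi' phic' B' e z w :
  skew_ext rho (rS / 16) phi phic B -> skew_ext rho (rS / 16) phi' phic' B' ->
  (forall u, Rabs (Im u) < rho -> Cmod (phic u - phic' u) <= e) ->
  Rabs (Im z) < r -> Rabs (Im w) < r ->
  Cmod (comp_ext alpha beta phic z w - comp_ext alpha beta phic' z w) <= (Rabs b' + 32 * MS / rS) * e.
Proof.
  intros Hphi Hphi' He Hz Hw.
  destruct (comp_args_strip alpha beta phi phic B z w Hphi Hz Hw) as [I1 [I2 I3]].
  destruct (comp_args_strip alpha beta phi' phic' B' z w Hphi' Hz Hw) as [J1 [J2 J3]].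
  specialize (He _ I1). destruct Hs as [Hs1 [Hs2 Hs3]].
  unfold comp_ext. set (u := lin_ext a b g1 z w) in *. set (v := lin_ext c d g2 z w) in *.
  replace (RtoC a' * (g1 z w + RtoC alpha) + RtoC b' * (g2 z w + RtoC beta + phic u) + gs (u + RtoC alpha) (v + RtoC beta + phic u) -
   (RtoC a' * (g1 z w + RtoC alpha) + RtoC b' * (g2 z w + RtoC beta + phic' u) + gs (u + RtoC alpha) (v + RtoC beta + phic' u)))%C
   with (RtoC b' * (phic u - phic' u) + (gs (u + RtoC alpha) (v + RtoC beta + phic u) - gs (u + RtoC alpha) (v + RtoC beta + phic' u)))%C
   by ring.
  eapply Rle_trans; [apply Cmod_triangle|]. rewrite Cmod_mult, Cmod_R, Rmult_plus_distr_r.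
  apply Rplus_le_compat; [apply Rmult_le_compat_l; [apply Rabs_pos|auto]|].
  assert (HMS := bounded2_pos _ _ _ HrS Hs3).
  eapply Rle_trans; [apply (holo2_lipschitz_snd rS gs MS); auto; lra|].
  replace (v + RtoC beta + phic u - (v + RtoC beta + phic' u))%C with (phic u - phic' u)%C by ring.
  apply Rmult_le_compat_l; auto. apply Rdiv_le_0_compat; lra.
Qed.
End Component.

(** * Lifts with a prescribed integer matrix *)

Definition gen_lift (a b c d : Z) (r : R) (T : R * R -> R * R) : Prop :=
  let t1 := fun x y => fst (T (x, y)) - (IZR a * x + IZR b * y) in
  let t2 := fun x y => snd (T (x, y)) - (IZR c * x + IZR d * y) in
  periodic2 t1 /\ periodic2 t2 /\ holo_ext r t1 /\ holo_ext r t2.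

Lemma periodic1_Z (f : R -> R) : (forall x, f (x + 1) = f x) -> forall x n, f (x + IZR n) = f x.
Proof.
  intros H. assert (Hn : forall n x, f (x + INR n) = f x).
  { induction n as [|n IH]; intros x; [simpl; f_equal; ring|].
    rewrite S_INR. replace (x + (INR n + 1)) with ((x + INR n) + 1) by ring. rewrite H; auto. }
  intros x n. destruct (Z_le_gt_dec 0 n) as [Hz|Hz].
  - rewrite <- (Z2Nat.id n Hz), <- INR_IZR_INZ. apply Hn.
  - rewrite <- (Hn (Z.to_nat (- n)) (x + IZR n)). f_equal.
    rewrite INR_IZR_INZ, Z2Nat.id by lia. rewrite opp_IZR. ring.
Qed.

Lemma gen_lift_translate a b c d r T (m n : Z) x y : gen_lift a b c d r T ->
  T (x + IZR m, y + IZR n) =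
  (fst (T (x, y)) + (IZR a * IZR m + IZR b * IZR n), snd (T (x, y)) + (IZR c * IZR m + IZR d * IZR n)).
Proof.
  intros [P1 [P2 _]].
  assert (E : forall t, periodic2 t -> t (x + IZR m) (y + IZR n) = t x y).
  { intros t Ht. rewrite (periodic1_Z (fun x => t x (y + IZR n))) by (intros; apply Ht).
    apply (periodic1_Z (fun y => t x y)). intros; apply Ht. }
  pose proof (E _ P1) as E1. pose proof (E _ P2) as E2. cbv beta in E1, E2.
  apply injective_projections; simpl; lra.
Qed.

Lemma holo_ext_bounded_ext r f g M : (forall x y, f x y = g x y) ->
  holo_ext_bounded_by r f M -> holo_ext_bounded_by r g M.
Proof.
  intros E. replace g with f; auto. apply functional_extensionality; intros z.
  apply functional_extensionality; intros w; auto.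
Qed.

Lemma ext_on_mono r r' f g M : r' <= r -> ext_on r f g M -> ext_on r' f g M.
Proof.
  intros Hr [H1 [H2 H3]]. split; [apply holo2_mono with r; auto|split; auto].
  intros z w Hz Hw. apply H3; lra.
Qed.

(* The admissible imaginary amplitude [eta] depends on [S] only, not on the width [rho]
   of the strip on which the fibre translations are defined. *)
Lemma conj_skew_lift a b c d rT T a' b' c' d' rS S : 0 < rT -> 0 < rS ->
  gen_lift a b c d rT T -> gen_lift a' b' c' d' rS S ->
  exists eta, 0 < eta /\ forall rho, 0 < rho -> exists r K, 0 < r /\ 0 < K /\
    (forall alpha beta phi phic B, skew_ext rho eta phi phic B -> (forall x, phi (x + 1) = phi x) ->
       gen_lift (a' * a + b' * c) (a' * b + b' * d) (c' * a + d' * c) (c' * b + d' * d) r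
         (fun p => S (skew alpha beta phi (T p)))) /\
    (forall alpha beta phi phic B phi' phic' B' e,
       skew_ext rho eta phi phic B -> skew_ext rho eta phi' phic' B' ->
       (forall u, Rabs (Im u) < rho -> Cmod (phic u - phic' u) <= e) ->
       holo_ext_bounded_by r (fun x y => fst (S (skew alpha beta phi (T (x, y)))) - fst (S (skew alpha beta phi' (T (x, y))))) (K * e) /\
       holo_ext_bounded_by r (fun x y => snd (S (skew alpha beta phi (T (x, y)))) - snd (S (skew alpha beta phi' (T (x, y))))) (K * e)).
Proof.
  intros HrT HrS HT HS.
  exists (rS / 16); split; [lra|]. intros rho Hrho.
  pose proof HT as HT0. pose proof HS as HS0.
  destruct HT as [_ [_ [[M1 E1] [M2 E2]]]]. destruct HS as [_ [_ [[N1 F1] [N2 F2]]]].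
  apply holo_ext_bounded_byP in E1 as [g1 G1]. apply holo_ext_bounded_byP in E2 as [g2 G2].
  apply holo_ext_bounded_byP in F1 as [s1 S1]. apply holo_ext_bounded_byP in F2 as [s2 S2].
  assert (Hmu : 0 < Rmin rho (rS / 8)) by (apply Rmin_pos; lra).
  destruct (inner_strip (IZR a) (IZR b) (IZR c) (IZR d) rT _ g1 M1 _ g2 M2 _ HrT Hmu G1 G2) as [r [Hr Hin]].
  apply (ext_on_mono rT r) in G1; [|lra]. apply (ext_on_mono rT r) in G2; [|lra].
  assert (P1 : 0 <= 32 * N1 / rS).
  { apply Rdiv_le_0_compat; auto. pose proof (bounded2_pos _ _ _ HrS (proj2 (proj2 S1))). lra. }
  assert (P2 : 0 <= 32 * N2 / rS).
  { apply Rdiv_le_0_compat; auto. pose proof (bounded2_pos _ _ _ HrS (proj2 (proj2 S2))). lra. }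
  pose proof (Rabs_pos (IZR b')) as Pb. pose proof (Rabs_pos (IZR d')) as Pd.
  set (K := (Rabs (IZR b') + 32 * N1 / rS) + (Rabs (IZR d') + 32 * N2 / rS) + 1).
  exists r, K. split; [lra|]. split; [unfold K; lra|]. split.
  - intros alpha beta phi phic B Hphi Hper.
    assert (Htr : forall m n x y, S (skew alpha beta phi (T (x + IZR m, y + IZR n))) =
       (fst (S (skew alpha beta phi (T (x, y)))) + (IZR (a' * a + b' * c) * IZR m + IZR (a' * b + b' * d) * IZR n),
        snd (S (skew alpha beta phi (T (x, y)))) + (IZR (c' * a + d' * c) * IZR m + IZR (c' * b + d' * d) * IZR n))).
    { intros m n x y. rewrite (gen_lift_translate _ _ _ _ _ _ m n x y HT0).
      unfold skew; simpl fst; simpl snd.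
      rewrite <- !mult_IZR, <- !plus_IZR, (periodic1_Z phi Hper).
      replace (fst (T (x, y)) + IZR (a * m + b * n) + alpha) with (fst (T (x, y)) + alpha + IZR (a * m + b * n)) by ring.
      replace (snd (T (x, y)) + IZR (c * m + d * n) + beta + phi (fst (T (x, y))))
        with (snd (T (x, y)) + beta + phi (fst (T (x, y))) + IZR (c * m + d * n)) by ring.
      rewrite (gen_lift_translate _ _ _ _ _ _ _ _ _ _ HS0).
      repeat rewrite ?plus_IZR, ?mult_IZR. apply injective_projections; cbn [fst snd]; ring. }
    assert (T10 := Htr 1%Z 0%Z). assert (T01 := Htr 0%Z 1%Z).
    assert (T10' : forall x y, S (skew alpha beta phi (T (x + 1, y))) = 
       (fst (S (skew alpha beta phi (T (x, y)))) + IZR (a' * a + b' * c),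
        snd (S (skew alpha beta phi (T (x, y)))) + IZR (c' * a + d' * c))).
    { intros x y. specialize (T10 x y). replace (y + IZR 0) with y in T10 by (simpl; ring).
      rewrite T10. apply injective_projections; cbn [fst snd]; ring. }
    assert (T01' : forall x y, S (skew alpha beta phi (T (x, y + 1))) = 
       (fst (S (skew alpha beta phi (T (x, y)))) + IZR (a' * b + b' * d),
        snd (S (skew alpha beta phi (T (x, y)))) + IZR (c' * b + d' * d))).
    { intros x y. specialize (T01 x y). replace (x + IZR 0) with x in T01 by (simpl; ring).
      rewrite T01. apply injective_projections; cbn [fst snd]; ring. }
    split; [|split; [|split]].
    + intros x y. rewrite T10', T01'. simpl fst. split; ring.
    + intros x y. rewrite T10', T01'. simpl snd. split; ring.
    + pose proof (comp_ext_correct (IZR a) (IZR b) (IZR c) (IZR d) (IZR a') (IZR b') rS rho r _ _ _ s1 g1 g2 N1 M1 M2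
        HrS S1 G1 G2 Hin alpha beta phi phic B Hphi) as HC.
      eexists. eapply holo_ext_bounded_ext; [|apply holo_ext_bounded_byP; eexists; apply HC].
      intros x y. cbv beta zeta. unfold skew.
      replace (IZR a * x + IZR b * y + (fst (T (x, y)) - (IZR a * x + IZR b * y))) with (fst (T (x, y))) by ring.
      replace (IZR c * x + IZR d * y + (snd (T (x, y)) - (IZR c * x + IZR d * y))) with (snd (T (x, y))) by ring.
      rewrite !plus_IZR, !mult_IZR. ring.
    + pose proof (comp_ext_correct (IZR a) (IZR b) (IZR c) (IZR d) (IZR c') (IZR d') rS rho r _ _ _ s2 g1 g2 N2 M1 M2
        HrS S2 G1 G2 Hin alpha beta phi phic B Hphi) as HC.
      eexists. eapply holo_ext_bounded_ext; [|apply holo_ext_bounded_byP; eexists; apply HC].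
      intros x y. cbv beta zeta. unfold skew.
      replace (IZR a * x + IZR b * y + (fst (T (x, y)) - (IZR a * x + IZR b * y))) with (fst (T (x, y))) by ring.
      replace (IZR c * x + IZR d * y + (snd (T (x, y)) - (IZR c * x + IZR d * y))) with (snd (T (x, y))) by ring.
      rewrite !plus_IZR, !mult_IZR. ring.
  - intros alpha beta phi phic B phi' phic' B' e Hphi Hphi' He.
    assert (He0 : 0 <= e).
    { eapply Rle_trans; [apply Cmod_ge_0|apply (He 0%C)]. rewrite Im_RtoC, Rabs_R0; auto. }
    (* Treats both components at once: (p, q) stands for a row of the matrix of S and [rs] for the
       corresponding periodic part. *)
    assert (Hcomp : forall p q rs gs Ns, ext_on rS rs gs Ns -> (Rabs q + 32 * Ns / rS) * e <= K * e ->
       holo_ext_bounded_by r (fun x y =>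
         (p * (fst (T (x, y)) + alpha) + q * (snd (T (x, y)) + beta + phi (fst (T (x, y)))) + rs (fst (T (x, y)) + alpha) (snd (T (x, y)) + beta + phi (fst (T (x, y))))) -
         (p * (fst (T (x, y)) + alpha) + q * (snd (T (x, y)) + beta + phi' (fst (T (x, y)))) + rs (fst (T (x, y)) + alpha) (snd (T (x, y)) + beta + phi' (fst (T (x, y)))))) (K * e)).
    { intros p q rs gs Ns HSs HK.
      pose proof (comp_ext_correct (IZR a) (IZR b) (IZR c) (IZR d) p q rS rho r _ _ _ gs g1 g2 Ns M1 M2
        HrS HSs G1 G2 Hin alpha beta phi phic B Hphi) as [C1 [C2 _]].
      pose proof (comp_ext_correct (IZR a) (IZR b) (IZR c) (IZR d) p q rS rho r _ _ _ gs g1 g2 Ns M1 M2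
        HrS HSs G1 G2 Hin alpha beta phi' phic' B' Hphi') as [C1' [C2' _]].
      apply holo_ext_bounded_byP.
      exists (fun z w => comp_ext (IZR a) (IZR b) (IZR c) (IZR d) p q gs g1 g2 alpha beta phic z w +
         RtoC (-1) * comp_ext (IZR a) (IZR b) (IZR c) (IZR d) p q gs g1 g2 alpha beta phic' z w)%C.
      split; [apply holo2_plus; auto; apply holo2_scal; auto|split].
      - intros x y. rewrite C2, C2', <- RtoC_mult, <- RtoC_plus. f_equal. cbv zeta.
        replace (IZR a * x + IZR b * y + (fst (T (x, y)) - (IZR a * x + IZR b * y))) with (fst (T (x, y))) by ring.
        replace (IZR c * x + IZR d * y + (snd (T (x, y)) - (IZR c * x + IZR d * y))) with (snd (T (x, y))) by ring.
        ring.
      - intros z w Hz Hw.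
        pose proof (comp_ext_diff (IZR a) (IZR b) (IZR c) (IZR d) p q rS rho r rs gs g1 g2 Ns
          HrS HSs Hin alpha beta phi phic B phi' phic' B' e z w Hphi Hphi' He Hz Hw) as HD.
        match goal with |- Cmod (?u + _ * ?v) <= _ => replace (u + RtoC (-1) * v)%C with (u - v)%C
          by (apply injective_projections; simpl; ring) end.
        lra. }
    split.
    + eapply holo_ext_bounded_ext; [|apply (Hcomp (IZR a') (IZR b') _ s1 N1 S1); apply Rmult_le_compat_r; unfold K; lra].
      intros x y. unfold skew; simpl fst; simpl snd. ring.
    + eapply holo_ext_bounded_ext; [|apply (Hcomp (IZR c') (IZR d') _ s2 N2 S2); apply Rmult_le_compat_r; unfold K; lra].
      intros x y. unfold skew; simpl fst; simpl snd. ring.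
Qed.

(** * Peak functions *)

Fixpoint cpow (z : C) (n : nat) : C := match n with O => RtoC 1 | S n => (z * cpow z n)%C end.

Lemma Cmod_cpow z n : Cmod (cpow z n) = Cmod z ^ n.
Proof. induction n as [|n IH]; simpl; [apply Cmod_1|]. rewrite Cmod_mult, IH. reflexivity. Qed.

Lemma cpow_RtoC x n : cpow (RtoC x) n = RtoC (x ^ n).
Proof. induction n as [|n IH]; simpl; auto. rewrite IH, RtoC_mult. reflexivity. Qed.

Lemma cdiff_cpow f n z : cdiff f z -> cdiff (fun u => cpow (f u) n) z.
Proof. intros H. induction n as [|n IH]; simpl; [apply cdiff_const|]. apply cdiff_mult; auto. Qed.

Lemma cpow_diff_bound u v X n : 1 <= X -> Cmod u <= X -> Cmod v <= X ->
  Cmod (cpow u n - cpow v n) <= INR n * X ^ n * Cmod (u - v).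
Proof.
  intros HX Hu Hv. induction n as [|n IH].
  - simpl. replace (RtoC 1 - RtoC 1)%C with (RtoC 0) by ring. rewrite Cmod_0. pose proof (Cmod_ge_0 (u - v)). lra.
  - rewrite S_INR. simpl cpow.
    replace (u * cpow u n - v * cpow v n)%C with (u * (cpow u n - cpow v n) + (u - v) * cpow v n)%C by ring.
    eapply Rle_trans; [apply Cmod_triangle|]. rewrite !Cmod_mult, Cmod_cpow.
    assert (H1 : Cmod u * Cmod (cpow u n - cpow v n) <= X * (INR n * X ^ n * Cmod (u - v)))
      by (apply Rmult_le_compat; auto; apply Cmod_ge_0).
    assert (H2 : Cmod v ^ n <= X ^ n) by (apply pow_incr; split; auto; apply Cmod_ge_0).
    assert (H3 : X ^ n <= X * X ^ n).
    { rewrite <- (Rmult_1_l (X ^ n)) at 1. apply Rmult_le_compat_r; auto. apply pow_le; lra. }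
    assert (H4 : Cmod (u - v) * Cmod v ^ n <= Cmod (u - v) * (X * X ^ n))
      by (apply Rmult_le_compat_l; [apply Cmod_ge_0|lra]).
    simpl pow. lra.
Qed.

Definition turn (z : C) : C := cexp ((0, 2 * PI) * z).
Definition ccos (z : C) : C := (RtoC (/ 2) * (turn z + turn (- z)))%C.
(** Equal to cos^2 (pi x), so that [peak m] is 2 cos^(2m) (pi x): a trigonometric polynomial, hence
    entire, which concentrates at the integers as m grows. *)
Definition base (x : R) : R := (1 + cos (2 * PI * x)) / 2.
Definition basec (z : C) : C := (RtoC (/ 2) * (1 + ccos z))%C.
Definition peak (m : nat) (x : R) : R := 2 * base x ^ m.
Definition peakc (m : nat) (z : C) : C := (RtoC 2 * cpow (basec z) m)%C.

Lemma turn_plus z w : turn (z + w) = (turn z * turn w)%C.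
Proof. unfold turn. rewrite <- cexp_plus. f_equal. ring. Qed.

Lemma turn_Z n : turn (RtoC (IZR n)) = 1%C.
Proof.
  unfold turn. rewrite <- cexp_0, <- (cexp_2pi_periodic 0 n). f_equal. apply injective_projections; simpl; ring.
Qed.

Lemma Cmod_turn z Y : Rabs (Im z) <= Y -> Cmod (turn z) <= exp (2 * PI * Y).
Proof.
  intros H. unfold turn. rewrite Cmod_cexp.
  replace (Re ((0, 2 * PI) * z)) with (2 * PI * (- Im z)) by (destruct z; simpl; ring).
  assert (Hpi := PI_RGT_0). apply Rabs_le_between in H.
  destruct (Rle_lt_or_eq_dec (- Im z) Y) as [L|E]; [lra| |].
  - left. apply exp_increasing. apply Rmult_lt_compat_l; lra.
  - rewrite E. lra.
Qed.

Lemma Rabs_sin_le x : Rabs (sin x) <= Rabs x.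
Proof.
  assert (H : forall x, 0 <= x -> Rabs (sin x) <= x).
  { intros y Hy. destruct (Req_dec y 0) as [->|Hn]; [rewrite sin_0, Rabs_R0; lra|].
    assert (Hy' : 0 < y) by (destruct Hy; [auto|congruence]).
    destruct (Rle_lt_dec 1 y) as [H1|H1].
    - assert (Rabs (sin y) <= 1) by (apply Rabs_le, SIN_bound). lra.
    - rewrite Rabs_pos_eq; [left; apply sin_lt_x; exact Hy'|].
      apply sin_ge_0; auto. pose proof PI_RGT_0. pose proof PI2_1. lra. }
  destruct (Rle_lt_dec 0 x) as [Hx|Hx].
  - rewrite (Rabs_pos_eq x); auto.
  - rewrite <- (Rabs_Ropp (sin x)), <- sin_neg, (Rabs_left x); auto. apply H; lra.
Qed.

Lemma Cmod_turn_sub_1 t : Cmod (turn (RtoC t) - 1) <= 4 * PI * Rabs t.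
Proof.
  eapply Rle_trans; [apply Cmod_le_Re_Im|]. unfold turn.
  replace ((0, (2 * PI)%R) * RtoC t)%C with (0, 2 * PI * t) by (apply injective_projections; simpl; ring).
  unfold cexp; simpl. rewrite exp_0. set (x := 2 * PI * t).
  assert (Hpi := PI_RGT_0).
  assert (Hx : Rabs x = 2 * PI * Rabs t) by (unfold x; rewrite Rabs_mult, Rabs_pos_eq; lra).
  assert (H1 : Rabs (1 * cos x + - (1)) <= Rabs x).
  { replace (1 * cos x + - (1)) with (- (2 * sin (x / 2) * sin (x / 2))).
    - rewrite Rabs_Ropp, !Rabs_mult, (Rabs_pos_eq 2) by lra.
      pose proof (Rabs_sin_le (x / 2)) as H. assert (Rabs (x / 2) = Rabs x / 2).
      { unfold Rdiv. rewrite Rabs_mult, (Rabs_pos_eq (/ 2)); lra. }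
      assert (Rabs (sin (x / 2)) <= 1) by (apply Rabs_le, SIN_bound).
      pose proof (Rabs_pos (sin (x / 2))). nra.
    - replace x with (2 * (x / 2)) at 3 by field. rewrite cos_2a_sin. ring. }
  assert (H2 : Rabs (1 * sin x + - 0) <= Rabs x).
  { replace (1 * sin x + - 0) with (sin x) by ring. apply Rabs_sin_le. }
  lra.
Qed.

Lemma Rabs_Im_opp z : Rabs (Im (- z)) = Rabs (Im z).
Proof. destruct z; simpl. apply Rabs_Ropp. Qed.

Lemma Cmod_basec z Y : 0 <= Y -> Rabs (Im z) <= Y -> Cmod (basec z) <= exp (2 * PI * Y).
Proof.
  intros HY H. unfold basec, ccos. rewrite Cmod_mult, Cmod_R, Rabs_pos_eq by lra.
  pose proof (Cmod_triangle 1 (RtoC (/ 2) * (turn z + turn (- z)))) as T1.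
  rewrite Cmod_1, Cmod_mult, Cmod_R, Rabs_pos_eq in T1 by lra.
  pose proof (Cmod_triangle (turn z) (turn (- z))).
  pose proof (Cmod_turn z Y H). pose proof (Cmod_turn (- z) Y ltac:(rewrite Rabs_Im_opp; auto)).
  assert (1 <= exp (2 * PI * Y)).
  { rewrite <- exp_0. assert (Hpi := PI_RGT_0). destruct (Req_dec Y 0) as [->|Hn].
    - replace (2 * PI * 0) with 0 by ring. lra.
    - left. apply exp_increasing. apply Rmult_lt_0_compat; lra. }
  lra.
Qed.

Lemma basec_shift_bound z t Y : Rabs (Im z) <= Y ->
  Cmod (basec (z + RtoC t) - basec z) <= exp (2 * PI * Y) * (2 * PI * Rabs t).
Proof.
  intros H. unfold basec, ccos.
  replace (- (z + RtoC t))%C with (- z + RtoC (- t))%C by (apply injective_projections; simpl; ring).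
  rewrite !turn_plus.
  replace (RtoC (/ 2) * (1 + RtoC (/ 2) * (turn z * turn (RtoC t) + turn (- z) * turn (RtoC (- t)))) -
    RtoC (/ 2) * (1 + RtoC (/ 2) * (turn z + turn (- z))))%C
    with (RtoC (/ 2) * RtoC (/ 2) * (turn z * (turn (RtoC t) - 1) + turn (- z) * (turn (RtoC (- t)) - 1)))%C by ring.
  rewrite !Cmod_mult, Cmod_R, Rabs_pos_eq by lra.
  pose proof (Cmod_triangle (turn z * (turn (RtoC t) - 1)) (turn (- z) * (turn (RtoC (- t)) - 1))) as T.
  rewrite !Cmod_mult in T.
  pose proof (Cmod_turn z Y H) as T1. pose proof (Cmod_turn (- z) Y ltac:(rewrite Rabs_Im_opp; auto)) as T2.
  pose proof (Cmod_turn_sub_1 t) as S1. pose proof (Cmod_turn_sub_1 (- t)) as S2. rewrite Rabs_Ropp in S2.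
  assert (Cmod (turn z) * Cmod (turn (RtoC t) - 1) <= exp (2 * PI * Y) * (4 * PI * Rabs t))
    by (apply Rmult_le_compat; auto; apply Cmod_ge_0).
  assert (Cmod (turn (- z)) * Cmod (turn (RtoC (- t)) - 1) <= exp (2 * PI * Y) * (4 * PI * Rabs t))
    by (apply Rmult_le_compat; auto; apply Cmod_ge_0).
  lra.
Qed.

Lemma basec_RtoC x : basec (RtoC x) = RtoC (base x).
Proof.
  unfold basec, ccos, turn, base.
  replace ((0, (2 * PI)%R) * RtoC x)%C with (0, 2 * PI * x) by (apply injective_projections; simpl; ring).
  replace ((0, (2 * PI)%R) * - RtoC x)%C with (0, - (2 * PI * x)) by (apply injective_projections; simpl; ring).
  unfold cexp; simpl. rewrite cos_neg, sin_neg, exp_0. apply injective_projections; simpl; field.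
Qed.

Lemma basec_Z z n : basec (z + RtoC (IZR n)) = basec z.
Proof.
  unfold basec, ccos.
  replace (- (z + RtoC (IZR n)))%C with (- z + RtoC (IZR (- n)))%C
    by (rewrite opp_IZR; apply injective_projections; simpl; ring).
  rewrite !turn_plus, !turn_Z. do 3 f_equal. ring.
Qed.

Lemma peakc_RtoC m x : peakc m (RtoC x) = RtoC (peak m x).
Proof. unfold peakc, peak. rewrite basec_RtoC, cpow_RtoC, RtoC_mult. reflexivity. Qed.

Lemma peakc_Z m z n : peakc m (z + RtoC (IZR n)) = peakc m z.
Proof. unfold peakc. rewrite basec_Z. reflexivity. Qed.

Lemma peak_Z m x n : peak m (x + IZR n) = peak m x.
Proof.
  pose proof (peakc_Z m (RtoC x) n) as H. rewrite <- RtoC_plus, !peakc_RtoC in H.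
  apply (f_equal Re) in H. exact H.
Qed.

Lemma cdiff_basec z : cdiff basec z.
Proof.
  unfold basec, ccos, turn.
  assert (H : forall c u, cdiff (fun z => cexp (c * z)) u).
  { intros c u. apply (cdiff_comp cexp (fun z => c * z)%C); [|apply cdiff_cexp].
    apply cdiff_mult; [apply cdiff_const|apply cdiff_id]. }
  apply cdiff_mult; [apply cdiff_const|]. apply cdiff_plus; [apply cdiff_const|].
  apply cdiff_mult; [apply cdiff_const|]. apply cdiff_plus; auto.
  apply cdiff_ext with (fun u => cexp (- (0, (2 * PI)%R) * u)%C); [intros u; f_equal; ring|auto].
Qed.

Lemma cdiff_peakc m z : cdiff (peakc m) z.
Proof. apply cdiff_mult; [apply cdiff_const|]. apply cdiff_cpow, cdiff_basec. Qed.

Lemma Cmod_peakc m z Y : 0 <= Y -> Rabs (Im z) <= Y -> Cmod (peakc m z) <= 2 * exp (2 * PI * Y) ^ m.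
Proof.
  intros HY H. unfold peakc. rewrite Cmod_mult, Cmod_R, Rabs_pos_eq, Cmod_cpow by lra.
  apply Rmult_le_compat_l; [lra|]. apply pow_incr. split; [apply Cmod_ge_0|]. apply Cmod_basec; auto.
Qed.

(** Exponential growth in the width Y is unavoidable, but the bound is linear in the real shift t,
    which a Liouville number makes much smaller than that growth. *)
Lemma peakc_shift_bound m z t Y : 0 <= Y -> Rabs (Im z) <= Y ->
  Cmod (peakc m (z + RtoC t) - peakc m z) <= 4 * PI * INR m * exp (2 * PI * Y) ^ (S m) * Rabs t.
Proof.
  intros HY H. unfold peakc.
  replace (RtoC 2 * cpow (basec (z + RtoC t)) m - RtoC 2 * cpow (basec z) m)%C
    with (RtoC 2 * (cpow (basec (z + RtoC t)) m - cpow (basec z) m))%C by ring.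
  rewrite Cmod_mult, Cmod_R, Rabs_pos_eq by lra.
  assert (HX : 1 <= exp (2 * PI * Y)).
  { rewrite <- exp_0. assert (Hpi := PI_RGT_0). destruct (Req_dec Y 0) as [->|Hn].
    - replace (2 * PI * 0) with 0 by ring. lra.
    - left. apply exp_increasing. apply Rmult_lt_0_compat; lra. }
  set (X := exp (2 * PI * Y)) in *.
  assert (B : Cmod (cpow (basec (z + RtoC t)) m - cpow (basec z) m) <=
     INR m * X ^ m * Cmod (basec (z + RtoC t) - basec z)).
  { apply cpow_diff_bound; auto; apply Cmod_basec; auto.
    replace (Im (z + RtoC t)) with (Im z) by (destruct z; simpl; ring). auto. }
  pose proof (basec_shift_bound z t Y H) as S1. fold X in S1.
  apply Rmult_le_compat_l with (r := INR m * X ^ m) in S1;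
    [|apply Rmult_le_pos; [apply pos_INR|apply pow_le; lra]].
  replace (4 * PI * INR m * X ^ S m * Rabs t) with (2 * (INR m * X ^ m * (X * (2 * PI * Rabs t)))) by (simpl; ring).
  lra.
Qed.

(** The complex estimate for a strip of width Y = 0. *)
Lemma peak_lipschitz m x y : Rabs (peak m x - peak m y) <= 4 * PI * INR m * Rabs (x - y).
Proof.
  pose proof (peakc_shift_bound m (RtoC y) (x - y) 0 (Rle_refl 0)) as H.
  rewrite <- RtoC_plus in H. replace (y + (x - y)) with x in H by ring.
  rewrite !peakc_RtoC, <- RtoC_minus, Cmod_R in H. rewrite Im_RtoC, Rabs_R0 in H.
  replace (2 * PI * 0) with 0 in H by ring. rewrite exp_0, pow1, Rmult_1_r in H. apply H; lra.
Qed.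

Lemma base_bound x : 0 <= base x <= 1.
Proof. unfold base. pose proof (COS_bound (2 * PI * x)). lra. Qed.

Lemma peak_pos m x : 0 <= peak m x.
Proof. unfold peak. assert (0 <= base x ^ m) by (apply pow_le, base_bound). lra. Qed.

Lemma peak_top m n : peak m (IZR n) = 2.
Proof.
  rewrite <- (Rplus_0_l (IZR n)), peak_Z. unfold peak, base.
  rewrite Rmult_0_r, cos_0. replace ((1 + 1) / 2) with 1 by field. rewrite pow1. ring.
Qed.

Lemma peak_bottom m n : (1 <= m)%nat -> peak m (IZR n + / 2) = 0.
Proof.
  intros Hm. rewrite Rplus_comm, peak_Z. unfold peak, base.
  replace (2 * PI * / 2) with PI by field. rewrite cos_PI.
  replace ((1 + -1) / 2) with 0 by field. rewrite pow_i by lia. ring.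
Qed.

(** At distance at least [delta] from the integers [base] is bounded by [base delta] < 1, whose
    powers tend to 0. *)
Lemma peak_localized delta eps : 0 < delta < / 2 -> 0 < eps ->
  exists m, (1 <= m)%nat /\ forall x, (forall j : Z, delta <= Rabs (x - IZR j)) -> peak m x <= eps.
Proof.
  intros Hd He. assert (Hpi := PI_RGT_0).
  set (c := base delta).
  assert (Hcos : forall u, delta <= u <= / 2 -> cos (2 * PI * u) <= cos (2 * PI * delta)).
  { intros u Hu. destruct (Req_dec u delta) as [->|Hn]; [lra|].
    apply cos_decr_1; nra. }
  assert (Hc : 0 <= c < 1).
  { split; [apply base_bound|]. unfold c, base.
    assert (cos (2 * PI * delta) < cos 0) by (apply cos_decreasing_1; nra).
    rewrite cos_0 in H. lra. }
  destruct (pow_lt_1_zero c) with (y := eps / 2) as [N HN]; [rewrite Rabs_pos_eq; lra|lra|].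
  exists (S N). split; [lia|]. intros x Hx.
  specialize (HN (S N) ltac:(lia)). rewrite Rabs_pos_eq in HN by (apply pow_le; lra).
  unfold peak.
  assert (Hb : base x <= c).
  { unfold base, c, base.
    destruct (base_Int_part x) as [Hi1 Hi2]. set (j := Int_part x) in *.
    pose proof (Hx j) as H1. pose proof (Hx (j + 1)%Z) as H2. rewrite plus_IZR in H2.
    rewrite Rabs_pos_eq in H1 by lra.
    destruct (Req_dec x (IZR j + 1)) as [E|E]; [rewrite E in H2; replace (IZR j + 1 - (IZR j + 1)) with 0 in H2 by ring; rewrite Rabs_R0 in H2; lra|].
    rewrite Rabs_left in H2 by lra.
    assert (Hper : base (x + IZR (- j)) = base x).
    { pose proof (basec_Z (RtoC x) (- j)) as H. rewrite <- RtoC_plus, !basec_RtoC in H.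
      apply (f_equal Re) in H. exact H. }
    rewrite opp_IZR in Hper. unfold base in Hper. rewrite <- Hper.
    set (f := x + - IZR j). assert (Hf : delta <= f <= 1 - delta) by (unfold f; lra).
    destruct (Rle_lt_dec f (/ 2)) as [Hl|Hl].
    - specialize (Hcos f ltac:(lra)). lra.
    - specialize (Hcos (1 - f) ltac:(lra)).
      replace (cos (2 * PI * f)) with (cos (2 * PI * (1 - f))); [lra|].
      replace (2 * PI * (1 - f)) with (- (2 * PI * f) + 2 * PI) by ring.
      transitivity (cos (- (2 * PI * f))); [|apply cos_neg].
      replace (- (2 * PI * f) + 2 * PI) with (- (2 * PI * f) + 2 * INR 1 * PI) by (simpl; ring).
      apply cos_period. }
  assert (base x ^ S N <= c ^ S N) by (apply pow_incr; split; [apply base_bound|auto]).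
  lra.
Qed.

(** The invariant [I] guarantees that each state has a successor. *)
Lemma dependent_choice {A : Type} (I : A -> Prop) (step : nat -> A -> A -> Prop) (a0 : A) : I a0 ->
  (forall n a, I a -> exists b, I b /\ step n a b) ->
  exists f, f O = a0 /\ (forall n, I (f n)) /\ forall n, step n (f n) (f (S n)).
Proof.
  intros H0 H.
  destruct (exists_choice (fun (na : nat * A) b => I (snd na) -> I b /\ step (fst na) (snd na) b)) as [g Hg].
  { intros [n a]. simpl. destruct (excluded_middle_informative (I a)) as [Ha|Ha].
    - destruct (H n a Ha) as [b Hb]. exists b; auto.
    - exists a; intros; contradiction. }
  set (f := fix f n := match n with O => a0 | S n => g (n, f n) end).
  assert (HI : forall n, I (f n)).
  { induction n; simpl; auto. apply (Hg (n, f n)); auto. }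
  exists f. split; auto. split; auto. intros n. apply (Hg (n, f n)), HI.
Qed.

Lemma archimed_nat x : exists n : nat, x < INR n.
Proof.
  destruct (archimed x) as [H _]. exists (Z.to_nat (up x)).
  eapply Rlt_le_trans; [apply H|]. rewrite INR_IZR_INZ. apply IZR_le. lia.
Qed.

(** * Liouville rotation numbers *)

(** Strict inequalities make the condition open. A number satisfying it for every n is Liouville of
    exponential type; the positive lower bound keeps the rotation from being periodic. *)
Definition well_approx (n : nat) (a : R) : Prop :=
  exists (q : nat) (p : Z), (n < q)%nat /\ 0 < Rabs (INR q * a - IZR p) < exp (- (INR n * INR q)).

Lemma well_approx_open n : open_set (well_approx n).
Proof.
  intros a [q [p [Hq [H1 H2]]]].
  assert (Hq0 : 0 < INR q) by (apply lt_0_INR; lia).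
  set (x := Rabs (INR q * a - IZR p)) in *.
  set (m := Rmin x (exp (- (INR n * INR q)) - x)).
  assert (Hm : 0 < m) by (apply Rmin_pos; lra).
  assert (Hd : 0 < m / INR q) by (apply Rdiv_lt_0_compat; auto).
  exists (mkposreal _ Hd). intros b Hb. unfold disc in Hb; simpl in Hb.
  exists q, p. split; auto.
  assert (Hs : Rabs (INR q * b - INR q * a) < m).
  { rewrite <- Rmult_minus_distr_l, Rabs_mult, (Rabs_pos_eq (INR q)) by lra.
    apply Rmult_lt_compat_l with (r := INR q) in Hb; auto.
    replace (INR q * (m / INR q)) with m in Hb by (field; lra). exact Hb. }
  assert (m <= x) by apply Rmin_l. assert (m <= exp (- (INR n * INR q)) - x) by apply Rmin_r.
  pose proof (Rabs_triang (INR q * b - INR q * a) (INR q * a - IZR p)) as T1.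
  replace (INR q * b - INR q * a + (INR q * a - IZR p)) with (INR q * b - IZR p) in T1 by ring.
  pose proof (Rabs_triang (INR q * a - INR q * b) (INR q * b - IZR p)) as T2.
  replace (INR q * a - INR q * b + (INR q * b - IZR p)) with (INR q * a - IZR p) in T2 by ring.
  rewrite (Rabs_minus_sym (INR q * a) (INR q * b)) in T2. fold x in T1, T2. lra.
Qed.

Lemma well_approx_subinterval n u v : u < v ->
  exists u' v', u < u' /\ u' < v' /\ v' < v /\ forall a, u' <= a <= v' -> well_approx n a.
Proof.
  intros Huv. destruct (archimed_nat (INR n + 2 / (v - u))) as [q Hq].
  assert (H2 : 0 < 2 / (v - u)) by (apply Rdiv_lt_0_compat; lra).
  assert (Hq0 : 0 < INR q) by (pose proof (pos_INR n); lra).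
  assert (Hnq : (n < q)%nat) by (apply INR_lt; lra).
  assert (Hq1 : 2 < INR q * (v - u)).
  { assert (2 / (v - u) < INR q) by (pose proof (pos_INR n); lra). apply Rlt_div_l in H; lra. }
  destruct (archimed (INR q * u)) as [Hp1 Hp2]. set (p := up (INR q * u)) in *.
  set (e := exp (- (INR n * INR q))). assert (He : 0 < e) by apply exp_pos.
  set (s := Rmin (1 / 2) (e / 2)). assert (Hs : 0 < s) by (apply Rmin_pos; lra).
  assert (s <= 1 / 2) by apply Rmin_l. assert (s <= e / 2) by apply Rmin_r.
  assert (E : forall x, INR q * ((IZR p + x) / INR q) = IZR p + x) by (intros; field; lra).
  exists ((IZR p + s / 2) / INR q), ((IZR p + s) / INR q). split; [|split; [|split]].
  - apply Rmult_lt_reg_l with (INR q); auto. rewrite E. lra.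
  - apply Rmult_lt_reg_l with (INR q); auto. rewrite !E. lra.
  - apply Rmult_lt_reg_l with (INR q); auto. rewrite E. lra.
  - intros a [Ha1 Ha2]. exists q, p. split; auto.
    apply Rmult_le_compat_l with (r := INR q) in Ha1; [|lra].
    apply Rmult_le_compat_l with (r := INR q) in Ha2; [|lra]. rewrite E in Ha1, Ha2.
    rewrite Rabs_pos_eq by lra. fold e. lra.
Qed.

(** The Baire category argument written out with nested closed intervals, the n-th of which consists
    of numbers satisfying the n-th condition. *)
Lemma well_approx_dense x eps : 0 <= x <= 1 -> 0 < eps ->
  exists a, (0 <= a <= 1) /\ (forall n, well_approx n a) /\ Rabs (a - x) < eps.
Proof.
  intros Hx He.
  set (u := Rmax 0 (x - eps)). set (v := Rmin 1 (x + eps)).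
  assert (Hu0 : 0 <= u) by apply Rmax_l. assert (Hu1 : x - eps <= u) by apply Rmax_r.
  assert (Hv0 : v <= 1) by apply Rmin_l. assert (Hv1 : v <= x + eps) by apply Rmin_r.
  assert (Huv : u < v).
  { unfold u, v. apply Rmax_lub_lt; apply Rmin_glb_lt; lra. }
  (* A first interval strictly inside (u, v), which yields the strict inequality of the
     conclusion. *)
  destruct (well_approx_subinterval 0 u v Huv) as [u0 [v0 [K1 [K2 [K3 _]]]]].
  destruct (dependent_choice (fun I => fst I < snd I)
    (fun n I J => fst I < fst J /\ snd J < snd I /\ forall a, fst J <= a <= snd J -> well_approx n a) (u0, v0))
    as [f [Hf0 [HI Hf]]].
  - exact K2.
  - intros n [a b] Hab. destruct (well_approx_subinterval n a b Hab) as [a' [b' [H1 [H2 [H3 H4]]]]].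
    exists (a', b'). simpl. auto.
  - destruct (nested_intervals (fun n => fst (f n)) (fun n => snd (f n))) as [a Ha].
    + intros n. destruct (Hf n) as [? [? ?]]. lra.
    + intros n. destruct (Hf n) as [? [? ?]]. lra.
    + intros n. specialize (HI n). lra.
    + pose proof (Ha O) as H0. rewrite Hf0 in H0. simpl in H0.
      exists a. split; [lra|]. split.
      * intros n. apply (Hf n). apply (Ha (S n)).
      * apply Rabs_def1; lra.
Qed.

Lemma exp_neg_lt_inv n : (1 <= n)%nat -> exp (- INR n) < / INR n.
Proof.
  intros Hn. assert (0 < INR n) by (apply lt_0_INR; lia).
  rewrite exp_Ropp. apply Rinv_lt_contravar.
  - apply Rmult_lt_0_compat; auto. apply exp_pos.
  - pose proof (exp_ineq1 (INR n) ltac:(lra)). lra.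
Qed.

(** After q steps the rotation moves by t = |q a - p|, with 0 < t < [delta], modulo 1. Fewer than 1
    / t + 1 such moves go around the circle, so the waiting time does not depend on x and y. *)
Lemma rotation_uniformly_dense a delta : (forall n, well_approx n a) -> 0 < delta ->
  exists N : nat, forall x y, exists (n : nat) (j : Z), (n <= N)%nat /\ Rabs (x + INR n * a + IZR j - y) < delta.
Proof.
  intros Ha Hd. destruct (archimed_nat (/ delta)) as [n0 Hn0].
  assert (Hid : 0 < / delta) by (apply Rinv_0_lt_compat; auto).
  destruct (Ha (S n0)) as [q [p [Hq [Ht1 Ht2]]]].
  assert (Hsm : Rabs (INR q * a - IZR p) < delta).
  { eapply Rlt_trans; [apply Ht2|]. apply Rle_lt_trans with (exp (- INR (S n0))).
    - assert (Hle : - (INR (S n0) * INR q) <= - INR (S n0)).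
      { assert (1 <= INR q) by (change 1 with (INR 1); apply le_INR; lia).
        pose proof (pos_INR (S n0)). nra. }
      destruct Hle as [Hle|Hle]; [left; apply exp_increasing; auto|rewrite Hle; lra].
    - eapply Rlt_trans; [apply exp_neg_lt_inv; lia|].
      rewrite <- (Rinv_inv delta). rewrite S_INR. apply Rinv_lt_contravar; [|lra].
      apply Rmult_lt_0_compat; lra. }
  set (t := Rabs (INR q * a - IZR p)) in *.
  destruct (archimed_nat (1 / t)) as [I HI].
  exists (I * q)%nat. intros x y.
  (* Counts the moves of length t needed to approach a point at distance z in the direction of
     motion; the two signs of q a - p are treated separately afterwards. *)
  assert (Hgen : forall z, 0 <= z < 1 -> exists i : nat, (i <= I)%nat /\ 0 <= z - INR i * t < t).
  { intros z Hz. destruct (base_Int_part (z / t)) as [B1 B2].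
    assert (Hzt : 0 <= z / t) by (apply Rdiv_le_0_compat; lra).
    assert (Hip : (0 <= Int_part (z / t))%Z).
    { assert (IZR (-1) < IZR (Int_part (z / t))) by (simpl; lra). apply lt_IZR in H. lia. }
    exists (Z.to_nat (Int_part (z / t))). rewrite INR_IZR_INZ, Z2Nat.id by auto. split.
    - apply INR_le. rewrite INR_IZR_INZ, Z2Nat.id by auto.
      assert (z / t < 1 / t) by (apply Rmult_lt_compat_r; [apply Rinv_0_lt_compat; lra|lra]). lra.
    - assert (E : z = z / t * t) by (field; lra).
      assert (IZR (Int_part (z / t)) * t <= z / t * t) by (apply Rmult_le_compat_r; lra).
      assert (z / t * t < (IZR (Int_part (z / t)) + 1) * t) by (apply Rmult_lt_compat_r; lra).
      lra. }
  destruct (Rle_lt_dec 0 (INR q * a - IZR p)) as [Hs|Hs].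
  - assert (Et : t = INR q * a - IZR p) by (unfold t; apply Rabs_pos_eq; auto).
    destruct (base_Int_part (y - x)) as [B1 B2]. set (k := Int_part (y - x)) in *.
    destruct (Hgen (y - x - IZR k)) as [i [Hi1 Hi2]]; [lra|].
    exists (i * q)%nat, (k - Z.of_nat i * p)%Z. split; [apply Nat.mul_le_mono_r; auto|].
    rewrite mult_INR, minus_IZR, mult_IZR, <- INR_IZR_INZ.
    replace (x + INR i * INR q * a + (IZR k - INR i * IZR p) - y)
      with (- (y - x - IZR k - INR i * (INR q * a - IZR p))) by ring.
    rewrite Rabs_Ropp, <- Et, Rabs_pos_eq; lra.
  - assert (Et : t = - (INR q * a - IZR p)) by (unfold t; apply Rabs_left; auto).
    destruct (base_Int_part (x - y)) as [B1 B2]. set (k := Int_part (x - y)) in *.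
    destruct (Hgen (x - y - IZR k)) as [i [Hi1 Hi2]]; [lra|].
    exists (i * q)%nat, (- k - Z.of_nat i * p)%Z. split; [apply Nat.mul_le_mono_r; auto|].
    rewrite mult_INR, minus_IZR, mult_IZR, <- INR_IZR_INZ, opp_IZR.
    replace (x + INR i * INR q * a + (- IZR k - INR i * IZR p) - y)
      with (x - y - IZR k - INR i * (- (INR q * a - IZR p))) by ring.
    rewrite <- Et, Rabs_pos_eq; lra.
Qed.

Definition peak_cocycle (m q : nat) (a : R) (z : C) : C :=
  (peakc m (RtoC (INR q) * (z + RtoC a)) - peakc m (RtoC (INR q) * z))%C.

(** With z in the strip of width 1, q z lies in the strip of width q, where the shift estimate loses
    e^(2 pi (m+1) q). The factor |q a - p| < e^(-n q) compensates this. *)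
Lemma peak_cocycle_small a m eps Q : (forall n, well_approx n a) -> 0 < eps ->
  exists q, (Q <= q)%nat /\ forall z, Rabs (Im z) < 1 -> Cmod (peak_cocycle m q a z) <= eps.
Proof.
  intros Ha He. assert (Hpi := PI_RGT_0). assert (Hpi4 := PI_4).
  destruct (archimed_nat (4 * PI * INR m / eps)) as [n1 Hn1].
  (* As 2 pi <= 8, the last entry makes the total exponent at most -q, hence at most -n; [n1] makes
     4 pi m / n at most eps; [Q] forces q to be large. *)
  set (n := S (max (max n1 Q) (8 * S m + 1))).
  destruct (Ha n) as [q [p [Hq [Ht1 Ht2]]]].
  exists q. split; [lia|]. intros z Hz.
  set (t := INR q * a - IZR p) in *.
  assert (Hq0 : 0 < INR q) by (apply lt_0_INR; lia).
  unfold peak_cocycle.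
  (* The integer p drops out by periodicity of the peak, leaving only the tiny shift t. *)
  replace (RtoC (INR q) * (z + RtoC a))%C with (RtoC (INR q) * z + RtoC t + RtoC (IZR p))%C
    by (unfold t; rewrite RtoC_minus, RtoC_mult; ring).
  rewrite peakc_Z.
  eapply Rle_trans; [apply (peakc_shift_bound m _ t (INR q)); [lra|]|].
  { replace (Im (RtoC (INR q) * z)) with (INR q * Im z) by (destruct z; simpl; ring).
    rewrite Rabs_mult, Rabs_pos_eq by lra. nra. }
  assert (HX : exp (2 * PI * INR q) ^ S m = exp (INR (S m) * (2 * PI * INR q))).
  { generalize (S m) as k. induction k as [|k IH]; [simpl; rewrite Rmult_0_l, exp_0; auto|].
    rewrite S_INR. replace ((INR k + 1) * (2 * PI * INR q)) with (2 * PI * INR q + INR k * (2 * PI * INR q)) by ring.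
    rewrite exp_plus, <- IH. reflexivity. }
  rewrite HX.
  assert (Hc : 0 <= 4 * PI * INR m) by (pose proof (pos_INR m); nra).
  apply Rle_trans with (4 * PI * INR m * exp (- INR n)).
  - rewrite Rmult_assoc. apply Rmult_le_compat_l; auto.
    apply Rle_trans with (exp (INR (S m) * (2 * PI * INR q)) * exp (- (INR n * INR q))).
    + apply Rmult_le_compat_l; [left; apply exp_pos|lra].
    + rewrite <- exp_plus.
      assert (Hle : INR (S m) * (2 * PI * INR q) + - (INR n * INR q) <= - INR n).
      { assert (Hnm : INR (8 * S m + 1) <= INR n) by (apply le_INR; unfold n; lia).
        rewrite plus_INR, mult_INR in Hnm. replace (INR 8) with 8 in Hnm by (simpl; ring). simpl (INR 1) in Hnm.
        assert (Hnq : INR n <= INR q) by (apply le_INR; lia).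
        assert (0 <= INR (S m)) by apply pos_INR.
        assert (INR (S m) * (2 * PI) <= 8 * INR (S m)) by nra.
        assert (INR (S m) * (2 * PI) - INR n <= -1) by lra.
        assert ((INR (S m) * (2 * PI) - INR n) * INR q <= -1 * INR q) by (apply Rmult_le_compat_r; lra).
        lra. }
      destruct Hle as [Hle|Hle]; [left; apply exp_increasing; auto|rewrite Hle; lra].
  - assert (Hn : (1 <= n)%nat) by (unfold n; lia).
    assert (Hn0 : 0 < INR n) by (apply lt_0_INR; lia).
    pose proof (exp_neg_lt_inv n Hn) as Hexp.
    apply Rle_trans with (4 * PI * INR m * / INR n); [apply Rmult_le_compat_l; lra|].
    apply Rle_div_l; auto.
    assert (4 * PI * INR m / eps <= INR n).
    { apply Rle_trans with (INR n1); [lra|]. apply le_INR. unfold n. lia. }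
    apply Rle_div_l in H; auto. lra.
Qed.

(** * The lacunary transfer function *)

Fixpoint transfer (m q : nat -> nat) (N : nat) (x : R) : R :=
  match N with O => 0 | S k => transfer m q k x + peak (m k) (INR (q k) * x) end.

Fixpoint transferc (m q : nat -> nat) (N : nat) (z : C) : C :=
  match N with O => RtoC 0 | S k => (transferc m q k z + peakc (m k) (RtoC (INR (q k)) * z))%C end.

Definition cocyclec (m q : nat -> nat) (a : R) (N : nat) (z : C) : C :=
  (transferc m q N (z + RtoC a) - transferc m q N z)%C.

Lemma transferc_RtoC m q N x : transferc m q N (RtoC x) = RtoC (transfer m q N x).
Proof.
  induction N as [|N IH]; simpl; auto. rewrite IH, <- RtoC_mult, peakc_RtoC, RtoC_plus. reflexivity.
Qed.

Lemma cocyclec_RtoC m q a N x :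
  cocyclec m q a N (RtoC x) = RtoC (transfer m q N (x + a) - transfer m q N x).
Proof. unfold cocyclec. rewrite <- RtoC_plus, !transferc_RtoC, RtoC_minus. reflexivity. Qed.

Lemma cdiff_transferc m q N z : cdiff (transferc m q N) z.
Proof.
  induction N as [|N IH]; simpl; [apply cdiff_const|]. apply cdiff_plus; auto.
  apply (cdiff_comp (peakc (m N)) (fun u => RtoC (INR (q N)) * u)%C); [|apply cdiff_peakc].
  apply cdiff_mult; [apply cdiff_const|apply cdiff_id].
Qed.

Lemma cdiff_cocyclec m q a N z : cdiff (cocyclec m q a N) z.
Proof.
  unfold cocyclec. apply cdiff_minus; [|apply cdiff_transferc].
  apply (cdiff_comp (transferc m q N) (fun u => u + RtoC a)%C); [|apply cdiff_transferc].
  apply cdiff_plus; [apply cdiff_id|apply cdiff_const].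
Qed.

Lemma transferc_bounded m q N Y : 0 <= Y -> exists B, forall z, Rabs (Im z) <= Y -> Cmod (transferc m q N z) <= B.
Proof.
  intros HY. induction N as [|N [B IH]].
  - exists 0. intros z _. simpl. rewrite Cmod_0. lra.
  - exists (B + 2 * exp (2 * PI * (INR (q N) * Y)) ^ m N). intros z Hz. simpl.
    eapply Rle_trans; [apply Cmod_triangle|]. apply Rplus_le_compat; auto.
    pose proof (pos_INR (q N)).
    apply Cmod_peakc; [apply Rmult_le_pos; auto|].
    replace (Im (RtoC (INR (q N)) * z)) with (INR (q N) * Im z) by (destruct z; simpl; ring).
    rewrite Rabs_mult, Rabs_pos_eq by auto. apply Rmult_le_compat_l; auto.
Qed.

Lemma transfer_lipschitz m q N : exists L, 0 <= L /\ forall x y, Rabs (transfer m q N x - transfer m q N y) <= L * Rabs (x - y).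
Proof.
  assert (Hpi := PI_RGT_0).
  induction N as [|N [L [HL IH]]].
  - exists 0. split; [lra|]. intros x y. simpl. rewrite Rminus_diag, Rabs_R0. lra.
  - exists (L + 4 * PI * INR (m N) * INR (q N)).
    pose proof (pos_INR (m N)). pose proof (pos_INR (q N)).
    assert (0 <= 4 * PI * INR (m N) * INR (q N)) by (apply Rmult_le_pos; auto; apply Rmult_le_pos; lra).
    split; [lra|]. intros x y. simpl.
    replace (transfer m q N x + peak (m N) (INR (q N) * x) - (transfer m q N y + peak (m N) (INR (q N) * y)))
      with ((transfer m q N x - transfer m q N y) + (peak (m N) (INR (q N) * x) - peak (m N) (INR (q N) * y))) by ring.
    eapply Rle_trans; [apply Rabs_triang|].
    pose proof (peak_lipschitz (m N) (INR (q N) * x) (INR (q N) * y)) as P.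
    rewrite <- Rmult_minus_distr_l, Rabs_mult, (Rabs_pos_eq (INR (q N))) in P by auto.
    specialize (IH x y). lra.
Qed.

Lemma transfer_Z m q N x n : transfer m q N (x + IZR n) = transfer m q N x.
Proof.
  induction N as [|N IH]; simpl; auto. rewrite IH. f_equal.
  replace (INR (q N) * (x + IZR n)) with (INR (q N) * x + IZR (Z.of_nat (q N) * n))
    by (rewrite mult_IZR, <- INR_IZR_INZ; ring).
  apply peak_Z.
Qed.

Lemma transfer_ext m q q' N : (forall k, (k < N)%nat -> q k = q' k) -> transfer m q N = transfer m q' N.
Proof.
  intros H. apply functional_extensionality. intros x. induction N as [|N IH]; simpl; auto.
  rewrite IH, H by auto. reflexivity.
Qed.

(** The halving of [e] sums the tails. The strip estimate gives convergence of the cocycles, and the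
    oscillation bound lets the new peak dominate the old partial sum in [transfer_onto]. In the last
    clause N is a time within which the rotation matches both a base point and the value of the new
    partial sum; the later cocycle terms remain negligible during that time. *)
Definition good_step (a : R) (m q : nat -> nat) (e : nat -> R) (k : nat) : Prop :=
  0 < e k /\ e (S k) <= e k / 2 /\ (S k <= q k)%nat /\
  (forall z, Rabs (Im z) < 1 -> Cmod (peak_cocycle (m k) (q k) a z) <= e k) /\
  (forall x y, Rabs (x - y) <= / INR (q k) -> Rabs (transfer m q k x - transfer m q k y) <= 1) /\
  exists N : nat, INR N * e (S k) <= / INR (S k) /\
    forall x y, exists (n : nat) (j : Z), (n <= N)%nat /\
      Rabs (x + INR n * a + IZR j - y) <= / INR (S k) /\
      Rabs (transfer m q (S k) (x + INR n * a + IZR j) - transfer m q (S k) y) <= / INR (S k).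

Lemma inv_INR_S_pos k : 0 < / INR (S k).
Proof. apply Rinv_0_lt_compat, lt_0_INR. lia. Qed.

(* The frequencies are chosen one at a time: [q k] must beat the modulus of continuity of
   the partial sum, and the next error bound [e (S k)] must beat the time the rotation
   needs to become dense at the scale of the new partial sum. *)
Lemma frequencies_exist a m e0 : (forall n, well_approx n a) -> 0 < e0 ->
  exists q e, e O = e0 /\ forall k, good_step a m q e k.
Proof.
  intros Ha He0.
  destruct (dependent_choice (A := (nat -> nat) * R) (fun s => 0 < snd s)
    (* A state is a whole frequency sequence with the current error bound. Step k changes only entry
       k, so entries below k are final. *)
    (fun k s s' => (forall i, i <> k -> fst s' i = fst s i) /\
       0 < snd s /\ snd s' <= snd s / 2 /\ (S k <= fst s' k)%nat /\
       (forall z, Rabs (Im z) < 1 -> Cmod (peak_cocycle (m k) (fst s' k) a z) <= snd s) /\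
       (forall x y, Rabs (x - y) <= / INR (fst s' k) -> Rabs (transfer m (fst s') k x - transfer m (fst s') k y) <= 1) /\
       exists N : nat, INR N * snd s' <= / INR (S k) /\
         forall x y, exists (n : nat) (j : Z), (n <= N)%nat /\
           Rabs (x + INR n * a + IZR j - y) <= / INR (S k) /\
           Rabs (transfer m (fst s') (S k) (x + INR n * a + IZR j) - transfer m (fst s') (S k) y) <= / INR (S k))
    (fun _ => O, e0)) as [f [Hf0 [HI Hf]]]; [exact He0| |].
  { intros k [q e] He. simpl in He.
    destruct (transfer_lipschitz m q k) as [L [HL HLip]].
    (* A frequency above the Lipschitz constant L makes the partial sum vary by at most 1 over a
       distance 1 / [qk]. *)
    destruct (archimed_nat L) as [Q HQ].
    destruct (peak_cocycle_small a (m k) e (max (S k) Q) Ha He) as [qk [Hqk Hsmall]].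
    set (q' := fun i => if Nat.eq_dec i k then qk else q i).
    assert (Eq : q' k = qk) by (unfold q'; destruct (Nat.eq_dec k k); congruence).
    assert (Et : transfer m q' k = transfer m q k).
    { apply transfer_ext. intros i Hi. unfold q'. destruct (Nat.eq_dec i k); auto; lia. }
    assert (Hk := inv_INR_S_pos k).
    destruct (transfer_lipschitz m q' (S k)) as [L' [HL' HLip']].
    destruct (rotation_uniformly_dense a (/ INR (S k) / (L' + 1)) Ha) as [N HN].
    { apply Rdiv_lt_0_compat; lra. }
    (* The waiting time N is already known here; the denominator N + 1 also covers N = 0. *)
    set (e' := Rmin (e / 2) (/ INR (S k) / (INR N + 1))).
    pose proof (pos_INR N) as HN0.
    exists (q', e'). cbn [fst snd]. split.
    { apply Rmin_pos; [lra|]. apply Rdiv_lt_0_compat; lra. }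
    split; [|split; [|split; [|split; [|split; [|split]]]]].
    - intros i Hi. unfold q'. destruct (Nat.eq_dec i k); congruence.
    - exact He.
    - apply Rmin_l.
    - rewrite Eq. lia.
    - rewrite Eq. exact Hsmall.
    - rewrite Et, Eq. intros x y Hxy. eapply Rle_trans; [apply HLip|].
      assert (INR Q <= INR qk) by (apply le_INR; lia).
      assert (0 < INR qk) by (apply lt_0_INR; lia).
      apply Rle_trans with (INR qk * / INR qk); [|right; field; lra].
      apply Rmult_le_compat; try lra. apply Rabs_pos.
    - exists N. split.
      + assert (H1 : e' <= / INR (S k) / (INR N + 1)) by apply Rmin_r.
        apply Rle_div_r in H1; [|lra].
        assert (0 <= e') by (apply Rmin_glb; [lra|apply Rdiv_le_0_compat; lra]).
        change (INR N * e' <= / INR (S k)). lra.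
      + intros x y. destruct (HN x y) as [n [j [Hn Hnj]]]. exists n, j. split; auto.
        apply Rlt_div_r in Hnj; [|lra].
        pose proof (Rabs_pos (x + INR n * a + IZR j - y)).
        split; [|eapply Rle_trans; [apply HLip'|]]; nra. }
  exists (fun k => fst (f (S k)) k), (fun k => snd (f k)).
  split; [rewrite Hf0; reflexivity|]. intros k.
  (* The diagonal sequence: entry k is read off immediately after it has been fixed, and [Hstab]
     says that it never changes again. *)
  set (q := fun k => fst (f (S k)) k).
  assert (Hstab : forall d k, fst (f (S k + d)%nat) k = q k).
  { induction d as [|d IH]; intros i; [rewrite Nat.add_0_r; reflexivity|].
    rewrite <- (IH i). rewrite Nat.add_succ_r. apply (Hf (S i + d)%nat). lia. }
  assert (Et : forall M K, (M <= K)%nat -> transfer m (fst (f K)) M = transfer m q M).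
  { intros M K HMK. apply transfer_ext. intros i Hi. rewrite <- (Hstab (K - S i)%nat i). do 2 f_equal. lia. }
  destruct (Hf k) as [_ [H1 [H2 [H3 [H4 [H5 H6]]]]]].
  rewrite (Et k (S k)) in H5 by lia. rewrite (Et (S k) (S k)) in H6 by lia.
  unfold good_step. fold q. repeat (split; auto).
Qed.

Section Limit.
Variables (a : R) (m q : nat -> nat) (e : nat -> R).
Hypothesis Hgood : forall k, good_step a m q e k.

Lemma error_geometric N : e N <= e O / 2 ^ N.
Proof.
  induction N as [|N IH]; [simpl; lra|]. destruct (Hgood N) as [_ [H _]].
  assert (2 ^ N <> 0) by (apply pow_nonzero; lra).
  replace (e O / 2 ^ S N) with (e O / 2 ^ N / 2) by (simpl; field; auto). lra.
Qed.

Lemma error_small eps : 0 < eps -> exists N, forall n, (N <= n)%nat -> e n < eps.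
Proof.
  intros He. destruct (pow_half_lt (e O) eps He) as [N HN]. exists N.
  intros n Hn. apply Rle_lt_trans with (e N); [|pose proof (error_geometric N); lra].
  induction Hn as [|n Hn IH]; [lra|]. destruct (Hgood n) as [H1 [H2 _]]. lra.
Qed.

Lemma cocyclec_step N z :
  cocyclec m q a (S N) z = (cocyclec m q a N z + peak_cocycle (m N) (q N) a z)%C.
Proof. unfold cocyclec, peak_cocycle. simpl. ring. Qed.

(** The subtracted term makes the induction telescope: a step costs at most e(N+j), and e(N+j) <= 2
    e(N+j) - 2 e(N+j+1). *)
Lemma cocyclec_tail N j z : Rabs (Im z) < 1 ->
  Cmod (cocyclec m q a (N + j) z - cocyclec m q a N z) <= 2 * e N - 2 * e (N + j)%nat.
Proof.
  intros Hz. induction j as [|j IH].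
  - rewrite Nat.add_0_r. replace (cocyclec m q a N z - cocyclec m q a N z)%C with (RtoC 0) by ring.
    rewrite Cmod_0. lra.
  - rewrite Nat.add_succ_r, cocyclec_step. destruct (Hgood (N + j)) as [_ [H2 [_ [H4 _]]]].
    specialize (H4 z Hz).
    replace (cocyclec m q a (N + j) z + peak_cocycle (m (N + j)) (q (N + j)) a z - cocyclec m q a N z)%C
      with ((cocyclec m q a (N + j) z - cocyclec m q a N z) + peak_cocycle (m (N + j)) (q (N + j)) a z)%C by ring.
    eapply Rle_trans; [apply Cmod_triangle|]. lra.
Qed.

Lemma cocyclec_tail_le N n z : Rabs (Im z) < 1 -> (N <= n)%nat ->
  Cmod (cocyclec m q a n z - cocyclec m q a N z) <= 2 * e N.
Proof.
  intros Hz Hn. pose proof (cocyclec_tail N (n - N) z Hz) as H.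
  replace (N + (n - N))%nat with n in H by lia. destruct (Hgood n) as [H1 _]. lra.
Qed.

(** The cocycles converge uniformly on the strip of width 1, which makes the limit holomorphic; no
    convergence of the transfer functions is involved. *)
Lemma cocycle_limit : exists (phi : R -> R) (phic : C -> C),
  holo1 1 phic /\ (forall x, phic (RtoC x) = RtoC (phi x)) /\
  (forall N z, Rabs (Im z) < 1 -> Cmod (cocyclec m q a N z - phic z) <= 2 * e N).
Proof.
  destruct (exists_choice (fun z l => Rabs (Im z) < 1 -> forall N, Cmod (cocyclec m q a N z - l) <= 2 * e N)) as [phic Hphi].
  { intros z. destruct (Rlt_dec (Rabs (Im z)) 1) as [Hz|Hz]; [|exists (RtoC 0); intros; contradiction].
    destruct (C_cauchy_complete (fun N => cocyclec m q a N z)) as [l Hl].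
    - intros eps He. destruct (error_small (eps / 4)) as [N HN]; [lra|]. exists N. intros n k Hn Hk.
      specialize (HN N (le_n N)).
      eapply Rle_lt_trans; [apply (Cmod_sub_triangle _ (cocyclec m q a N z))|].
      rewrite (Cmod_sub_sym (cocyclec m q a N z)).
      pose proof (cocyclec_tail_le N n z Hz Hn). pose proof (cocyclec_tail_le N k z Hz Hk). lra.
    - exists l. intros _ N. apply le_epsilon. intros eps He. destruct (Hl eps He) as [M HM].
      specialize (HM (max M N) ltac:(lia)). pose proof (cocyclec_tail_le N (max M N) z Hz ltac:(lia)) as H.
      eapply Rle_trans; [apply (Cmod_sub_triangle _ (cocyclec m q a (max M N) z))|].
      rewrite Cmod_sub_sym. lra. }
  exists (fun x => Re (phic (RtoC x))), phic. split; [|split].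
  - apply holo1_uniform_limit with (cocyclec m q a); [lra| |].
    + intros n z _. apply cdiff_cocyclec.
    + intros eps He. destruct (error_small (eps / 2)) as [N HN]; [lra|]. exists N. intros n z Hn Hz.
      specialize (Hphi z Hz n). specialize (HN n Hn). lra.
  (* The approximating cocycles are real on the real line, so the limit is real there too. *)
  - intros x. assert (Him : Im (phic (RtoC x)) = 0).
    { apply Rabs_eq_0, Rle_antisym; [|apply Rabs_pos]. apply le_epsilon. intros eps He.
      destruct (error_small (eps / 2)) as [N HN]; [lra|]. specialize (HN N (le_n N)).
      specialize (Hphi (RtoC x) ltac:(rewrite Im_RtoC, Rabs_R0; lra) N).
      pose proof (Im_le_Cmod (cocyclec m q a N (RtoC x) - phic (RtoC x))) as H.
      rewrite cocyclec_RtoC in H, Hphi.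
      replace (Im (RtoC (transfer m q N (x + a) - transfer m q N x) - phic (RtoC x))) with (- Im (phic (RtoC x))) in H
        by (destruct (phic (RtoC x)); simpl; ring).
      rewrite Rabs_Ropp in H. lra. }
    destruct (phic (RtoC x)); simpl in *. rewrite Him. reflexivity.
  - intros N z Hz. apply Hphi; auto.
Qed.

Variables (phi : R -> R).
Hypothesis Hphi : forall N x, Rabs (transfer m q N (x + a) - transfer m q N x - phi x) <= 2 * e N.
Hypothesis Hm : forall k, (1 <= m k)%nat.

Lemma phi_periodic x : phi (x + 1) = phi x.
Proof.
  apply Rminus_diag_uniq, Rabs_eq_0, Rle_antisym; [|apply Rabs_pos]. apply le_epsilon. intros eps He.
  destruct (error_small (eps / 4)) as [N HN]; [lra|]. specialize (HN N (le_n N)).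
  pose proof (Hphi N x) as H1. pose proof (Hphi N (x + 1)) as H2.
  replace (x + 1 + a) with ((x + a) + 1) in H2 by ring. change 1 with (IZR 1) in H2.
  rewrite !transfer_Z in H2. change (IZR 1) with 1 in H2.
  apply Rabs_le_between in H1. apply Rabs_le_between in H2. apply Rabs_le. lra.
Qed.

Fixpoint birkhoff (n : nat) (x : R) : R :=
  match n with O => 0 | S n => birkhoff n x + phi (x + INR n * a) end.

(** The N-th cocycle telescopes along the orbit, and each of the n steps costs its distance to
    [phi]. *)
Lemma birkhoff_transfer n N x :
  Rabs (transfer m q N (x + INR n * a) - transfer m q N x - birkhoff n x) <= INR n * (2 * e N).
Proof.
  induction n as [|n IH].
  - simpl. replace (x + 0 * a) with x by ring.
    replace (transfer m q N x - transfer m q N x - 0) with 0 by ring. rewrite Rabs_R0. lra.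
  - rewrite S_INR. simpl birkhoff. pose proof (Hphi N (x + INR n * a)) as H.
    replace (x + (INR n + 1) * a) with (x + INR n * a + a) by ring.
    apply Rabs_le_between in IH. apply Rabs_le_between in H. apply Rabs_le. lra.
Qed.

Lemma skew_iter (k1 k2 : Z) n x y :
  Nat.iter n (skew (a + IZR k1) (IZR k2) phi) (x, y) =
  (x + INR n * a + INR n * IZR k1, y + INR n * IZR k2 + birkhoff n x).
Proof.
  induction n as [|n IH].
  - simpl. f_equal; ring.
  - change (Nat.iter (S n) (skew (a + IZR k1) (IZR k2) phi) (x, y))
      with (skew (a + IZR k1) (IZR k2) phi (Nat.iter n (skew (a + IZR k1) (IZR k2) phi) (x, y))).
    rewrite IH. unfold skew; cbn [fst snd]. rewrite S_INR. cbn [birkhoff].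
    replace (INR n * IZR k1) with (IZR (Z.of_nat n * k1)) by (rewrite mult_IZR, <- INR_IZR_INZ; auto).
    rewrite (periodic1_Z phi phi_periodic). rewrite mult_IZR, <- INR_IZR_INZ. f_equal; ring.
Qed.

Lemma transfer_continuity N : continuity (transfer m q N).
Proof.
  intros x. destruct (transfer_lipschitz m q N) as [L [HL H]].
  apply continuity_pt_filterlim. apply (lipschitz_at_continuous _ x 1 (L + 1)); [lra|lra|].
  intros y _. eapply Rle_trans; [apply H|]. apply Rmult_le_compat_r; [apply Rabs_pos|lra].
Qed.

(** Between u = p / q and v = u + 1 / (2 q) the new peak falls from 2 to 0, while the older sum
    changes by at most 1. So the partial sum falls by at least 1, and by continuity it meets c
    modulo 1. *)
Lemma transfer_onto k x c : exists x' (j : Z),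
  Rabs (x' - x) <= 2 / INR (q k) /\ transfer m q (S k) x' = c + IZR j.
Proof.
  destruct (Hgood k) as [_ [_ [Hq [_ [Hosc _]]]]].
  assert (Hq0 : 0 < INR (q k)) by (apply lt_0_INR; lia).
  assert (Hi : 0 < / INR (q k)) by (apply Rinv_0_lt_compat; auto).
  destruct (archimed (INR (q k) * x)) as [A1 A2]. set (p := up (INR (q k) * x)) in *.
  set (u := IZR p / INR (q k)). set (v := (IZR p + / 2) / INR (q k)).
  assert (Eu : INR (q k) * u = IZR p) by (unfold u; field; lra).
  assert (Ev : INR (q k) * v = IZR p + / 2) by (unfold v; field; lra).
  assert (Huv : v - u = / 2 * / INR (q k)) by (unfold u, v; field; lra).
  assert (Hux : 0 <= u - x <= / INR (q k)).
  { replace (u - x) with ((IZR p - INR (q k) * x) * / INR (q k)) by (unfold u; field; lra).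
    split; [apply Rmult_le_pos; lra|]. rewrite <- (Rmult_1_l (/ INR (q k))) at 2.
    apply Rmult_le_compat_r; lra. }
  assert (Hd : Rabs (transfer m q k u - transfer m q k v) <= 1).
  { apply Hosc. apply Rabs_le. lra. }
  apply Rabs_le_between in Hd.
  assert (Fu : transfer m q (S k) u = transfer m q k u + 2).
  { simpl. rewrite Eu, peak_top. reflexivity. }
  assert (Fv : transfer m q (S k) v = transfer m q k v).
  { simpl. rewrite Ev, peak_bottom by auto. ring. }
  destruct (base_Int_part (transfer m q (S k) v - c)) as [B1 B2].
  set (j := Int_part (transfer m q (S k) v - c)) in *.
  (* The representative of c modulo 1 in the half-open unit interval just above the value at v; it
     does not exceed the value at u. *)
  destruct (IVT_gen (transfer m q (S k)) u v (c + (IZR j + 1))) as [x' [Hx' Ex']].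
  - apply transfer_continuity.
  - rewrite Rmin_right, Rmax_left by lra. lra.
  - rewrite Rmin_left, Rmax_right in Hx' by lra.
    exists x', (j + 1)%Z. rewrite plus_IZR. split; auto. apply Rabs_le. unfold Rdiv. lra.
Qed.

(** The fibre coordinate moves by a Birkhoff sum, which is close to the increment of the partial sum
    of index k + 1. It is enough to bring the base point near a point where that partial sum has the
    right value modulo 1. *)
Lemma skew_orbit_dense (k1 k2 : Z) x y x0 y0 eps : 0 < eps ->
  exists n (j1 j2 : Z),
    Rabs (fst (Nat.iter n (skew (a + IZR k1) (IZR k2) phi) (x, y)) + IZR j1 - x0) < eps /\
    Rabs (snd (Nat.iter n (skew (a + IZR k1) (IZR k2) phi) (x, y)) + IZR j2 - y0) < eps.
Proof.
  intros He. destruct (archimed_nat (4 / eps)) as [k Hk].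
  assert (Hk0 : 0 < INR (S k)) by (apply lt_0_INR; lia).
  assert (Hk1 : 4 * / INR (S k) < eps).
  { apply Rlt_div_l in Hk; auto. apply Rlt_div_l; auto. rewrite S_INR. lra. }
  destruct (Hgood k) as [_ [_ [Hq [_ [_ [N [HN1 HN2]]]]]]].
  assert (Hq0 : 0 < INR (q k)) by (apply lt_0_INR; lia).
  assert (Hqk : / INR (q k) <= / INR (S k)).
  { apply Rinv_le_contravar; auto. apply le_INR; auto. }
  (* The value of the partial sum at x' is the one that moves the fibre coordinate from y to y0
     modulo 1. *)
  destruct (transfer_onto k x0 (transfer m q (S k) x + y0 - y)) as [x' [j [Hx' Ex']]].
  destruct (HN2 x x') as [n [i [Hn [Hn1 Hn2]]]].
  rewrite transfer_Z in Hn2.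
  exists n, (i - Z.of_nat n * k1)%Z, (- j - Z.of_nat n * k2)%Z. rewrite skew_iter. cbn [fst snd].
  rewrite !minus_IZR, !mult_IZR, <- !INR_IZR_INZ, opp_IZR.
  pose proof (birkhoff_transfer n (S k) x) as HB.
  assert (HBn : INR n * (2 * e (S k)) <= 2 * / INR (S k)).
  { assert (INR n <= INR N) by (apply le_INR; auto). destruct (Hgood (S k)) as [Hp _].
    assert (INR n * e (S k) <= INR N * e (S k)) by (apply Rmult_le_compat_r; lra). lra. }
  pose proof (inv_INR_S_pos k) as Hpk.
  apply Rabs_le_between in Hx'. apply Rabs_le_between in Hn1. apply Rabs_le_between in Hn2.
  apply Rabs_le_between in HB. unfold Rdiv in Hx'.
  split; apply Rabs_def1; lra.
Qed.
End Limit.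

(** * An invariant set of intermediate measure *)

(* This is [liminf_N cos (2 pi (y - psi_N x)) > 0]: the region [cos (2 pi (y - psi x)) > 0]
   over the discontinuous limit [psi] of the transfer functions, up to a null set. *)
Definition positive_side (m q : nat -> nat) (p : R * R) : Prop :=
  exists j K : nat, forall N, (K <= N)%nat -> / INR (S j) <= cos (2 * PI * (snd p - transfer m q N (fst p))).

Lemma cos_lipschitz a b : Rabs (cos a - cos b) <= Rabs (a - b).
Proof.
  rewrite form2. rewrite !Rabs_mult.
  assert (E2 : Rabs (-2) = 2) by (rewrite Rabs_left; lra). rewrite E2.
  pose proof (Rabs_sin_le ((a - b) / 2)) as H. unfold Rdiv in H at 2.
  rewrite (Rabs_mult (a - b)), (Rabs_pos_eq (/ 2)) in H by lra.
  assert (H1 : Rabs (sin ((a + b) / 2)) <= 1) by (apply Rabs_le, SIN_bound).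
  pose proof (Rabs_pos (sin ((a - b) / 2))). pose proof (Rabs_pos (sin ((a + b) / 2))). nra.
Qed.

Lemma cos_2PI_sub_1 y t : cos (2 * PI * (y + 1 - t)) = cos (2 * PI * (y - t)).
Proof.
  replace (2 * PI * (y + 1 - t)) with (2 * PI * (y - t) + 2 * INR 1 * PI) by (simpl; ring). apply cos_period.
Qed.

Definition cos_turn (x : R) : R := cos (2 * PI * x).

Lemma continuity_cos_turn : continuity cos_turn.
Proof.
  apply (continuity_comp (fun x => 2 * PI * x) cos); [|apply continuity_cos].
  apply continuity_scal, derivable_continuous, derivable_id.
Qed.

(** The same number as [gap], in the notation of the standard reals; [away_IZR] identifies the
    two. *)
Definition notch (k : nat) : R := / 4 / 2 ^ (S k) / 2.

Section PositiveSide.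
Variables m q : nat -> nat.

Lemma positive_side_periodic : periodic_set (positive_side m q).
Proof.
  intros x y. unfold positive_side; cbn [fst snd]. split.
  - assert (E : forall N, transfer m q N (x + 1) = transfer m q N x) by (intros; apply (transfer_Z m q N x 1)).
    split; intros [j [K H]]; exists j, K; intros N HN; specialize (H N HN); rewrite E in *; auto.
  - split; intros [j [K H]]; exists j, K; intros N HN; specialize (H N HN); rewrite cos_2PI_sub_1 in *; auto.
Qed.

Lemma positive_side_half x y : positive_side m q (x, y) -> ~ positive_side m q (x, y + / 2).
Proof.
  intros [j [K H]] [j' [K' H']]. cbn [fst snd] in *.
  specialize (H (max K K') ltac:(lia)). specialize (H' (max K K') ltac:(lia)).
  replace (2 * PI * (y + / 2 - transfer m q (max K K') x)) with (2 * PI * (y - transfer m q (max K K') x) + PI) in H' by field.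
  rewrite neg_cos in H'. pose proof (inv_INR_S_pos j). pose proof (inv_INR_S_pos j'). lra.
Qed.

(** The bounds 2^-k make the partial sums increasing and bounded at x, hence convergent. Of four
    angles differing by quarter turns, one has cosine at least 1/2, and convergence keeps the cosine
    above a fixed positive number. *)
Lemma positive_side_cover x y : (forall k, peak (m k) (INR (q k) * x) <= (/ 2) ^ k) ->
  exists i : nat, (i < 4)%nat /\ positive_side m q (x, y + INR i / 4).
Proof.
  intros Hx.
  assert (Hb : forall N, transfer m q N x <= 2 - 2 * (/ 2) ^ N).
  { induction N as [|N IH]; simpl; [lra|]. specialize (Hx N). lra. }
  destruct (growing_cv (fun N => transfer m q N x)) as [l Hl].
  { intros N. simpl. pose proof (peak_pos (m N) (INR (q N) * x)). lra. }
  { exists 2. intros z [N ->]. specialize (Hb N). assert (0 < (/ 2) ^ N) by (apply pow_lt; lra). lra. }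
  assert (Hpi := PI_RGT_0). assert (Hpi4 := PI_4).
  (* Since 2 pi <= 8, the cosine changes by at most 8/48 = 1/6, and 1/2 - 1/6 = 1/3 is the threshold
     with j = 2. *)
  destruct (Hl (/ 48)) as [K HK]; [lra|].
  set (th := 2 * PI * (y - l)).
  assert (Hi : exists i : nat, (i < 4)%nat /\ / 2 <= cos (th + INR i * (PI / 2))).
  { assert (Es : cos (PI / 2 + th) = - sin th) by (rewrite cos_plus, cos_PI2, sin_PI2; ring).
    destruct (Rle_lt_dec (/ 2) (cos th)) as [H0|H0].
    { exists 0%nat. split; [lia|]. simpl. replace (th + 0 * (PI / 2)) with th by ring. auto. }
    destruct (Rle_lt_dec (/ 2) (- sin th)) as [H1|H1].
    { exists 1%nat. split; [lia|]. simpl. replace (th + 1 * (PI / 2)) with (PI / 2 + th) by ring.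
      rewrite Es. auto. }
    destruct (Rle_lt_dec (/ 2) (- cos th)) as [H2|H2].
    { exists 2%nat. split; [lia|]. simpl. replace (th + (1 + 1) * (PI / 2)) with (th + PI) by field.
      rewrite neg_cos. auto. }
    exists 3%nat. split; [lia|].
    replace (th + INR 3 * (PI / 2)) with ((PI / 2 + th) + PI) by (simpl; field).
    rewrite neg_cos. 
    pose proof (sin2_cos2 th) as Hsc. unfold Rsqr in Hsc.
    rewrite Es. nra. }
  destruct Hi as [i [Hi4 Hi]]. exists i. split; auto. exists 2%nat, K. intros N HN. cbn [fst snd].
  specialize (HK N HN). unfold Rdist in HK.
  set (a := 2 * PI * (y + INR i / 4 - transfer m q N x)).
  pose proof (cos_lipschitz (th + INR i * (PI / 2)) a) as HL.
  assert (Ea : th + INR i * (PI / 2) - a = 2 * PI * (transfer m q N x - l)) by (unfold th, a; field).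
  rewrite Ea, Rabs_mult, (Rabs_pos_eq (2 * PI)) in HL by lra.
  assert (2 * PI * Rabs (transfer m q N x - l) <= 8 * / 48).
  { apply Rmult_le_compat; try lra. apply Rabs_pos. }
  apply Rabs_le_between in HL. replace (INR 3) with 3 by (simpl; ring). lra.
Qed.

Variables (a : R) (e : nat -> R) (phi : R -> R).
Hypothesis Hgood : forall k, good_step a m q e k.
Hypothesis Hphi : forall N x, Rabs (transfer m q N (x + a) - transfer m q N x - phi x) <= 2 * e N.

(** Along the skew product y - psi_N(x) changes, up to an integer, by at most 2 e(N), which tends to
    0. The invariance is exact at every point, including those where the psi_N diverge, since a
    positive lower bound is only weakened by a factor 2. *)
Lemma positive_side_invariant (k1 k2 : Z) p :
  positive_side m q (skew (a + IZR k1) (IZR k2) phi p) <-> positive_side m q p.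
Proof.
  destruct p as [x y]. unfold positive_side, skew; cbn [fst snd].
  assert (Hpi := PI_RGT_0). assert (Hpi4 := PI_4).
  assert (Hd : forall N, Rabs (cos (2 * PI * (y + IZR k2 + phi x - transfer m q N (x + (a + IZR k1)))) -
     cos (2 * PI * (y - transfer m q N x))) <= 16 * e N).
  { intros N. replace (x + (a + IZR k1)) with (x + a + IZR k1) by ring. rewrite transfer_Z.
    assert (Ec : cos (2 * PI * (y + IZR k2 + phi x - transfer m q N (x + a))) =
        cos (2 * PI * (y + phi x - transfer m q N (x + a)))).
    { apply (periodic1_Z (fun y => cos (2 * PI * (y + phi x - transfer m q N (x + a))))).
      intros z. replace (z + 1 + phi x - transfer m q N (x + a)) with (z + phi x + 1 - transfer m q N (x + a)) by ring.
      apply cos_2PI_sub_1. }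
    rewrite Ec. eapply Rle_trans; [apply cos_lipschitz|].
    replace (2 * PI * (y + phi x - transfer m q N (x + a)) - 2 * PI * (y - transfer m q N x))
      with (- (2 * PI * (transfer m q N (x + a) - transfer m q N x - phi x))) by ring.
    rewrite Rabs_Ropp, Rabs_mult, (Rabs_pos_eq (2 * PI)) by lra.
    destruct (Hgood N) as [He _].
    apply Rle_trans with (8 * (2 * e N)); [|lra]. apply Rmult_le_compat; try lra; [apply Rabs_pos|apply Hphi]. }
  (* Half the threshold of index j is the threshold of index 2 j + 1; the other half absorbs the
     error 16 e(N). *)
  assert (Hhalf : forall j, / INR (S (2 * j + 1)) = / INR (S j) / 2).
  { intros j. replace (S (2 * j + 1)) with (2 * S j)%nat by lia. rewrite mult_INR. simpl (INR 2). field.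
    apply not_0_INR. lia. }
  split; intros [j [K H]].
  - destruct (error_small a m q e Hgood (/ INR (S j) / 32)) as [M HM]; [pose proof (inv_INR_S_pos j); lra|].
    exists (2 * j + 1)%nat, (max K M). intros N HN. rewrite Hhalf.
    specialize (H N ltac:(lia)). specialize (HM N ltac:(lia)). specialize (Hd N). apply Rabs_le_between in Hd. lra.
  - destruct (error_small a m q e Hgood (/ INR (S j) / 32)) as [M HM]; [pose proof (inv_INR_S_pos j); lra|].
    exists (2 * j + 1)%nat, (max K M). intros N HN. rewrite Hhalf.
    specialize (H N ltac:(lia)). specialize (HM N ltac:(lia)). specialize (Hd N). apply Rabs_le_between in Hd. lra.
Qed.
End PositiveSide.

(** * Measurability and measure of the invariant set *)

Module SkewMeasure.
Import all_boot all_order all_algebra all_classical all_reals all_analysis.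
Import measurable_realfun.
Import Rstruct Rstruct_topology TorusMeasure.
Import Order.TTheory GRing.Theory Num.Theory numFieldNormedType.Exports.
Set Implicit Arguments.
Unset Strict Implicit.
Unset Printing Implicit Defensive.
Local Open Scope classical_set_scope.
Local Open Scope ring_scope.

Local Notation RR := (measurableTypeR R).

Lemma unit_squareE : (unit_square : set (RR * RR)) = cell.
Proof.
apply/seteqP; split => -[x y]; rewrite /unit_square /=.
  by move=> [[/RleP x0 /RltP x1] [/RleP y0 /RltP y1]]; apply/cellP; rewrite x0 x1 y0 y1.
by move/cellP => [/andP[/RleP ? /RltP ?] /andP[/RleP ? /RltP ?]].
Qed.

Lemma continuity_measurable (f : R -> R) : continuity f -> measurable_fun setT (f : RR -> RR).
Proof. by move=> cf; apply: continuous_measurable_fun => x; apply/continuity_pt_cvg. Qed.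

Lemma torus_measurable_full (E : R * R -> Prop) : torus_measurable E -> measurable (E : set (RR * RR)).
Proof. by move=> [pE]; rewrite unit_squareE => mE; apply: periodic_measurable mE => x y; exact: pE. Qed.

Lemma area_preserving_shear (psi : R -> R) : continuity psi -> (forall x, psi (Rplus x 1) = psi x) ->
  area_preserving (fun p => (fst p, Rplus (snd p) (psi (fst p)))).
Proof.
move=> cpsi ppsi E tE; have mE := torus_measurable_full tE; have [pE _] := tE.
have mS := shear_measurable (continuity_measurable cpsi).
split; last first.
  rewrite /muT unit_squareE; apply: (shear_measure psi mE) => x y.
  by have [_] := pE x y.
split.
  move=> x y /=; rewrite ppsi; split; first exact: (pE x _).1.
  have -> : Rplus (Rplus y 1) (psi x) = Rplus (Rplus y (psi x)) 1 by lra.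
  exact: (pE x _).2.
rewrite unit_squareE; apply: measurableI; last exact: measurable_cell.
by rewrite -[X in measurable X]setTI; exact: mS.
Qed.

Lemma measurable_positive_side m q : measurable (positive_side m q : set (RR * RR)).
Proof.
have mg N : measurable_fun setT
    (fun p : RR * RR => cos_turn (Rminus (snd p) (transfer m q N (fst p))) : RR).
  have c1 : continuity (fun x => Ropp (transfer m q N x)).
    by apply: continuity_opp; exact: transfer_continuity.
  have := measurableT_comp (continuity_measurable continuity_cos_turn)
    (measurableT_comp measurable_snd (shear_measurable (continuity_measurable c1))).
  by [].
have -> : (positive_side m q : set (RR * RR)) = \bigcup_j \bigcup_K \bigcap_(N in [set N | (K <= N)%N])
    [set p | (Rinv (INR j.+1) : R) <= cos_turn (Rminus (snd p) (transfer m q N (fst p)))].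
  apply/seteqP; split => p.
    by move=> [j [K H]]; exists j => //; exists K => // N /= /ssrnat.leP KN; apply/RleP; exact: H.
  by move=> [j _ [K _ H]]; exists j, K => N /ssrnat.leP KN; exact/RleP/(H N KN).
apply: bigcupT_measurable => j; apply: bigcupT_measurable => K.
apply: bigcap_measurable; first by exists K => /=.
by move=> N _; apply: measurable_superlevel; exact: mg.
Qed.

Lemma away_IZR (q : nat -> nat) k x (j : Z) : @away R q k x ->
  Rle (notch k) (Rabs (Rminus (Rmult (INR (q k)) x) (IZR j))).
Proof.
move=> h.
have [i ->] : exists i : int, IZR j = i%:~R.
  case: (Z_le_gt_dec 0 j) => hj.
    exists (Posz (Z.to_nat j)); rewrite -pmulrn -INRE INR_IZR_INZ Z2Nat.id //.
  exists (- Posz (Z.to_nat (- j))); rewrite mulrNz -pmulrn -INRE INR_IZR_INZ Z2Nat.id; last by lia.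
  by rewrite opp_IZR -RoppE; lra.
have := h i => /RleP; rewrite -INRE.
suff -> : notch k = gap k by [].
have e4 : IZR 4 = 4%:R by rewrite -INRE /=; lra.
have e2 : IZR 2 = 2%:R by rewrite -INRE /=; lra.
by rewrite /notch /gap e4 e2 !RdivE RinvE RpowE.
Qed.

Lemma positive_side_nontrivial m q : (forall k, (0 < q k)%coq_nat) ->
  (forall k x, (forall j : Z, Rle (notch k) (Rabs (Rminus x (IZR j)))) ->
     Rle (peak (m k) x) (pow (Rinv 2) k)) ->
  torus_measurable (positive_side m q) /\ muT (positive_side m q) <> 0%E /\ muT (positive_side m q) <> 1%E.
Proof.
move=> hq hm; have q0 k : (0 < q k)%N by exact/ssrnat.ltP/hq.
have mP := @measurable_positive_side m q.
have pP := @positive_side_periodic m q.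
split.
  split=> //; rewrite unit_squareE; apply: measurableI => //; exact: measurable_cell.
rewrite /muT unit_squareE.
apply: (@nontrivial_measure R _ (\bigcap_k @away R q k)) => //.
- exact: measurable_away_all.
- by move=> x y; exact: (pP x y).2.
- by apply: lt_le_trans (away_measure q0).
- move=> x y h h'; apply: (@positive_side_half m q x y h).
  by have -> : Rplus y (Rinv 2) = y + 2^-1 by rewrite RplusE RinvE.
- move=> x y Xx.
  have [i [/ssrnat.ltP i4 hi]] : exists i : nat, (i < 4)%coq_nat /\ positive_side m q (x, Rplus y (Rdiv (INR i) 4)).
    apply: positive_side_cover => k; apply: hm => j; apply: away_IZR; exact: Xx.
  exists (Ordinal i4) => /=.
  have e4 : IZR 4 = 4%:R by rewrite -INRE /=; lra.
  by move: hi; rewrite e4 RplusE RdivE INRE.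
Qed.
End SkewMeasure.
Import SkewMeasure.

(** * Perturbing a conjugate of the rotation *)

Lemma skew_ext_zero rho eta : 0 <= eta -> skew_ext rho eta (fun _ => 0) (fun _ => RtoC 0) 0.
Proof.
  intros He. split; [|split].
  - intros z _. apply cdiff_const.
  - reflexivity.
  - intros z _. rewrite Im_RtoC, Rabs_R0, Cmod_0. lra.
Qed.

Lemma skew_ext_inverse rho eta phi phic B a : skew_ext rho eta phi phic B ->
  skew_ext rho eta (fun x => - phi (x - a)) (fun z => - phic (z - RtoC a))%C B.
Proof.
  intros [H1 [H2 H3]].
  assert (HI : forall z, Im (z - RtoC a) = Im z) by (intros [x y]; simpl; ring).
  split; [|split].
  - intros z Hz. apply cdiff_opp. apply (cdiff_comp phic (fun u => u - RtoC a)%C).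
    + apply cdiff_minus; [apply cdiff_id|apply cdiff_const].
    + apply H1. rewrite HI; auto.
  - intros x. rewrite <- RtoC_minus, H2, RtoC_opp. reflexivity.
  - intros z Hz. rewrite Rabs_Im_opp, Cmod_opp. apply H3. rewrite HI; auto.
Qed.

(** The transfer function may be large, but it is real on the real line, so its imaginary part falls
    below [eta] on a thin strip. This is why [eta] has to be given before the width [rho]. *)
Lemma skew_ext_transfer m q N eta : 0 < eta -> exists rho B, 0 < rho /\
  skew_ext rho eta (transfer m q N) (transferc m q N) B /\
  skew_ext rho eta (fun x => - transfer m q N x) (fun z => - transferc m q N z)%C B.
Proof.
  intros He. destruct (transferc_bounded m q N 1 Rle_0_1) as [B HB].
  assert (HB0 : 0 <= B).
  { eapply Rle_trans; [apply Cmod_ge_0|apply (HB 0%C)]. rewrite Im_RtoC, Rabs_R0; lra. }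
  (* On the strip of width 1/2 the Lipschitz constant is 32 B; the summand 1 covers B = 0. *)
  set (rho := Rmin (1 / 2) (eta / (32 * B + 1))).
  assert (Hrho : 0 < rho) by (apply Rmin_pos; [lra|apply Rdiv_lt_0_compat; lra]).
  assert (Hr1 : rho <= 1 / 2) by apply Rmin_l.
  assert (Hr2 : rho * (32 * B + 1) <= eta) by (apply Rle_div_r; [lra|apply Rmin_r]).
  assert (HI : forall z, Rabs (Im z) < rho -> Rabs (Im (transferc m q N z)) <= eta /\ Cmod (transferc m q N z) <= B).
  { intros z Hz. split; [|apply HB; lra].
    assert (HL : Cmod (transferc m q N z - transferc m q N (RtoC (Re z))) <= 32 * B / 1 * Cmod (z - RtoC (Re z))).
    { apply (holo1_lipschitz 1); try lra.
      - intros u _. apply cdiff_transferc.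
      - intros u Hu. apply HB. lra.
      - rewrite Im_RtoC, Rabs_R0. lra. }
    rewrite Cmod_sub_Re, transferc_RtoC in HL.
    pose proof (Im_le_Cmod (transferc m q N z - RtoC (transfer m q N (Re z)))) as HI.
    replace (Im (transferc m q N z - RtoC (transfer m q N (Re z)))) with (Im (transferc m q N z)) in HI
      by (destruct (transferc m q N z); simpl; ring).
    pose proof (Rabs_pos (Im z)). replace (32 * B / 1) with (32 * B) in HL by field. nra. }
  exists rho, B. split; auto. split.
  - split; [|split; auto].
    + intros z _. apply cdiff_transferc.
    + intros x. apply transferc_RtoC.
  - split; [|split].
    + intros z _. apply cdiff_opp, cdiff_transferc.
    + intros x. rewrite transferc_RtoC, RtoC_opp. reflexivity.
    + intros z Hz. rewrite Rabs_Im_opp, Cmod_opp. auto.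
Qed.

Lemma gen_lift_id : gen_lift 1 0 0 1 1 (fun p => p).
Proof.
  assert (E1 : (fun x y : R => fst (x, y) - (IZR 1 * x + IZR 0 * y)) = (fun _ _ => 0)).
  { do 2 (apply functional_extensionality; intro). simpl. ring. }
  assert (E2 : (fun x y : R => snd (x, y) - (IZR 0 * x + IZR 1 * y)) = (fun _ _ => 0)).
  { do 2 (apply functional_extensionality; intro). simpl. ring. }
  assert (HE : holo_ext 1 (fun _ _ => 0)).
  { exists 0. apply holo_ext_bounded_byP. exists (fun _ _ => RtoC 0).
    split; [apply holo2_const|split; [reflexivity|]]. intros z w _ _. rewrite Cmod_0. lra. }
  unfold gen_lift. cbv zeta. rewrite E1, E2. repeat split; auto.
Qed.

Lemma gen_lift_continuous a b c d r S x y eps : 0 < r -> gen_lift a b c d r S -> 0 < eps ->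
  exists delta, 0 < delta /\ forall x' y', Rabs (x' - x) < delta -> Rabs (y' - y) < delta ->
    Rabs (fst (S (x', y')) - fst (S (x, y))) < eps /\ Rabs (snd (S (x', y')) - snd (S (x, y))) < eps.
Proof.
  intros Hr [_ [_ [[M1 E1] [M2 E2]]]] He.
  assert (Hgen : forall (f : R -> R -> R) (u v M : R),
    holo_ext_bounded_by r (fun x y => f x y - (u * x + v * y)) M ->
    exists delta, 0 < delta /\ forall x' y', Rabs (x' - x) < delta -> Rabs (y' - y) < delta ->
      Rabs (f x' y' - f x y) < eps).
  { intros f u v M HE. apply holo_ext_bounded_byP in HE as [g [Hg [Hreal _]]].
    destruct (Hg (RtoC x) (RtoC y)) as [Hj _]; [rewrite Im_RtoC, Rabs_R0; auto..|].
    destruct (Hj (eps / 2)) as [d1 [Hd1 Hx]]; [lra|].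
    set (L := Rabs u + Rabs v + 1). assert (HL : 0 < L) by (unfold L; pose proof (Rabs_pos u); pose proof (Rabs_pos v); lra).
    exists (Rmin d1 (eps / (2 * L))). split.
    { apply Rmin_pos; auto. apply Rdiv_lt_0_compat; lra. }
    intros x' y' Hx' Hy'. apply Rmin_Rgt in Hx' as [Hx1 Hx2]. apply Rmin_Rgt in Hy' as [Hy1 Hy2].
    specialize (Hx (RtoC x') (RtoC y')). rewrite <- !RtoC_minus, !Cmod_R in Hx. specialize (Hx Hx1 Hy1).
    rewrite !Hreal, <- RtoC_minus, Cmod_R in Hx.
    replace (f x' y' - f x y) with ((f x' y' - (u * x' + v * y') - (f x y - (u * x + v * y))) + (u * (x' - x) + v * (y' - y))) by ring.
    eapply Rle_lt_trans; [apply Rabs_triang|].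
    pose proof (Rabs_triang (u * (x' - x)) (v * (y' - y))) as T. rewrite !Rabs_mult in T.
    assert (Rabs u * Rabs (x' - x) <= Rabs u * (eps / (2 * L))) by (apply Rmult_le_compat_l; [apply Rabs_pos|lra]).
    assert (Rabs v * Rabs (y' - y) <= Rabs v * (eps / (2 * L))) by (apply Rmult_le_compat_l; [apply Rabs_pos|lra]).
    assert (Hh : (Rabs u + Rabs v) * (eps / (2 * L)) <= eps / 2).
    { apply Rle_trans with (L * (eps / (2 * L))); [|right; field; lra].
      apply Rmult_le_compat_r; [left; apply Rdiv_lt_0_compat; lra|unfold L; lra]. }
    lra. }
  destruct (Hgen (fun x y => fst (S (x, y))) (IZR a) (IZR b) M1 E1) as [d1 [Hd1 H1]].
  destruct (Hgen (fun x y => snd (S (x, y))) (IZR c) (IZR d) M2 E2) as [d2 [Hd2 H2]].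
  exists (Rmin d1 d2). split; [apply Rmin_pos; auto|]. intros x' y' Hx Hy.
  apply Rmin_Rgt in Hx as [? ?]. apply Rmin_Rgt in Hy as [? ?]. auto.
Qed.

(** Comparing S o T at the origin and at an integer vector shows that the product of the matrices
    fixes that vector. Hence the conjugated skew products are homotopic to the identity. *)
Lemma gen_lift_inverse_matrix a b c d r T a' b' c' d' r' S :
  gen_lift a b c d r T -> gen_lift a' b' c' d' r' S -> (forall p, S (T p) = p) ->
  (a' * a + b' * c = 1 /\ a' * b + b' * d = 0 /\ c' * a + d' * c = 0 /\ c' * b + d' * d = 1)%Z.
Proof.
  intros HT HS E.
  assert (Hcol : forall m n : Z,
    (IZR m, IZR n) = (IZR (a' * (a * m + b * n) + b' * (c * m + d * n)), IZR (c' * (a * m + b * n) + d' * (c * m + d * n)))).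
  { intros m n. rewrite <- (E (IZR m, IZR n)) at 1.
    replace (IZR m, IZR n) with (0 + IZR m, 0 + IZR n) by (f_equal; ring).
    rewrite (gen_lift_translate a b c d r T m n 0 0 HT), <- !mult_IZR, <- !plus_IZR.
    rewrite (gen_lift_translate a' b' c' d' r' S _ _ _ _ HS).
    rewrite <- surjective_pairing, E. simpl fst. simpl snd.
    rewrite !Rplus_0_l, <- !mult_IZR, <- !plus_IZR. reflexivity. }
  pose proof (Hcol 1%Z 0%Z) as H1. pose proof (Hcol 0%Z 1%Z) as H2.
  apply pair_equal_spec in H1 as [H11 H12]. apply pair_equal_spec in H2 as [H21 H22].
  apply eq_IZR in H11, H12, H21, H22. nia.
Qed.

Lemma lift_r_of_gen_lift r F : gen_lift 1 0 0 1 r F -> lift_r r F.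
Proof.
  intros [H1 [H2 [H3 H4]]].
  assert (E1 : disp1 F = (fun x y => fst (F (x, y)) - (IZR 1 * x + IZR 0 * y))).
  { do 2 (apply functional_extensionality; intro). unfold disp1. ring. }
  assert (E2 : disp2 F = (fun x y => snd (F (x, y)) - (IZR 0 * x + IZR 1 * y))).
  { do 2 (apply functional_extensionality; intro). unfold disp2. ring. }
  unfold lift_r. rewrite E1, E2. auto.
Qed.

Lemma skewK a1 b1 phi p :
  skew (- a1) (- b1) (fun x => - phi (x - a1)) (skew a1 b1 phi p) = p /\
  skew a1 b1 phi (skew (- a1) (- b1) (fun x => - phi (x - a1)) p) = p.
Proof.
  destruct p as [x y]. unfold skew; simpl. split.
  - replace (x + a1 - a1) with x by ring. f_equal; ring.
  - replace (x + - a1) with (x - a1) by ring. f_equal; ring.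
Qed.

Lemma iter_conj (S T K : R * R -> R * R) : (forall p, T (S p) = p) -> (forall p, S (T p) = p) ->
  forall n p, Nat.iter n (fun p => S (K (T p))) p = S (Nat.iter n K (T p)).
Proof.
  intros H1 H2 n p. induction n as [|n IH]; simpl; [auto|]. rewrite IH, H1. reflexivity.
Qed.

Lemma notch_bound k : 0 < notch k < / 2.
Proof.
  unfold notch. assert (H : 1 <= 2 ^ S k) by (apply pow_R1_Rle; lra).
  split.
  - apply Rdiv_lt_0_compat; [|lra]. apply Rdiv_lt_0_compat; lra.
  - apply Rlt_div_l; [lra|]. apply Rlt_div_l; lra.
Qed.

Lemma exists_peak_exponents : exists m : nat -> nat, (forall k, (1 <= m k)%nat) /\
  forall k x, (forall j : Z, notch k <= Rabs (x - IZR j)) -> peak (m k) x <= (/ 2) ^ k.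
Proof.
  destruct (exists_choice (fun k m => (1 <= m)%nat /\
    forall x, (forall j : Z, notch k <= Rabs (x - IZR j)) -> peak m x <= (/ 2) ^ k)) as [m Hm].
  { intros k. apply peak_localized; [apply notch_bound|]. apply pow_lt. lra. }
  exists m. split; intros k; apply Hm.
Qed.

Section Perturbation.
Variables (alpha : R) (T S : R * R -> R * R) (a b c d : Z) (rT : R) (a' b' c' d' : Z) (rS : R) (k1 k2 : Z).
Hypotheses (HrT : 0 < rT) (HrS : 0 < rS) (HT : gen_lift a b c d rT T) (HS : gen_lift a' b' c' d' rS S).
Hypotheses (TS : forall p, T (S p) = p) (ST : forall p, S (T p) = p) (HTarea : area_preserving T).

(** The integers [k1] and [k2] are those of [A_alpha], where the conjugacy holds on lifts only up to
    an integer translation. *)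
Definition conj_skew (phi : R -> R) (p : R * R) : R * R := S (skew (alpha + IZR k1) (IZR k2) phi (T p)).

(** Provides one width r and one constant K for all admissible cocycles on the strip of width 1, so
    that neighbourhoods in [tau] reduce to a single metric. *)
Lemma conj_skew_family : exists eta r K, 0 < eta /\ 0 < r /\ 0 < K /\
  (forall phi phic B, skew_ext 1 eta phi phic B -> (forall x, phi (x + 1) = phi x) -> Diff_r r (conj_skew phi)) /\
  (forall phi phic B phi' phic' B' e eps, skew_ext 1 eta phi phic B -> skew_ext 1 eta phi' phic' B' ->
     (forall u, Rabs (Im u) < 1 -> Cmod (phic u - phic' u) <= e) -> K * e < eps ->
     dist_r_lt r (conj_skew phi) (conj_skew phi') eps).
Proof.
  destruct (conj_skew_lift a b c d rT T a' b' c' d' rS S HrT HrS HT HS) as [eta [Heta H]].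
  destruct (H 1 Rlt_0_1) as [r [K [Hr [HK [H1 H2]]]]].
  destruct (gen_lift_inverse_matrix _ _ _ _ _ _ _ _ _ _ _ _ HT HS ST) as [I1 [I2 [I3 I4]]].
  rewrite I1, I2, I3, I4 in H1.
  exists eta, r, K. do 3 (split; auto). split.
  - intros phi phic B Hphi Hper.
    assert (L1 : lift_r r (conj_skew phi)) by (apply lift_r_of_gen_lift, (H1 _ _ _ _ _ Hphi Hper)).
    split; auto. split; [exists r; auto|].
    set (A := alpha + IZR k1) in *.
    exists (fun p => S (skew (- A) (- IZR k2) (fun x => - phi (x - A)) (T p))). split; [|split].
    + exists r. split; auto. apply lift_r_of_gen_lift. eapply H1; [apply skew_ext_inverse, Hphi|].
      intros x. f_equal. replace (x + 1 - A) with (x - A + 1) by ring. apply Hper.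
    + intros p. unfold conj_skew. fold A. rewrite TS, (proj2 (skewK A (IZR k2) phi _)). apply ST.
    + intros p. unfold conj_skew. fold A. rewrite TS, (proj1 (skewK A (IZR k2) phi _)). apply ST.
  - intros phi phic B phi' phic' B' e eps Hphi Hphi' He Heps. exists (K * e). split; auto.
    destruct (H2 (alpha + IZR k1) (IZR k2) _ _ _ _ _ _ _ Hphi Hphi' He) as [E1 E2]. split.
    + eapply holo_ext_bounded_ext; [|apply E1]. intros x y. unfold disp1, conj_skew. ring.
    + eapply holo_ext_bounded_ext; [|apply E2]. intros x y. unfold disp2, conj_skew. ring.
Qed.

(** Following T by the shear y - psi(x) turns the skew product over psi(x + alpha) - psi(x) into the
    rotation, and shears preserve area. *)
Lemma conj_skew_coboundary_in_A_alpha m q N :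
  InDiff (conj_skew (fun x => transfer m q N (x + alpha) - transfer m q N x)) ->
  A_alpha alpha (conj_skew (fun x => transfer m q N (x + alpha) - transfer m q N x)).
Proof.
  intros HD. split; auto.
  set (psi := transfer m q N).
  assert (Hpsi1 : forall x, psi (x + 1) = psi x) by (intros; apply (transfer_Z m q N x 1)).
  (* The identity is written out so that T' and S' have the shape S o [skew] o T to which
     [conj_skew_lift] applies. *)
  set (T' := fun p => (fun p => p) (skew 0 0 (fun x => - psi x) (T p))).
  set (S' := fun p => S (skew 0 0 psi ((fun p => p) p))).
  exists T'. split; [|split].
  - split; [|exists S'; split; [|split]].
    + destruct (conj_skew_lift _ _ _ _ _ _ _ _ _ _ _ _ HrT Rlt_0_1 HT gen_lift_id) as [eta [He H]].
      destruct (skew_ext_transfer m q N eta He) as [rho [B [Hrho [_ Hext]]]].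
      destruct (H rho Hrho) as [r [K [Hr [_ [HL _]]]]].
      do 4 eexists. exists r. split; auto. apply (HL 0 0 _ _ _ Hext).
      intros x. f_equal. apply Hpsi1.
    + destruct (conj_skew_lift _ _ _ _ _ _ _ _ _ _ _ _ Rlt_0_1 HrS gen_lift_id HS) as [eta [He H]].
      destruct (skew_ext_transfer m q N eta He) as [rho [B [Hrho [Hext _]]]].
      destruct (H rho Hrho) as [r [K [Hr [_ [HL _]]]]].
      do 4 eexists. exists r. split; auto. apply (HL 0 0 _ _ _ Hext). exact Hpsi1.
    + intros p. unfold T', S'. rewrite TS. destruct p as [x y]. unfold skew; simpl.
      rewrite !Rplus_0_r. f_equal. ring.
    + intros p. unfold T', S'. rewrite <- (ST p) at 2. f_equal. destruct (T p) as [x y]. unfold skew; simpl.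
      rewrite !Rplus_0_r. f_equal. ring.
  - assert (Hsh : area_preserving (fun p => (fst p, snd p + - psi (fst p)))).
    { apply (@area_preserving_shear (fun x => - psi x)).
      - apply continuity_opp. apply transfer_continuity.
      - intros x. f_equal. apply Hpsi1. }
    intros E HE. destruct (Hsh E HE) as [M1 M2]. destruct (HTarea _ M1) as [M3 M4].
    replace (fun p => E (T' p)) with (fun p => E (fst (T p), snd (T p) + - psi (fst (T p)))).
    + split; auto. rewrite <- M2. exact M4.
    + apply functional_extensionality. intros p. f_equal. unfold T', skew. rewrite !Rplus_0_r. reflexivity.
  - exists k1, k2. intros p. unfold T', conj_skew. rewrite TS. destruct (T p) as [x y]. unfold skew; simpl.
    fold psi. replace (x + (alpha + IZR k1)) with (x + alpha + IZR k1) by ring.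
    unfold psi at 3. rewrite transfer_Z. fold psi. rewrite !Rplus_0_r. f_equal. ring.
Qed.

(** The orbit of T p approaches T z modulo integers. Continuity of S at T z carries this back, and
    integer translations become integer translations through the matrix of S. Forward orbits
    suffice. *)
Lemma conj_skew_minimal m q e phi : (forall k, good_step alpha m q e k) ->
  (forall N x, Rabs (transfer m q N (x + alpha) - transfer m q N x - phi x) <= 2 * e N) ->
  (forall k, (1 <= m k)%nat) -> minimal (conj_skew phi).
Proof.
  intros Hgood Hphi Hm p z eps He.
  destruct (T z) as [x0 y0] eqn:Ez.
  destruct (gen_lift_continuous _ _ _ _ _ _ x0 y0 eps HrS HS He) as [delta [Hdelta Hc]].
  destruct (T p) as [x y] eqn:Ep.
  destruct (skew_orbit_dense alpha m q e Hgood phi Hphi Hm k1 k2 x y x0 y0 delta Hdelta) as [n [j1 [j2 [D1 D2]]]].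
  exists (Nat.iter n (conj_skew phi) p). split; [left; exists n; reflexivity|].
  unfold conj_skew. rewrite (iter_conj S T (skew (alpha + IZR k1) (IZR k2) phi) TS ST), Ep.
  destruct (Nat.iter n (skew (alpha + IZR k1) (IZR k2) phi) (x, y)) as [u v]. cbn [fst snd] in D1, D2.
  destruct (Hc _ _ D1 D2) as [C1 C2].
  rewrite (gen_lift_translate _ _ _ _ _ _ j1 j2 u v HS) in C1, C2. rewrite <- Ez, ST in C1, C2. cbn [fst snd] in C1, C2.
  exists (a' * j1 + b' * j2)%Z, (c' * j1 + d' * j2)%Z. rewrite !plus_IZR, !mult_IZR. auto.
Qed.

(** The witness is the preimage under T of [positive_side]; area preservation keeps its measure away
    from 0 and 1. *)
Lemma conj_skew_not_ergodic m q e phi : (forall k, good_step alpha m q e k) ->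
  (forall N x, Rabs (transfer m q N (x + alpha) - transfer m q N x - phi x) <= 2 * e N) ->
  (forall k x, (forall j : Z, notch k <= Rabs (x - IZR j)) -> peak (m k) x <= (/ 2) ^ k) ->
  ~ ergodic_leb (conj_skew phi).
Proof.
  intros Hgood Hphi Hpeak Herg.
  destruct (@positive_side_nontrivial m q) as [M [N0 N1]]; auto.
  { intros k. destruct (Hgood k) as [_ [_ [Hq _]]]. lia. }
  destruct (HTarea _ M) as [M' E]. rewrite <- E in N0, N1.
  destruct (Herg _ M') as [H|H]; auto.
  intros p. unfold conj_skew. rewrite TS. apply (positive_side_invariant m q alpha e phi Hgood Hphi).
Qed.

Lemma dense_perturbation (O : (R * R -> R * R) -> Prop) : (forall n, well_approx n alpha) ->
  tau_open O -> O (conj_skew (fun _ => 0)) ->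
  exists F, O F /\ tau_closure (A_alpha alpha) F /\ minimal F /\ ~ ergodic_leb F.
Proof.
  intros Ha HO HG.
  destruct conj_skew_family as [eta [r [K [Heta [Hr [HK [HD Hdist]]]]]]].
  assert (Z0 := skew_ext_zero 1 eta (Rlt_le _ _ Heta)).
  destruct (proj2 HO r Hr _ HG (HD _ _ _ Z0 (fun _ => eq_refl))) as [eps [Heps Hball]].
  destruct exists_peak_exponents as [m [Hm Hpeak]].
  (* All cocycles are bounded by 2 [e0]: at most [eta], so they are admissible, and at distance at
     most K 2 [e0] <= eps / 2 from the unperturbed map. *)
  set (e0 := Rmin (eta / 2) (eps / (4 * K))).
  assert (He0 : 0 < e0) by (apply Rmin_pos; [lra|apply Rdiv_lt_0_compat; lra]).
  assert (He1 : e0 <= eta / 2) by apply Rmin_l.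
  assert (He2 : e0 * (4 * K) <= eps) by (apply Rle_div_r; [lra|apply Rmin_r]).
  destruct (frequencies_exist alpha m e0 Ha He0) as [q [e [Ee Hgood]]].
  destruct (cocycle_limit alpha m q e Hgood) as [phi [phic [Hol [Hreal Hlim]]]].
  assert (Hphi : forall N x, Rabs (transfer m q N (x + alpha) - transfer m q N x - phi x) <= 2 * e N).
  { intros N x. specialize (Hlim N (RtoC x)). rewrite cocyclec_RtoC, Hreal, <- RtoC_minus, Cmod_R in Hlim.
    apply Hlim. rewrite Im_RtoC, Rabs_R0. lra. }
  assert (Hbd : forall z, Rabs (Im z) < 1 -> Cmod (phic z) <= 2 * e0).
  { intros z Hz. rewrite <- Ee. replace (phic z) with (- (cocyclec m q alpha 0 z - phic z))%C
      by (unfold cocyclec; simpl; ring). rewrite Cmod_opp. apply Hlim; auto. }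
  assert (HbdN : forall N z, Rabs (Im z) < 1 -> Cmod (cocyclec m q alpha N z) <= 2 * e0).
  { intros N z Hz. rewrite <- Ee. replace (cocyclec m q alpha N z) with (cocyclec m q alpha N z - cocyclec m q alpha 0 z)%C
      by (unfold cocyclec at 2; simpl; ring). apply (cocyclec_tail_le alpha m q e Hgood); auto. lia. }
  assert (Xphi : skew_ext 1 eta phi phic (2 * e0)).
  { split; [auto|split; auto]. intros z Hz. split; auto.
    eapply Rle_trans; [apply Im_le_Cmod|]. specialize (Hbd z Hz). lra. }
  assert (XN : forall N, skew_ext 1 eta (fun x => transfer m q N (x + alpha) - transfer m q N x) (cocyclec m q alpha N) (2 * e0)).
  { intros N. split; [|split].
    - intros z _. apply cdiff_cocyclec.
    - intros x. apply cocyclec_RtoC.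
    - intros z Hz. split; auto. eapply Rle_trans; [apply Im_le_Cmod|]. specialize (HbdN N z Hz). lra. }
  assert (PN : forall N x, (fun x => transfer m q N (x + alpha) - transfer m q N x) (x + 1) =
     (fun x => transfer m q N (x + alpha) - transfer m q N x) x).
  { intros N x. cbv beta. replace (x + 1 + alpha) with (x + alpha + 1) by ring.
    change 1 with (IZR 1). rewrite !transfer_Z. reflexivity. }
  pose proof (HD _ _ _ Xphi (phi_periodic alpha m q e Hgood phi Hphi)) as Dphi.
  assert (DN := fun N => HD _ _ _ (XN N) (PN N)).
  exists (conj_skew phi). split; [|split; [|split]].
  - apply Hball; auto. apply (Hdist _ _ _ _ _ _ (2 * e0) eps Z0 Xphi).
    + intros u Hu. replace (RtoC 0 - phic u)%C with (- phic u)%C by ring. rewrite Cmod_opp. auto.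
    + nra.
  - split; [apply Dphi|]. intros O' HO' HF.
    (* The limit and all truncations lie in the same [Diff_r], so the openness of O' is needed for
       this r only. *)
    destruct (proj2 HO' r Hr _ HF Dphi) as [eps' [Heps' Hball']].
    destruct (error_small alpha m q e Hgood (eps' / (2 * K))) as [N HN]; [apply Rdiv_lt_0_compat; lra|].
    specialize (HN N (le_n N)). apply Rlt_div_r in HN; [|lra].
    exists (conj_skew (fun x => transfer m q N (x + alpha) - transfer m q N x)). split.
    + apply Hball'; [apply DN|]. apply (Hdist _ _ _ _ _ _ (2 * e N) eps' Xphi (XN N)).
      * intros u Hu. rewrite Cmod_sub_sym. apply Hlim; auto.
      * lra.
    + apply conj_skew_coboundary_in_A_alpha. apply DN.
  - apply (conj_skew_minimal m q e phi Hgood Hphi Hm).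
  - apply (conj_skew_not_ergodic m q e phi Hgood Hphi Hpeak).
Qed.
End Perturbation.

Theorem theoremB :
  exists E : R -> Prop,
    (* E is a G_delta subset of [0,1] (countable intersection of relatively open sets) *)
    (exists U : nat -> (R -> Prop),
        (forall n, open_set (U n)) /\
        (forall a, E a <-> ((0 <= a <= 1) /\ forall n, U n a))) /\
    (* E is dense in [0,1] *)
    (forall x, 0 <= x <= 1 -> forall eps, 0 < eps -> exists e, E e /\ Rabs (e - x) < eps) /\
    forall alpha, E alpha ->
      exists D : (R * R -> R * R) -> Prop,
        (forall F, D F -> tau_closure (A_alpha alpha) F) /\
        (forall F, tau_closure (A_alpha alpha) F ->
           forall O, tau_open O -> O F -> exists G, O G /\ D G) /\
        (forall F, D F -> minimal F /\ ~ ergodic_leb F).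
Proof.
  exists (fun a => (0 <= a <= 1) /\ forall n, well_approx n a). split; [|split].
  - exists well_approx. split; [apply well_approx_open|]. intros a; tauto.
  - intros x Hx eps He. destruct (well_approx_dense x eps Hx He) as [a [H1 [H2 H3]]]. exists a. auto.
  - intros alpha [_ Ha].
    (* All minimal and non-ergodic maps of the closure are taken, so only density remains. *)
    exists (fun F => tau_closure (A_alpha alpha) F /\ minimal F /\ ~ ergodic_leb F).
    split; [tauto|]. split; [|tauto].
    (* An open set around a point of the closure already contains some G in [A_alpha], so only
       members of [A_alpha] have to be perturbed; G is [conj_skew] of the zero cocycle. *)
    intros F [_ HF] O HO HOF. destruct (HF O HO HOF) as [G [HOG [HG [T [[GT [S [GS [TS ST]]]] [AT [k1 [k2 EG]]]]]]]].
    destruct GT as [a [b [c [d [rT [HrT HT]]]]]]. destruct GS as [a' [b' [c' [d' [rS [HrS HS]]]]]].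
    apply (dense_perturbation alpha T S a b c d rT a' b' c' d' rS k1 k2 HrT HrS HT HS TS ST AT O Ha HO).
    replace (conj_skew alpha T S k1 k2 (fun _ => 0)) with G; auto.
    apply functional_extensionality. intros p. rewrite <- (ST (G p)), EG. unfold conj_skew, skew. f_equal.
    apply injective_projections; simpl; ring.
Qed.
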